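(* The isomorphism problem is decidable for finite index subgroups of the groups $G_{1,q}^d$, where $q,d$ range over the positive integers. That is, there is an algorithm which, given positive integers $q_1,d_1,q_2,d_2$, a finite index subgroup $H_1\le G_{1,q_1}^{d_1}$ and a finite index subgroup $H_2\le G_{1,q_2}^{d_2}$ (each $H_i$ given by a finite generating set), decides whether or not $H_1$ and $H_2$ are isomorphic.
   Context: For positive integers $q,d$, the group $G_{1,q}^d$ is defined by the presentation $$G_{1,q}^d=\langle a,t_1,\dots,t_d \mid t_i^{-1}a\,t_i=a^{q},\ i=1,\dots,d\rangle .$$ A finite generating set of a subgroup of $G_{1,q}^d$ is given as a finite list of words in the generators $a,t_1,\dots,t_d$ and their inverses. The input subgroups are promised to have finite index. *)

(* Defs.v *)
From HB Require Import structures.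
From mathcomp Require Import all_boot generic_quotient.
From mathcomp Require Import boolp classical_sets functions cardinality.

Set Implicit Arguments.
Unset Strict Implicit.
Unset Printing Implicit Defensive.

Local Open Scope classical_set_scope.
Local Open Scope quotient_scope.

(** * Partial recursive functions *)

(* Kleene's mu-recursive programs with [k] arguments.  A family of [m] programs
   is a function on ['I_m], so a program is a finite object. *)
Inductive recfun : nat -> Type :=
| RZero k : recfun k
| RSucc : recfun 1
| RProj k (i : 'I_k) : recfun k
| RComp m k (f : recfun m) (g : 'I_m -> recfun k) : recfun k
| RPrim k (f : recfun k) (g : recfun k.+2) : recfun k.+1
| RMu k (f : recfun k.+1) : recfun k.

(* [rec_eval f v y]: the program [f] halts on input [v] with output [y].
   Primitive recursion is on the first argument, [g] being applied to
   (counter, previous value, parameters), and [RMu f] computes the least [y]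
   with [f (y, v) = 0], all the earlier values of [f] being defined. *)
Fixpoint rec_eval k (f : recfun k) : k.-tuple nat -> nat -> Prop :=
  match f with
  | RZero k => fun _ y => y = 0
  | RSucc => fun v y => y = (thead v).+1
  | RProj k i => fun v y => y = tnth v i
  | RComp m k f g => fun v y =>
      exists2 w : m.-tuple nat,
        forall i, rec_eval (g i) v (tnth w i) & rec_eval f w y
  | RPrim k f g => fun v y =>
      let p := [tuple of behead v] in
      exists s : nat -> nat,
        [/\ rec_eval f p (s 0),
            forall i, i < thead v ->
              rec_eval g [tuple of i :: s i :: p] (s i.+1)
          & y = s (thead v)]
  | RMu k f => fun v y =>
      rec_eval f [tuple of y :: v] 0 /\
      forall i, i < y -> exists z, rec_eval f [tuple of i :: v] z.+1
  end.

(** * Groups given by a presentation *)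

(* The letter [(x, false)] stands for [x] and [(x, true)] for its inverse. *)
Definition word (X : Type) := seq (X * bool).

Section Presentation.

Variables (X : choiceType) (R : word X -> word X -> Prop).

Inductive word_cong : word X -> word X -> Prop :=
| cong_rel u v : R u v -> word_cong u v
| cong_inv x b : word_cong [:: (x, b); (x, ~~ b)] [::]
| cong_refl u : word_cong u u
| cong_sym u v : word_cong u v -> word_cong v u
| cong_trans u v w : word_cong u v -> word_cong v w -> word_cong u w
| cong_cat u u' v v' :
    word_cong u u' -> word_cong v v' -> word_cong (u ++ v) (u' ++ v').

Definition word_eqv (u v : word X) : bool := `[< word_cong u v >].

Lemma word_eqv_refl : reflexive word_eqv.
Proof. by move=> u; apply/asboolP; apply: cong_refl. Qed.

Lemma word_eqv_sym : symmetric word_eqv.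
Proof. by move=> u v; apply/asboolP/asboolP; apply: cong_sym. Qed.

Lemma word_eqv_trans : transitive word_eqv.
Proof.
by move=> v u w /asboolP uv /asboolP vw; apply/asboolP; apply: cong_trans vw.
Qed.

Canonical word_eqv_equiv :=
  EquivRel word_eqv word_eqv_refl word_eqv_sym word_eqv_trans.

Definition presented := {eq_quot word_eqv}.

HB.instance Definition _ := Choice.on presented.

Definition pword (u : word X) : presented := \pi_({eq_quot word_eqv}) u.

Definition inv_word (u : word X) : word X :=
  rev [seq (l.1, ~~ l.2) | l <- u].

Definition pmul (x y : presented) : presented := pword (repr x ++ repr y).
Definition pone : presented := pword [::].
Definition pinv (x : presented) : presented := pword (inv_word (repr x)).

Lemma pwordP u v : pword u = pword v <-> word_cong u v.
Proof.
split=> [/eqquotP/asboolP //|uv]; by apply/eqquotP/asboolP.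
Qed.

Lemma repr_pword u : word_cong (repr (pword u)) u.
Proof. by apply/pwordP; rewrite {1}/pword reprK. Qed.

Lemma pword_repr x : pword (repr x) = x.
Proof. exact: reprK. Qed.

Lemma pwordM u v : pmul (pword u) (pword v) = pword (u ++ v).
Proof. by apply/pwordP; apply: cong_cat; apply: repr_pword. Qed.

Lemma inv_word_cat u v : inv_word (u ++ v) = inv_word v ++ inv_word u.
Proof. by rewrite /inv_word map_cat rev_cat. Qed.

Lemma inv_wordK : involutive inv_word.
Proof.
move=> u; rewrite /inv_word map_rev revK -map_comp -[RHS]map_id.
by apply: eq_map => -[x b] /=; rewrite negbK.
Qed.

Lemma cong_inv_word u : word_cong (u ++ inv_word u) [::].
Proof.
elim: u => [|[x b] u IH]; first exact: cong_refl.
rewrite -cat1s inv_word_cat -catA (catA u).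
apply: cong_trans (cong_inv x b).
rewrite -[X in word_cong _ X]/([:: (x, b)] ++ [::] ++ [:: (x, ~~ b)]).
by apply: cong_cat; [apply: cong_refl | apply: cong_cat => //; apply: cong_refl].
Qed.

Lemma pmulA : associative pmul.
Proof.
move=> x y z; rewrite -(pword_repr x) -(pword_repr y) -(pword_repr z).
by rewrite !pwordM catA.
Qed.

Lemma pmul1 : left_id pone pmul.
Proof. by move=> x; rewrite -(pword_repr x) pwordM. Qed.

Lemma pmulr1 : right_id pone pmul.
Proof. by move=> x; rewrite -(pword_repr x) pwordM cats0. Qed.

Lemma pmulV : left_inverse pone pinv pmul.
Proof.
move=> x; rewrite -{2}(pword_repr x) pwordM; apply/pwordP.
by rewrite -{2}(inv_wordK (repr x)); apply: cong_inv_word.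
Qed.

Lemma pmulrV : right_inverse pone pinv pmul.
Proof.
move=> x; rewrite -{1}(pword_repr x) pwordM; apply/pwordP.
exact: cong_inv_word.
Qed.

HB.instance Definition _ :=
  isGroup.Build presented pmulA pmul1 pmulr1 pmulV pmulrV.

End Presentation.

(** * Subgroups *)

Section Subgroups.

Local Open Scope group_scope.

Definition gen_subgroup (G : groupType) (S : set G) : set G :=
  smallest [set A : set G | group_closed [in A]] S.

Definition finite_index (G : groupType) (A : set G) : Prop :=
  finite_set (range (fun x : G => [set x * y | y in A])).

(* [f] is only relevant on [A]; every isomorphism from [A] to [B] is the
   restriction of such a function. *)
Definition subgroups_isomorphic (G1 G2 : groupType)
    (A : set G1) (B : set G2) : Prop :=
  exists f : G1 -> G2,
    {in A &, {morph f : x y / x * y}} /\ set_bij A B f.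

End Subgroups.

(** * The groups [G_{1,q}^d] *)

(* [None] is the generator [a] and [Some i] is [t_{i+1}]. *)
Definition gen (d : nat) := option 'I_d.

Inductive G1_rel (q d : nat) : word (gen d) -> word (gen d) -> Prop :=
  G1_relI (i : 'I_d) :
    G1_rel q [:: (Some i, true); (None, false); (Some i, false)]
             (nseq q (None, false)).

Definition G1 (q d : nat) : groupType := presented (@G1_rel q d).

Definition subgroup_of_words q d (L : seq (word (gen d))) : set (G1 q d) :=
  gen_subgroup [set` [seq pword (@G1_rel q d) w | w <- L]].

Arguments subgroup_of_words q {d} L.

(** * Numerical encoding of the input *)

Definition letter_code d (l : gen d * bool) : nat :=
  (if l.1 is Some i then (val i).+1 else 0).*2 + l.2.

Definition word_code d (w : word (gen d)) : nat :=
  CodeSeq.code [seq letter_code l | l <- w].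

Definition words_code d (L : seq (word (gen d))) : nat :=
  CodeSeq.code [seq word_code w | w <- L].

(* Main.v *)
From HB Require Import structures.
Require Import Defs.
From mathcomp Require Import all_boot all_order all_algebra perm generic_quotient.
From mathcomp Require Import boolp classical_sets functions cardinality.
From mathcomp Require Import zify.

(** A subgroup [H] of finite index in [G = G_{1,q}^d] is determined up to
    isomorphism by a few integers, and these are found by bounded searches in the
    words that generate [H].

    The group [G] acts on the Bass-Serre tree of its presentation as a d-fold HNN
    extension of [<a>], and the quotient of the tree by [H] is a finite graph of
    infinite cyclic groups whose vertices are the orbits of [a] on the cosets of
    [H].  As [a] and [a^q] are conjugate in the finite permutation group on the
    cosets, all these orbits have the same length, prime to [q]
    ([fixed_everywhere], [coprime_clen]).  Hence every edge carries again the label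
    [(1, q)], and each of the [k] vertices is the origin of [d] edges and the end of
    [d] edges ([subgroup_pi1], [rt_gt_inj]).

    Two edges with a common end have origins whose generators are conjugate, so the
    two edges can be identified without changing the fundamental group
    ([pi1_fold_aux]).  Once no such pair is left the graph is a cycle with
    [c + 1] parallel edges between consecutive vertices ([unfoldable_cycle]).  Its
    length is the period [p], the positive generator of the image of [H] under the
    exponent sum in the [t_j], and [c p = k (d - 1)] because a fold removes one
    vertex and one edge.  Reading a presentation off the cycle,
      [H = <b, s, u_ij | b^s = b^(q^p), [b^(q^i), u_ij] = 1, i < p, j < c>]
    ([cycle_presentation], [subgroup_presentation]).  So [q], [p] and [k (d - 1)]
    determine [H]; when [k (d - 1) = 0] there are no [u_ij] and [q^p] is enough.

    Conversely, three quantities are read off the abstract group.  The number of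
    homomorphisms to the group of order two gives [c p] ([isog_card]).  An element
    conjugate to a proper power of itself is conjugate in [G] to a power of [a], for
    otherwise the lengths of its powers would grow both linearly and logarithmically
    ([elliptic]); comparing exponents, the least [N >= 2] for which some nontrivial
    [x] is conjugate to [x^N] is [q^p], and there is none when [q = 1]
    ([conj_power_exists], [conj_power_form]).
    Finally, if [k (d - 1) > 0] and [q > 1], consider for each such [x] the least
    power of [x] that has a larger centralizer than [x]: the largest exponent that
    occurs is [q] ([small_centralizer], [large_centralizer]).  Therefore
    [H1] and [H2] are isomorphic if and only if [k1 (d1 - 1) = k2 (d2 - 1)],
    [q1^p1 = q2^p2], and either [k1 (d1 - 1) = 0] or [q1 = q2] ([iso_criterion]).

    It remains to compute [k] and [p].  The set of orbits of [a] is the largest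
    transitive set on which [G] acts with [a] trivial and the generators of [H]
    fixing a point ([card_le_orbits]).  A vertex that the generating words never
    visit could be doubled, so [k] is at most one more than their total length
    ([all_visited]), and [k] is found by trying all tables of permutations up to
    that size ([vertex_countE]).  The period is the largest [n] for which the words
    act trivially on the cyclic table of size [n] ([periodP]).  Both searches are
    primitive recursive. *)

Set Implicit Arguments.
Unset Strict Implicit.
Unset Printing Implicit Defensive.

(** * Homomorphisms and integer powers *)

Section GroupBasics.
Local Open Scope group_scope.

Definition hom (G K : groupType) (f : G -> K) : Prop :=
  forall x y, f (x * y) = f x * f y.

Section Hom.
Variables (G K : groupType) (f : G -> K).
Hypothesis fM : hom f.

Lemma hom1 : f 1 = 1.
Proof. by apply: (@mulIg _ (f 1)); rewrite -fM mul1g mul1g. Qed.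

Lemma homV x : f x^-1 = (f x)^-1.
Proof. by apply: (@mulIg _ (f x)); rewrite -fM !mulVg hom1. Qed.

Lemma homX x n : f (x ^+ n) = f x ^+ n.
Proof. by elim: n => [|n IH]; rewrite ?hom1 // !expgS fM IH. Qed.

End Hom.

Lemma hom_comp (G K L : groupType) (f : G -> K) (g : K -> L) :
  hom f -> hom g -> hom (g \o f).
Proof. by move=> fM gM x y /=; rewrite fM gM. Qed.

Definition zpow (G : groupType) (x : G) (n : int) : G :=
  match n with Posz k => x ^+ k | Negz k => x ^- k.+1 end.

Lemma zpowS (G : groupType) (x : G) (n : int) :
  zpow x (1 + n)%R = x * zpow x n.
Proof.
case: n => [k|[|k]]; first by rewrite -PoszD add1n /= expgS.
  by rewrite /= expg1 mulgV.
rewrite (_ : (1 + Negz k.+1 = Negz k)%R) /=; last by lia.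
by rewrite [x ^+ k.+2]expgSr invgM mulgA mulgV mul1g.
Qed.

Lemma zpowD (G : groupType) (x : G) (m n : int) :
  zpow x (m + n)%R = zpow x m * zpow x n.
Proof.
case: m => k.
  elim: k => [|k IH]; first by rewrite GRing.add0r mul1g.
  rewrite -add1n PoszD -GRing.addrA zpowS IH mulgA; congr (_ * _).
  by rewrite -zpowS.
have {}H : forall k n, zpow x (- Posz k + n)%R = x ^- k * zpow x n.
  elim=> [|{}k IH] l; first by rewrite GRing.add0r expg0 invg1 mul1g.
  apply: (@mulgI _ x); rewrite -zpowS.
  rewrite (_ : (1 + (- Posz k.+1 + l) = - Posz k + l)%R); last by lia.
  by rewrite IH expgSr invgM !mulgA mulgV mul1g.
by rewrite NegzE H -NegzE.
Qed.

Lemma zpowN (G : groupType) (x : G) (n : int) : zpow x (- n)%R = (zpow x n)^-1.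
Proof.
apply: (@mulIg _ (zpow x n)); rewrite -zpowD mulVg GRing.addNr //.
Qed.

Lemma zpowM (G : groupType) (x : G) (n : int) (k : nat) :
  zpow x (n * Posz k)%R = zpow x n ^+ k.
Proof.
elim: k => [|k IH]; first by rewrite GRing.mulr0.
rewrite expgS -IH -zpowD; congr zpow; lia.
Qed.

(** A homomorphism out of a presented group is an assignment of the generators
    under which every relation holds. *)
Section Universal.
Variables (X : choiceType) (R : word X -> word X -> Prop).
Variables (K : groupType) (h : X -> K).

Definition letter_val (l : X * bool) : K := if l.2 then (h l.1)^-1 else h l.1.
Definition word_val (u : word X) : K := foldr (fun l x => letter_val l * x) 1 u.

Lemma word_val_cat u v : word_val (u ++ v) = word_val u * word_val v.
Proof. by elim: u => [|l u IH] /=; rewrite ?mul1g // IH mulgA. Qed.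

Hypothesis hR : forall u v, R u v -> word_val u = word_val v.

Lemma word_val_cong u v : word_cong R u v -> word_val u = word_val v.
Proof.
elim=> {u v} [u v /hR|x b| | |u v w _ -> _ ->|u u' v v' _ uu _ vv] //.
  by case: b; rewrite /= /letter_val /= mulg1 ?mulVg ?mulgV.
by rewrite !word_val_cat uu vv.
Qed.

Definition pres_lift (g : presented R) : K := word_val (repr g).

Lemma pres_lift_pword u : pres_lift (pword R u) = word_val u.
Proof. exact: word_val_cong (repr_pword R u). Qed.

Lemma pres_lift_hom : hom pres_lift.
Proof.
move=> x y; rewrite -(pword_repr x) -(pword_repr y).
rewrite (_ : _ * _ = pword R (repr x ++ repr y)); last exact: pwordM.
by rewrite !pres_lift_pword word_val_cat.
Qed.

End Universal.

End GroupBasics.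

(** * The normal form of an element of G_{1,q}^d *)

Section NormalForm.
Variables (q d : nat).
Hypothesis q_gt0 : 0 < q.

Local Notation G := (G1 q d).
Local Notation step := ('I_d * option nat)%type.

Definition ga : G := pword (@G1_rel q d) [:: (None, false)].
Definition gt (j : 'I_d) : G := pword (@G1_rel q d) [:: (Some j, false)].

Local Open Scope group_scope.

Lemma pword_nil : pword (@G1_rel q d) [::] = 1 :> G.
Proof. by []. Qed.

Lemma pword_cat u v :
  pword (@G1_rel q d) (u ++ v) =
  (pword (@G1_rel q d) u : G) * pword (@G1_rel q d) v :> G.
Proof. by rewrite -(pwordM (@G1_rel q d)). Qed.

Lemma pword_letterV x :
  pword (@G1_rel q d) [:: (x, true)] =
  (pword (@G1_rel q d) [:: (x, false)] : G)^-1 :> G.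
Proof.
apply: (@mulgI _ (pword (@G1_rel q d) [:: (x, false)] : G)).
rewrite mulgV -pword_cat; apply/pwordP; exact: cong_inv.
Qed.

Lemma ga_pow n : pword (@G1_rel q d) (nseq n (None, false)) = ga ^+ n :> G.
Proof. by elim: n => // n IH; rewrite -[nseq _ _]/([:: _] ++ nseq n _) pword_cat IH expgS. Qed.

Lemma ga_gt j : ga * gt j = gt j * ga ^+ q.
Proof.
rewrite -ga_pow; have /pwordP <- := cong_rel (G1_relI q j).
rewrite -[[:: _; _; _]]/([:: (Some j, true)] ++ [:: (None, false)] ++ [:: (Some j, false)]).
by rewrite !pword_cat pword_letterV mulVKg.
Qed.

Lemma ga_gt_pow j n : ga ^+ n * gt j = gt j * ga ^+ (n * q).
Proof.
elim: n => [|n IH]; first by rewrite mul0n !expg0 mulg1 mul1g.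
by rewrite expgSr -mulgA ga_gt mulgA IH -mulgA -expgnDr mulSnr.
Qed.

Lemma zga_gt j (n : int) : zpow ga n * gt j = gt j * zpow ga (n * Posz q)%R.
Proof.
case: n => k; first by rewrite -PoszM /= ga_gt_pow.
rewrite NegzE GRing.mulNr -PoszM !zpowN /=; apply: (@mulgI _ (ga ^+ k.+1)).
rewrite mulVKg mulgA ga_gt_pow mulgK //.
Qed.

Lemma G1_ind (P : G -> Prop) :
  P 1 -> (forall g, P g -> P (ga * g)) -> (forall g, P g -> P (ga^-1 * g)) ->
  (forall j g, P g -> P (gt j * g)) -> (forall j g, P g -> P ((gt j)^-1 * g)) ->
  forall g, P g.
Proof.
move=> P1 Pa PaV Pt PtV g; rewrite -[g]pword_repr.
elim: (repr g : word (gen d)) => [|[x b] u IH]; first by rewrite pword_nil.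
rewrite -cat1s pword_cat.
case: x b => [j|] [|]; rewrite ?pword_letterV; by [apply: Pt|apply: PtV|apply: Pa|apply: PaV].
Qed.

(** A vertex of the Bass-Serre tree is a coset [w<a>]; it is named by a reduced
    list of steps, [(j, None)] standing for [t_j] and [(j, Some i)] for
    [a^i t_j^-1] with [i < q].  [shift n w] rewrites [a^n w] as [w' a^n']. *)
Fixpoint shift (n : int) (w : seq step) : seq step * int :=
  match w with
  | [::] => ([::], n)
  | (j, None) :: w' =>
      let r := shift (n * Posz q)%R w' in ((j, None) :: r.1, r.2)
  | (j, Some i) :: w' =>
      let m := (n + Posz i)%R in
      let r := shift (divz m (Posz q)) w' in
      ((j, Some `|modz m (Posz q)|%N) :: r.1, r.2)
  end.

(** [x] followed by [y] backtracks: [a^i t_j^-1 t_j] for any digit [i], but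
    [t_j a^i t_j^-1] only for the digit [0]. *)
Definition cancels (x y : step) : bool :=
  (x.1 == y.1) &&
  match x.2, y.2 with
  | None, Some i => i == 0
  | Some _, None => true
  | _, _ => false
  end.

Definition digit_ok (x : step) : bool := if x.2 is Some i then i < q else true.

Definition reduced (w : seq step) : bool :=
  all digit_ok w && sorted (fun x y => ~~ cancels x y) w.

Lemma reduced_cons x w :
  reduced (x :: w) =
  [&& digit_ok x, reduced w & if w is y :: _ then ~~ cancels x y else true].
Proof.
rewrite /reduced /= -!andbA; congr (_ && _); case: w => //= y w.
by rewrite -!andbA; do !bool_congr.
Qed.

Lemma modz_bound (m : int) : (0 <= modz m q < Posz q)%R.
Proof. by rewrite modz_ge0 ?ltz_pmod //; lia. Qed.

Lemma shift_reduced n w : reduced w -> reduced (shift n w).1.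
Proof.
elim: w n => // [[j [i|]] w] IH n; rewrite reduced_cons => /and3P[xok wr Hx].
- rewrite /= reduced_cons IH //=; apply/andP; split.
    by rewrite /digit_ok /=; have := modz_bound (n + i); lia.
  case: w Hx {IH wr} => // [[j' [i'|]] w] //=.
- rewrite /= reduced_cons IH //=.
  case: w Hx wr {IH} => // [[j' [i'|]] w] //= Hx; rewrite reduced_cons => /and3P[yok _ _].
    rewrite /cancels /= in Hx *; move: yok Hx; rewrite /digit_ok /= => yok.
    by rewrite modzMDl modz_small //; lia.
Qed.

Lemma size_shift n w : size (shift n w).1 = size w.
Proof. by elim: w n => //= [[j [i|]] w] IH n /=; rewrite IH. Qed.

Lemma shift0 w : reduced w -> shift 0 w = (w, 0%R).
Proof.
elim: w => // [[j [i|]] w] IH; rewrite reduced_cons => /and3P[iq /IH Hw _] /=.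
- move: iq; rewrite /digit_ok /= GRing.add0r => iq.
  by rewrite divz_small ?modz_small ?Hw //=; lia.
- by rewrite GRing.mul0r Hw.
Qed.

(** Carrying digits is compatible with addition, so that [act_shift] below is an
    action of the integers. *)
Lemma shiftD (m n : int) (w : seq step) :
  shift (m + n)%R w =
  ((shift m (shift n w).1).1, ((shift m (shift n w).1).2 + (shift n w).2)%R).
Proof.
elim: w m n => // [[j [i|]] w] IH m n /=.
- set u := (n + i)%R.
  have Hu : u = (divz u q * q + modz u q)%R by apply: divz_eq.
  have Hr : (0 <= modz u q)%R by have := modz_bound u; lia.
  have E : (m + n + i = m + modz u q + divz u q * q)%R by rewrite /u in Hu *; lia.
  rewrite E [(_ + _ * _)%R]GRing.addrC divzMDl ?modzMDl; last by lia.
  by rewrite gez0_abs // (GRing.addrC (divz u _)) IH.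
- by rewrite GRing.mulrDl IH.
Qed.

(** A normal form [w a^n] is a pair of a list of steps and an exponent.  The letters
    act on these pairs by left multiplication followed by reduction; that this
    respects the relations is what makes normal forms unique. *)
Definition state : Type := (seq step * int)%type.

Definition act_letter (l : gen d * bool) (s : state) : state :=
  match l with
  | (None, b) =>
      let r := shift (if b then (-1)%R else 1%R) s.1 in (r.1, (r.2 + s.2)%R)
  | (Some j, b) =>
      let x := (j, if b then Some 0 else None) in
      match s.1 with
      | y :: w => if cancels x y then (w, s.2) else (x :: s.1, s.2)
      | [::] => ([:: x], s.2)
      end
  end.

Definition act_word (u : word (gen d)) (s : state) : state :=
  foldr act_letter s u.

Lemma act_word_cat u v s : act_word (u ++ v) s = act_word u (act_word v s).
Proof. by rewrite /act_word foldr_cat. Qed.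

Lemma act_letter_reduced l s : reduced s.1 -> reduced (act_letter l s).1.
Proof.
case: l s => [[j|] b] [w n] /= Hr; last exact: shift_reduced.
case: w Hr => [|y w] Hr; first by case: b; rewrite /reduced /= /digit_ok /= ?q_gt0.
case: ifP => [_|Hc] /=; first by move: Hr; rewrite reduced_cons => /and3P[].
rewrite reduced_cons Hr /=; apply/andP; split; first by case: b {Hc}; rewrite /digit_ok /= ?q_gt0.
by rewrite Hc.
Qed.

Lemma act_word_reduced u s : reduced s.1 -> reduced (act_word u s).1.
Proof. by elim: u => //= l u IH /IH; apply: act_letter_reduced. Qed.

Definition act_shift (n : int) (s : state) : state :=
  ((shift n s.1).1, ((shift n s.1).2 + s.2)%R).

Lemma act_shiftD (m n : int) s :
  act_shift (m + n)%R s = act_shift m (act_shift n s).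
Proof. by rewrite /act_shift /= shiftD /= GRing.addrA. Qed.

Lemma act_shift0 s : reduced s.1 -> act_shift 0 s = s.
Proof. by case: s => w n /= Hw; rewrite /act_shift /= shift0 //= GRing.add0r. Qed.

Lemma act_word_nseq n s : reduced s.1 ->
  act_word (nseq n (None, false)) s = act_shift n s.
Proof.
move=> Hs; elim: n => [|n IH]; first exact/esym/act_shift0.
by rewrite /= -/(act_word _ _) IH -add1n PoszD act_shiftD.
Qed.

(** Cancelling the first step exposes a second one that cannot cancel with the
    letter just absorbed, because the list was reduced; so the letter comes back. *)
Lemma act_letterK x b s : reduced s.1 ->
  act_letter (x, b) (act_letter (x, ~~ b) s) = s.
Proof.
case: x => [j|] Hs; last first.
  rewrite -[act_letter _ (act_letter _ _)]/(act_shift _ (act_shift _ s)).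
  by rewrite -act_shiftD; case: b; rewrite ?GRing.addNr ?GRing.addrN act_shift0.
case: s Hs => [[|y w] n] /= Hs; first by case: b; rewrite /= /cancels /= eqxx.
case: ifP => [Hc|Hc] /=; last first.
  by case: b {Hc} => /=; rewrite /cancels /= eqxx.
have E : y = (j, if b then Some 0 else None).
  move: Hc; case: y {Hs} => [j' [i|]] /=; rewrite /cancels /=; case: b => //=;
  by case/andP => /eqP -> // /eqP ->.
by move: Hs; rewrite E reduced_cons; case: w => // z w /and3P[_ _ /negbTE ->].
Qed.

(** If the list begins with [a^0 t_j^-1], then [t_j] cancels it, [a] shifts the rest
    and [t_j^-1] restores the step: this is the carry produced by [a^q] at that step.
    Otherwise [t_j] is put in front, and moving [a] past it yields [a^q]. *)
Lemma act_relation j s : reduced s.1 ->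
  act_word [:: (Some j, true); (None, false); (Some j, false)] s =
  act_shift q s.
Proof.
rewrite /act_word /=; case: s => [[|y w] n] Hs /=.
  by rewrite /cancels /= eqxx /act_shift /= GRing.mul1r.
case: ifP => Hc /=; last first.
  by rewrite /act_shift /= GRing.mul1r /cancels /= eqxx.
have {Hc} E : y = (j, Some 0).
  move: Hc; case: y {Hs} => [j' [i|]] /=; rewrite /cancels /= ?andbF //.
  by case/andP => /eqP -> /eqP ->.
rewrite /act_shift /= E /= GRing.addr0 modzz divzz (_ : (Posz q == 0) = false); last by lia.
move: Hs; rewrite E reduced_cons; case: w => // [[j' [i'|]] w] /= /and3P[_ _ Hz].
- by rewrite /cancels andbF.
- by move: Hz; rewrite /cancels /= => /negbTE ->.
Qed.

Lemma act_word_cong u v : word_cong (@G1_rel q d) u v ->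
  forall s, reduced s.1 -> act_word u s = act_word v s.
Proof.
elim=> {u v} [u v [j]|x b| |u v _ IH|u v w _ IH1 _ IH2|u u' v v' _ IH1 _ IH2] s Hs //.
- by rewrite act_relation // act_word_nseq.
- exact: act_letterK.
- by rewrite IH.
- by rewrite IH1 // IH2.
- by rewrite !act_word_cat IH2 // IH1 //; apply: act_word_reduced.
Qed.

Definition act (g : G) (s : state) : state := act_word (repr g) s.

Lemma act_pword u s : reduced s.1 ->
  act (pword (@G1_rel q d) u) s = act_word u s.
Proof. by move=> Hs; apply: act_word_cong => //; apply: repr_pword. Qed.

Lemma act_reduced g s : reduced s.1 -> reduced (act g s).1.
Proof. exact: act_word_reduced. Qed.

Lemma act1 s : reduced s.1 -> act 1 s = s.
Proof. by move=> Hs; rewrite -pword_nil act_pword. Qed.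

Lemma actM g h s : reduced s.1 -> act (g * h) s = act g (act h s).
Proof.
move=> Hs; rewrite -{1}[g]pword_repr -{1}[h]pword_repr -pword_cat act_pword //.
by rewrite act_word_cat.
Qed.

Lemma act_zga n s : reduced s.1 -> act (zpow ga n) s = act_shift n s.
Proof.
move=> Hs; have Hpos k s' : reduced s'.1 -> act (ga ^+ k) s' = act_shift k s'.
  by move=> Hs'; rewrite -ga_pow act_pword // act_word_nseq.
case: n => k /=; first exact: Hpos.
have Hr : reduced (act_shift (Negz k) s).1 by apply: shift_reduced.
rewrite -[in LHS](act_shift0 Hs) (_ : (0 = k.+1%:Z + Negz k)%R); last by lia.
by rewrite act_shiftD -Hpos // -actM // mulVg act1.
Qed.

Definition step_val (x : step) : G :=
  if x.2 is Some i then ga ^+ i * (gt x.1)^-1 else gt x.1.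

Definition steps_val (w : seq step) : G := foldr (fun x g => step_val x * g) 1 w.

Definition state_val (s : state) : G := steps_val s.1 * zpow ga s.2.

Lemma steps_val_cat v w : steps_val (v ++ w) = steps_val v * steps_val w.
Proof. by elim: v => [|x v IH] /=; rewrite ?mul1g // IH mulgA. Qed.

Lemma zga_gtV j (n : int) : zpow ga (n * Posz q)%R * (gt j)^-1 = (gt j)^-1 * zpow ga n.
Proof. by apply: (@mulIg _ (gt j)); rewrite mulgVK -mulgA zga_gt mulKg. Qed.

Lemma zga_steps n w :
  zpow ga n * steps_val w = steps_val (shift n w).1 * zpow ga (shift n w).2.
Proof.
elim: w n => [|[j [i|]] w IH] n /=; first by rewrite mul1g mulg1.
- rewrite -[RHS]mulgA -IH /step_val /= !mulgA; congr (_ * _).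
  rewrite -[ga ^+ i]/(zpow ga i) -zpowD {1}(divz_eq (n + i) q) GRing.addrC zpowD.
  rewrite -mulgA zga_gtV !mulgA; congr (_ * _ * _).
  by case: (modz _ _) (modz_bound (n + i)) => //= k; lia.
- by rewrite -[RHS]mulgA -IH /step_val /= !mulgA zga_gt.
Qed.

Lemma act_letter_val l s :
  state_val (act_letter l s) = pword (@G1_rel q d) [:: l] * state_val s.
Proof.
case: l s => [[j|] b] [w n]; last first.
  rewrite /state_val /= zpowD mulgA -zga_steps !mulgA; congr (_ * _ * _).
  by case: b; rewrite ?pword_letterV.
have E : pword (@G1_rel q d) [:: (Some j, b)] =
         step_val (j, if b then Some 0 else None).
  by case: b; rewrite ?pword_letterV //= /step_val /= expg0 mul1g.
rewrite E /state_val; case: w => [|y w] /=; first by rewrite mulgA.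
case: ifP => [Hc|_] /=; last by rewrite !mulgA.
rewrite !mulgA; congr (_ * _); rewrite -[LHS]mul1g; congr (_ * _).
move: Hc; case: y => [j' [i|]]; rewrite /cancels /step_val /=; case: b {E} => //=;
  rewrite ?andbF //.
- by case/andP => /eqP -> /eqP ->; rewrite expg0 mul1g mulgV.
- by rewrite andbT => /eqP ->; rewrite mul1g mulVg.
Qed.

(** Britton's normal form, computed by letting [g] act on the trivial one. *)
Definition nf (g : G) : state := act g ([::], 0%R).

Lemma nf_reduced g : reduced (nf g).1.
Proof. exact: act_reduced. Qed.

Lemma nf_val g : state_val (nf g) = g.
Proof.
rewrite /nf /act -{2}[g]pword_repr; elim: (repr g : word _) => [|l u IH].
  by rewrite /state_val /= mulg1.
by rewrite -cat1s pword_cat -IH /= act_letter_val.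
Qed.

Lemma act_steps v w n : reduced (v ++ w) -> act (steps_val v) (w, n) = (v ++ w, n).
Proof.
elim: v => [|x v IH] Hr; first by rewrite act1.
have Hvw : reduced (v ++ w) by move: Hr; rewrite cat_cons reduced_cons => /and3P[].
have Hw : reduced w.
  by move: Hvw; rewrite /reduced all_cat => /andP[/andP[_ ->]] /cat_sorted2[].
rewrite [steps_val _]/= actM // IH //.
have Ht b j' : b = (if x.2 is Some _ then true else false) -> j' = x.1 ->
   act (pword (@G1_rel q d) [:: (Some j', b)]) (v ++ w, n) =
   ((j', if b then Some 0 else None) :: v ++ w, n).
  move=> Hb Hj; rewrite act_pword //=.
  case E: (v ++ w) => [|y u] //=; rewrite ifN //.
  move: Hr; rewrite cat_cons E reduced_cons Hj => /and3P[_ _].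
  by case: (x) Hb => [j0 [i|]] /= ->.
case: x Hr Ht => [j [i|]] Hr Ht; rewrite /step_val /=; last by rewrite (Ht false).
rewrite actM // -pword_letterV (Ht true) // -[ga ^+ i]/(zpow ga i).
have iq : i < q by move: Hr; rewrite cat_cons reduced_cons => /and3P[].
rewrite act_zga /=; last first.
  rewrite reduced_cons Hvw /=; move: Hr; rewrite cat_cons reduced_cons => /and3P[_ _].
  by rewrite /digit_ok /= q_gt0.
by rewrite /act_shift /= GRing.addr0 modz_small ?divz_small ?shift0 //= ?GRing.add0r //; lia.
Qed.

End NormalForm.

(** * Elliptic elements and their centralizers *)

Lemma exp_beats_linear c : exists M, c * M + c < 2 ^ M.
Proof.
have H m : m < 2 ^ m by apply: ltn_expl.
(* 2 ^ (4 (c + 1)) is at least (c + 2) ^ 4. *)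
exists (c.+1 * 4)%N; rewrite expnM; have := H c.+1.
set u := 2 ^ c.+1 => Hu; have H1 : c.+2 ^ 4 <= u ^ 4 by rewrite leq_exp2r.
apply: leq_trans H1; rewrite !expnS expn0; nia.
Qed.

Section Elliptic.
Variables (q d : nat).
Hypothesis q_gt0 : 0 < q.

Local Notation G := (G1 q d).
Local Notation step := ('I_d * option nat)%type.
Local Notation a := (ga q d).

Local Open Scope group_scope.

(** The distance in the tree between the vertex fixed by [a] and its image under [g]. *)
Definition tlen (g : G) : nat := size (nf g).1.

Lemma size_act_shift n s : size (act_shift q n s).1 = size (s.1 : seq step).
Proof. exact: size_shift. Qed.

Lemma size_act_letter j b (s : state d) :
  size (act_letter q (Some j, b) s).1 <= (size s.1).+1.
Proof. by case: s => [[|y w] n] //=; case: ifP => //= _; lia. Qed.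

Lemma size_act_steps (v : seq step) (s : state d) : reduced q s.1 ->
  size (act (steps_val q v) s).1 <= size v + size s.1.
Proof.
elim: v => [|[j [i|]] v IH] Hs; first by rewrite act1.
- rewrite [steps_val _ _]/= actM //; set s' := act (steps_val _ _) _.
  have Hs' : reduced q s'.1 by apply: act_reduced.
  rewrite /step_val /= actM // -[_ ^+ i]/(zpow a i) act_zga //; last exact: act_reduced.
  rewrite size_act_shift -pword_letterV act_pword //.
  by apply: leq_trans (size_act_letter _ _ _) _; rewrite ltnS IH.
- rewrite [steps_val _ _]/= actM //; set s' := act (steps_val _ _) _.
  have Hs' : reduced q s'.1 by apply: act_reduced.
  rewrite /step_val /= act_pword //.
  by apply: leq_trans (size_act_letter _ _ _) _; rewrite ltnS IH.
Qed.

Lemma size_act g (s : state d) : reduced q s.1 ->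
  size (act (g : G) s).1 <= tlen g + size s.1.
Proof.
move=> Hs; rewrite -{1}(nf_val q_gt0 g) /state_val actM // act_zga //.
apply: leq_trans (size_act_steps _ _) _; first exact: shift_reduced.
by rewrite size_act_shift.
Qed.

Lemma nfM g h : nf (g * h : G) = act g (nf h).
Proof. by rewrite /nf actM. Qed.

Lemma tlenM g h : tlen (g * h) <= tlen g + tlen h.
Proof. by rewrite {1}/tlen nfM size_act // nf_reduced. Qed.

Lemma tlen1 : tlen 1 = 0.
Proof. by rewrite /tlen /nf act1. Qed.

Lemma tlenX g n : tlen (g ^+ n) <= n * tlen g.
Proof.
elim: n => [|n IH]; first by rewrite expg0 tlen1.
by rewrite expgS mulSn; apply: leq_trans (tlenM _ _) _; rewrite leq_add2l.
Qed.

Lemma nf_zga n : nf (zpow a n) = ([::], n).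
Proof. by rewrite /nf act_zga // /act_shift /= GRing.addr0. Qed.

Lemma zga_inj m n : zpow a m = zpow a n -> m = n.
Proof. by move/(congr1 (@nf q d)); rewrite !nf_zga => -[]. Qed.

Lemma tlen_eq0 g : tlen g = 0 -> exists n, g = zpow a n.
Proof.
move/size0nil => E; exists (nf g).2.
by rewrite -{1}(nf_val q_gt0 g) /state_val E /= mul1g.
Qed.

(** By minimality the normal form is cyclically reduced, so nothing cancels in the
    powers. *)
Lemma minimal_tlenX (y : G) :
  (forall g, tlen y <= tlen (g * y * g^-1)) -> forall k, tlen (y ^+ k) = (k * tlen y)%N.
Proof.
move=> ymin; case Ew: (nf y).1 => [|x0 w].
  by move=> k; have := tlenX y k; rewrite /tlen Ew muln0 leqn0 => /eqP.
pose n := (nf y).2; pose l := last x0 w; pose w0 := belast x0 w.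
have Ey : y = steps_val q (x0 :: w) * zpow a n.
  by rewrite -{1}(nf_val q_gt0 y) /state_val Ew.
have wr : reduced q (x0 :: w) by rewrite -Ew nf_reduced.
have Ew0 : x0 :: w = rcons w0 l by apply: lastI.
(* Otherwise conjugating by the last step would give a shorter element. *)
have ncl : ~~ cancels l (head x0 (shift q n (x0 :: w)).1).
  apply/negP => Hc.
  have Hw0 : exists w', w0 = x0 :: w'.
    move: Hc Ew0; rewrite /w0 /l; case: (w) => [|z w'] /=; last by move=> _ _; exists (belast z w').
    by case: (x0) => [j [i|]] /=; rewrite /cancels /= ?andbF.
  have [w' Ew'] := Hw0.
  have w0r : reduced q w0.
    by move: wr; rewrite Ew0 -cats1 /reduced all_cat => /andP[/andP[-> _]] /cat_sorted2[].
  have := ymin (step_val q l * zpow a n).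
  have -> : step_val q l * zpow a n * y * (step_val q l * zpow a n)^-1 =
            step_val q l * (zpow a n * steps_val q w0).
    by rewrite Ey Ew0 -cats1 steps_val_cat /= mulg1 !mulgA -(mulgA _ (step_val q l)) mulgK.
  rewrite {1}/tlen Ew Ew0 size_rcons Ew' /tlen (nfM (step_val q l)) (nfM (zpow _ _)).
  have -> : nf (steps_val q (x0 :: w')) = (x0 :: w', 0%R).
    by have := @act_steps q d q_gt0 (x0 :: w') [::] 0; rewrite cats0; apply; rewrite -Ew'.
  rewrite act_zga //; last by rewrite -Ew'.
  have Hs : reduced q (act_shift q n (x0 :: w', 0%R)).1 by apply: shift_reduced; rewrite // -Ew'.
  have : size (act_shift q n (x0 :: w', 0%R)).1 = (size w').+1 by rewrite size_act_shift.
  have Hh : cancels l (head x0 (act_shift q n (x0 :: w', 0%R)).1).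
    by move: Hc; case: (x0) => [j [i|]].
  move: Hs Hh; case: (act_shift _ _ _) => [[|y0 u] m] //= Hs Hh [Hu].
  case: l Hh {Ew0 Hc} => [j [i|]] Hh; rewrite /step_val /=.
    rewrite actM // -pword_letterV -[_ ^+ i]/(zpow a i) act_zga //; last exact: act_reduced.
    rewrite size_act_shift act_pword //= ifT; first by rewrite /= Hu; lia.
    by move: Hh; rewrite /cancels; case: (y0.2).
  by rewrite act_pword //= Hh /= Hu; lia.
have key k : exists m v, nf (y ^+ k.+1) = (x0 :: w ++ v, m) /\ size v = (k * (size w).+1)%N.
  elim: k => [|k [m [v [E Sv]]]].
    by exists n, [::]; rewrite expg1 cats0 -Ew /n; case: (nf y).
  have Hr : reduced q (nf (y ^+ k.+1)).1 by apply: nf_reduced.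
  have Hr' : reduced q (shift q n (nf (y ^+ k.+1)).1).1 by apply: shift_reduced.
  rewrite expgS nfM {1}Ey actM // act_zga // /act_shift.
  exists ((shift q n (nf (y ^+ k.+1)).1).2 + (nf (y ^+ k.+1)).2)%R.
  exists (shift q n (nf (y ^+ k.+1)).1).1.
  split; last by rewrite size_shift E /= size_cat Sv; lia.
  rewrite act_steps // /reduced all_cat.
  move: wr Hr'; rewrite /reduced => /andP[-> wsort] /andP[-> vsort].
  rewrite /= in wsort; rewrite /= cat_path wsort /=.
  move: vsort ncl; rewrite E /= /l.
  by case: (x0) => [j [i|]] /= ->; rewrite andbT.
case=> [|k]; first by rewrite expg0 tlen1.
have [m [v [E Sv]]] := key k.
by rewrite /tlen E Ew /= size_cat Sv; lia.
Qed.

(** The conjugate of [x] by [h^M] is [x^(N^M)], so the length of this power is at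
    most linear in [M]; but if no conjugate of [x] fixed the base vertex, it would be
    at least [N^M] up to a constant by [minimal_tlenX]. *)
Lemma elliptic (x h : G) N : 1 < N -> x ^ h = x ^+ N ->
  exists g n, x = zpow a n ^ g.
Proof.
move=> N1 Hx.
have [g ymin] : exists g, forall g', tlen (x ^ g) <= tlen (x ^ g').
  pose P n := `[< exists g, tlen (x ^ g) = n >].
  have exP : exists n, P n by exists (tlen (x ^ 1)); apply/asboolP; exists 1.
  case: (ex_minnP exP) => n /asboolP[g <-] Hm; exists g => g'.
  by apply: Hm; apply/asboolP; exists g'.
set y := x ^ g in ymin.
have ymin' g' : tlen y <= tlen (g' * y * g'^-1).
  by have := ymin (g * g'^-1); rewrite conjgM /(_ ^ g'^-1) invgK mulgA.
have grow := minimal_tlenX ymin'.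
have [y0|y0] := posnP (tlen y).
  have [n En] := tlen_eq0 y0; exists g^-1, n.
  by rewrite -En /y conjgK.
exfalso; pose k := h ^ g.
have HyM M : y ^ (k ^+ M) = y ^+ (N ^ M)%N.
  elim: M => [|M IH]; first by rewrite expg0 conjg1.
  by rewrite expgS conjgM /y /k -conjJg Hx conjXg -/y -/k conjXg IH -expgnA expnSr.
pose c := (tlen (k^-1) + tlen k + tlen y)%N.
have [M HM] := exp_beats_linear c.
have := grow (N ^ M)%N; rewrite -HyM => E.
have : tlen (y ^ (k ^+ M)) <= (c * M + c)%N.
  have EV : (k ^+ M)^-1 = k^-1 ^+ M.
    by elim: (M) => [|j IHj]; rewrite ?invg1 // expgS invgM IHj expgSr.
  rewrite /(_ ^ _) EV; apply: leq_trans (tlenM _ _) _; have := tlenX k M.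
  have := tlenX k^-1 M; have := tlenM y (k ^+ M); rewrite /c.
  move: (tlen _) (tlen _) (tlen _) (tlen _) (tlen _) (tlen _) => *; nia.
rewrite E; have : (2 ^ M <= N ^ M)%N by case: (M) => // M'; rewrite leq_exp2r.
by move: y0 HM; move: (2 ^ M)%N (N ^ M)%N (tlen y) => *; nia.
Qed.

Lemma nf_steps (w : seq step) n : reduced q w ->
  nf (steps_val q w * zpow a n) = (w, n).
Proof.
move=> wr; rewrite nfM nf_zga.
by have := @act_steps q d q_gt0 w [::] n; rewrite cats0; apply.
Qed.

(** [a^n h = h a^n'] means that [a^n] fixes the path from the base vertex to its image
    under [h] and comes out at the far end as [a^n']. *)
Lemma conj_zga_shift (h : G) (n n' : int) :
  zpow a n * h = h * zpow a n' <-> shift q n (nf h).1 = ((nf h).1, n').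
Proof.
have hr := nf_reduced q_gt0 h; have Eh := nf_val q_gt0 h.
rewrite /state_val in Eh; split=> [/(congr1 (@nf q d))|E].
  rewrite nfM act_zga // -{2}Eh -mulgA -zpowD nf_steps // /act_shift.
  by case: (shift _ _ _) => v m /= [-> E]; congr pair; lia.
by rewrite -Eh mulgA zga_steps // E /= -!mulgA -!zpowD GRing.addrC.
Qed.

Definition ups (w : seq step) := count (fun x => ~~ isSome x.2) w.
Definition downs (w : seq step) := count (fun x => isSome x.2) w.

(** Each [t_j] multiplies the exponent by [q] and each [t_j^-1] divides it by [q]. *)
Lemma shift_ratio (w : seq step) (n n' : int) : shift q n w = (w, n') ->
  (n' * Posz (q ^ downs w)%N = n * Posz (q ^ ups w)%N)%R.
Proof.
elim: w n n' => [|[j [i|]] w IH] n n'; first by case=> ->.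
- rewrite /=; case E: (shift _ _ _) => [v m] /= [Hi Hv Hm].
  move: E; rewrite Hv Hm => /IH; have := divz_eq (n + i) q.
  have := modz_bound q_gt0 (n + i); rewrite /downs /ups /= add0n add1n expnS PoszM.
  set A := Posz (_ ^ _); set B := Posz (_ ^ _); set D := divz _ _ => H1 H2 H3.
  have -> : n = (D * q)%R by lia.
  by rewrite GRing.mulrCA H3; nia.
- rewrite /=; case E: (shift _ _ _) => [v m] /= [Hv Hm].
  move: E; rewrite Hv Hm => /IH; rewrite /downs /ups /= add0n add1n expnS PoszM => ->.
  by rewrite GRing.mulrA.
Qed.

(** To fix a path that descends below the height of its origin, the exponent must be
    divisible by [q].  As [q] does not divide [N], the path stays above, and there
    the whole of [<a>] fixes what [a^N] fixes.  The height reached is [e]. *)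
Lemma shift_fix_all (w : seq step) (N : int) e : ~~ (q %| N)%Z ->
  shift q (N * Posz (q ^ e)%N)%R w = (w, N) -> shift q (Posz (q ^ e)%N) w = (w, 1%R).
Proof.
move=> qN; elim: w e => [|[j [i|]] w IH] e.
- case=> E; congr pair; have N0 : N != 0%R by apply: contraNneq qN => ->; rewrite dvdz0.
  have : (N * (Posz (q ^ e)%N - 1) = 0)%R by rewrite GRing.mulrBr E GRing.mulr1 GRing.subrr.
  by move/eqP; rewrite GRing.mulf_eq0 (negbTE N0) /= => /eqP; lia.
- rewrite /=; case E: (shift _ _ _) => [v m] /= [Hi Hv Hm].
  have Hb := modz_bound q_gt0 (N * (q ^ e)%N + i).
  have Hd := divz_eq (N * (q ^ e)%N + i) q.
  case: e E Hi Hb Hd => [|e] E Hi Hb Hd.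
    case/negP: qN; apply/dvdzP; exists (divz (N * (q ^ 0)%N + i) q).
    by move: Hd; rewrite expn0; lia.
  have HD : divz (N * (q ^ e.+1)%N + i) q = (N * (q ^ e)%N)%R.
    apply: (@GRing.mulIf _ (Posz q)); first by lia.
    by move: Hd Hb Hi; rewrite expnS; set D := divz _ _; set M := modz _ _; nia.
  have HM : i < q by lia.
  move: E; rewrite HD Hv Hm => /IH E.
  have -> : (Posz (q ^ e.+1)%N + Posz i = Posz (q ^ e)%N * Posz q + Posz i)%R.
    by rewrite expnSr PoszM.
  by rewrite divzMDl ?modzMDl ?divz_small ?modz_small ?GRing.addr0 ?E //; lia.
- rewrite /=; case E: (shift _ _ _) => [v m] /= [Hv Hm].
  move: E; rewrite -GRing.mulrA -PoszM -expnSr Hv Hm => /IH.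
  by move=> ->.
Qed.

Lemma centralizer_zga (h : G) (N : int) : ~~ (q %| N)%Z ->
  zpow a N * h = h * zpow a N -> forall n : int, zpow a n * h = h * zpow a n.
Proof.
move=> qN /conj_zga_shift E n.
have /conj_zga_shift E1 : shift q 1%R (nf h).1 = ((nf h).1, 1%R).
  by apply: (@shift_fix_all _ N 0); rewrite ?expn0 ?GRing.mulr1.
have Epos k : zpow a (Posz k) * h = h * zpow a (Posz k).
  elim: k => [|k IH]; first by rewrite mulg1 mul1g.
  by rewrite -addn1 PoszD !zpowD -mulgA E1 mulgA IH mulgA.
case: n => k; first exact: Epos.
rewrite NegzE zpowN; apply: (@mulgI _ (zpow a k.+1)).
by rewrite mulVKg mulgA Epos mulgK.
Qed.

(** The normal form of the power begins with [a^0 t_i^-1], and [a^N] changes the digit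
    [0] to [N] modulo [q]. *)
Lemma commutator_moves (i j : 'I_d) l (N : int) : i != j -> 0 < l ->
  ~~ (q %| N)%Z ->
  zpow a N * ((gt q i)^-1 * gt q j) ^+ l <> ((gt q i)^-1 * gt q j) ^+ l * zpow a N.
Proof.
move=> ij l0 qN /conj_zga_shift.
pose w l := flatten (nseq l [:: (i, Some 0); (j, None)] : seq (seq step)).
have Ew m : steps_val q (w m) = ((gt q i)^-1 * gt q j) ^+ m.
  elim: m => [|m IH]; rewrite ?expg0 // expgS -IH /= /step_val /=.
  by rewrite expg0 mul1g !mulgA.
have wr m : reduced q (w m).
  elim: m => // m IH; rewrite [w _]/= !reduced_cons IH /= /digit_ok /= q_gt0 /=.
  rewrite /cancels /= (negbTE ij) /= andbT.
  by case: (m) => //= m'; rewrite eq_sym (negbTE ij).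
have -> : nf (((gt q i)^-1 * gt q j) ^+ l) = (w l, 0%R).
  by rewrite -Ew -[steps_val _ _]mulg1 -[1]/(zpow a 0) nf_steps.
case: l l0 => // l _ /= [] H _ _; case/negP: qN.
move: H; rewrite GRing.addr0; have := modz_bound q_gt0 N; have := divz_eq N q.
by move=> E H1 H2; apply/dvdzP; exists (divz N q); lia.
Qed.

(** The exponent sum in the [t_j]. *)
Definition eps_letter (l : gen d * bool) : int :=
  if l.1 is Some _ then (if l.2 then (-1)%R else 1%R) else 0%R.
Definition eps_word (u : word (gen d)) : int :=
  foldr (fun l n => (eps_letter l + n)%R) 0%R u.

Lemma eps_word_cat u v : eps_word (u ++ v) = (eps_word u + eps_word v)%R.
Proof. by elim: u => [|l u IH] /=; rewrite ?GRing.add0r // IH GRing.addrA. Qed.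

Lemma eps_word_cong u v : word_cong (@G1_rel q d) u v -> eps_word u = eps_word v.
Proof.
elim=> {u v} [u v [j]|x b| |u v _ ->|u v w _ -> _ ->|u u' v v' _ IH1 _ IH2] //.
- rewrite (_ : eps_word [:: _; _; _] = 0%R) //.
  by elim: (q) => //= n <-; rewrite GRing.addr0.
- by case: x b => [j|] [|].
- by rewrite !eps_word_cat IH1 IH2.
Qed.

Definition eps (g : G) : int := eps_word (repr g).

Lemma eps_pword u : eps (pword (@G1_rel q d) u) = eps_word u.
Proof. exact/eps_word_cong/repr_pword. Qed.

Lemma epsM g h : eps (g * h) = (eps g + eps h)%R.
Proof.
rewrite -{1}[g]pword_repr -{1}[h]pword_repr -pword_cat eps_pword.
exact: eps_word_cat.
Qed.

Lemma eps1 : eps 1 = 0%R.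
Proof. by rewrite -pword_nil eps_pword. Qed.

Lemma epsV g : eps g^-1 = (- eps g)%R.
Proof.
by have /esym/eqP := epsM g^-1 g; rewrite mulVg eps1 GRing.addr_eq0 => /eqP.
Qed.

Lemma eps_ga : eps a = 0%R.
Proof. by rewrite eps_pword. Qed.

Lemma eps_gt j : eps (gt q j) = 1%R.
Proof. by rewrite eps_pword. Qed.

Lemma epsX g n : eps (g ^+ n) = (eps g *+ n)%R.
Proof.
elim: n => [|n IH]; first by rewrite expg0 eps1.
by rewrite expgS epsM IH GRing.mulrS.
Qed.

Lemma eps_zga n : eps (zpow a n) = 0%R.
Proof. by case: n => n /=; rewrite ?epsV epsX eps_ga GRing.mul0rn. Qed.

Lemma eps_steps (w : seq step) :
  eps (steps_val q w) = (Posz (ups w) - Posz (downs w))%R.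
Proof.
elim: w => [|[j [i|]] w IH]; first by rewrite eps1.
- rewrite /= epsM IH /step_val /= epsM epsV eps_gt -[_ ^+ i]/(zpow a i) eps_zga.
  by rewrite /ups /downs /=; lia.
- by rewrite /= epsM IH /step_val /= eps_gt /ups /downs /=; lia.
Qed.

(** The modular homomorphism: [n' / n = q ^ eps h], written without inverses. *)
Lemma conj_zga_ratio (h : G) (n n' : int) : zpow a n * h = h * zpow a n' ->
  exists u v : nat, eps h = (Posz u - Posz v)%R /\
    (n' * Posz (q ^ v)%N = n * Posz (q ^ u)%N)%R.
Proof.
move/conj_zga_shift/shift_ratio => E; exists (ups (nf h).1), (downs (nf h).1).
split=> //; rewrite -{1}(nf_val q_gt0 h) /state_val epsM eps_zga eps_steps; lia.
Qed.

End Elliptic.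

(** * Subgroups of finite index as point stabilizers *)

Section Subgroups.
Local Open Scope group_scope.
Local Open Scope classical_set_scope.
Variable G : groupType.

Definition subgrp (H : set G) : Prop :=
  H 1 /\ forall x y, H x -> H y -> H (x * y^-1).

Section Subgrp.
Variable H : set G.
Hypothesis hH : subgrp H.

Lemma subgrp1 : H 1. Proof. by case: hH. Qed.
Lemma subgrpV x : H x -> H x^-1.
Proof. by case: hH => H1 HD Hx; rewrite -[x^-1]mul1g; apply: HD. Qed.
Lemma subgrpM x y : H x -> H y -> H (x * y).
Proof.
by case: hH => H1 HD Hx Hy; rewrite -[y]invgK; apply: HD; last exact: subgrpV.
Qed.
Lemma subgrpX x n : H x -> H (x ^+ n).
Proof. by move=> Hx; elim: n => [|n IH]; [exact: subgrp1 | rewrite expgS; exact: subgrpM]. Qed.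

End Subgrp.

Lemma group_closedP (A : set G) : group_closed [in A] <-> subgrp A.
Proof.
split=> -[H1 HD]; split.
- by move: H1; rewrite !inE.
- by move=> x y Ax Ay; have := HD x y; rewrite !inE; apply.
- by rewrite !inE.
- by move=> x y; rewrite !inE; apply: HD.
Qed.

Lemma gen_subgroup_subgrp (S : set G) : subgrp (gen_subgroup S).
Proof.
split; first by move=> A [/group_closedP[]].
move=> x y Hx Hy A HA; have [/group_closedP[_ HD] _] := HA.
by apply: HD; [exact: Hx | exact: Hy].
Qed.

Lemma gen_subgroup_sub (S : set G) : S `<=` gen_subgroup S.
Proof. by move=> x Sx A [_]; apply. Qed.

Lemma gen_subgroup_min (S A : set G) : subgrp A -> S `<=` A -> gen_subgroup S `<=` A.
Proof. by move=> hA SA x; apply; split=> //; apply/group_closedP. Qed.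

(** The right action on the cosets of [H], up to isomorphism: finiteness of the index
    is used only through the existence of such an action. *)
Record coset_action (H : set G) (O : finType) (o : O) (r : O -> G -> O) : Prop :=
  CosetAction {
    act_mul : forall w g h, r w (g * h) = r (r w g) h;
    act_one : forall w, r w 1 = w;
    act_stab : forall g, r o g = o <-> H g;
    act_trans : forall w, exists g, r o g = w }.

Lemma finite_index_action (H : set G) : subgrp H -> finite_index H ->
  exists (O : finType) (o : O) (r : O -> G -> O), coset_action H o r.
Proof.
move=> hH; rewrite /finite_index => /finite_seqP[s Es].
pose coset x : set G := [set x * y | y in H].
have cosetE x y : coset x = coset y <-> H (x^-1 * y).
  split=> [E|Hxy].
    have : coset y y by exists 1; [exact: subgrp1 | rewrite mulg1].
    by rewrite -E => -[z Hz <-]; rewrite mulKg.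
  rewrite eqEsubset; split=> z [u Hu <-].
    exists ((x^-1 * y)^-1 * u); first by apply: subgrpM => //; apply: subgrpV.
    by rewrite invgM invgK !mulgA mulgV mul1g.
  exists (x^-1 * y * u); first exact: subgrpM.
  by rewrite !mulgA mulgV mul1g.
have cs x : coset x \in s.
  have : range coset (coset x) by exists x.
  by rewrite Es.
have /choice[rep repE] (w : seq_sub s) : exists x, coset x = ssval w.
  have : [set` s] (ssval w) by exact: ssvalP.
  by rewrite -Es => -[x _ <-]; exists x.
pose idx x := SeqSub (cs x).
have idxE x y : idx x = idx y <-> H (x^-1 * y).
  by rewrite -cosetE; split=> [[]|E] //; apply: val_inj.
have idxK w : idx (rep w) = w by apply: val_inj; rewrite /= repE.
have repK x : H (x^-1 * rep (idx x)) by apply/idxE; rewrite idxK.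
exists (seq_sub s), (idx 1), (fun w g => idx (g^-1 * rep w)); split.
- move=> w g h; apply/idxE; rewrite !invgM !invgK !mulgA.
  set u := rep w; have := repK (g^-1 * u); rewrite invgM invgK.
  by rewrite -!(mulgA _ h) mulgV mulg1.
- by move=> w; rewrite invg1 mul1g idxK.
- have H1 : H (rep (idx 1)) by have := repK 1; rewrite invg1 mul1g.
  move=> g; rewrite idxE invgM invgK mulg1; split=> Hg.
    by rewrite -[g](mulVKg (rep (idx 1))); apply: subgrpM.
  by apply: subgrpM => //; exact: subgrpV.
- move=> w; exists (rep w)^-1; rewrite invgK -[RHS]idxK; apply/idxE.
  rewrite invgM -mulgA mulVg mulg1; apply: subgrpV => //.
  by have := repK 1; rewrite invg1 mul1g.
Qed.

End Subgroups.

Lemma iter_fixed (T : finType) (f : T -> T) : injective f ->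
  exists2 n, 0 < n & forall x, iter n f x = x.
Proof.
move=> f_inj; exists (\prod_x order f x); first by apply: prodn_gt0 => x; exact: order_gt0.
move=> x; have /dvdnP[c ->] : order f x %| \prod_x order f x.
  by rewrite (bigD1 x) //= dvdn_mulr.
elim: c => // c IH; rewrite mulSn iterD IH; exact: iter_order.
Qed.

Lemma iter_order_dvd (T : finType) (f : T -> T) x i : injective f ->
  (iter i f x == x) = (order f x %| i).
Proof.
move=> f_inj; apply/eqP/idP => [E|/dvdnP[c ->]]; last first.
  by elim: c => // c IH; rewrite mulSn iterD IH; exact: iter_order.
have Hc c : iter (c * order f x) f x = x.
  by elim: c => // c IH; rewrite mulSn iterD IH; exact: iter_order.
have lt_r : i %% order f x < order f x by rewrite ltn_mod order_gt0.
have := findex_iter lt_r; rewrite /dvdn => <-.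
have -> : iter (i %% order f x) f x = x.
  by rewrite -[RHS]E [in RHS](divn_eq i (order f x)) addnC iterD Hc.
by rewrite findex0.
Qed.

Section Orbits.
Variables (q d : nat).
Hypothesis q_gt0 : 0 < q.
Local Notation G := (G1 q d).
Local Notation a := (ga q d).
Local Open Scope group_scope.
Variables (H : set G) (O : finType) (o : O) (r : O -> G -> O).
Hypothesis rP : coset_action H o r.

Lemma ractK g w : r (r w g) g^-1 = w.
Proof. by rewrite -(act_mul rP) mulgV (act_one rP). Qed.

Lemma ract_inj g : injective (fun w => r w g).
Proof. by move=> w w' E; rewrite -[w](ractK g) E ractK. Qed.

Lemma ractX g w n : r w (g ^+ n) = iter n (fun w => r w g) w.
Proof.
elim: n => [|n IH]; first exact: (act_one rP).
by rewrite expgSr (act_mul rP) IH.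
Qed.

Lemma ract_period g : exists2 n, 0 < n & forall w, r w (g ^+ n) = w.
Proof.
have [n n0 E] := iter_fixed (@ract_inj g); exists n => // w.
by rewrite ractX E.
Qed.

Lemma power_in_H g : exists2 n, 0 < n & H (g ^+ n).
Proof. by have [n n0 E] := ract_period g; exists n => //; apply/(act_stab rP). Qed.

Lemma ga_gtX (j : 'I_d) n i : a ^+ i * gt q j ^+ n = gt q j ^+ n * a ^+ (i * q ^ n)%N.
Proof.
elim: n i => [|n IH] i; first by rewrite expg0 mul1g mulg1 muln1.
by rewrite expgSr mulgA IH -mulgA ga_gt_pow mulgA expnSr mulnA.
Qed.

(** The power [t_j^n] acts trivially on the cosets, for some [n], and conjugates
    [a^i] to [a^(i q^n)]. *)
Lemma ract_a_pow (j : 'I_d) :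
  exists2 n, 0 < n & forall w i, r w (a ^+ (i * q ^ n)%N) = r w (a ^+ i).
Proof.
have [n n0 E] := ract_period (gt q j); exists n => // w i.
by rewrite -{1}(E w) -(act_mul rP) -ga_gtX (act_mul rP) E.
Qed.

(** The set of points fixed by [a^i] is stable under [t_j]: the image of such a point
    is fixed by [a^(i q)], hence by [a^(i q^n)], which acts as [a^i]. *)
Lemma fixed_everywhere i w w' : r w (a ^+ i) = w -> r w' (a ^+ i) = w'.
Proof.
move=> Hw; have [g1 E1] := act_trans rP w; have [g2 E2] := act_trans rP w'.
have -> : w' = r w (g1^-1 * g2) by rewrite (act_mul rP) -E1 ractK.
have step j v : r v (a ^+ i) = v -> r (r v (gt q j)) (a ^+ i) = r v (gt q j).
  move=> Hv; have [[|n] // n0 E] := ract_a_pow j.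
  rewrite -E expnS mulnA expgnA ractX.
  have Hq : r (r v (gt q j)) (a ^+ (i * q)%N) = r v (gt q j).
    by rewrite -(act_mul rP) -ga_gt_pow (act_mul rP) Hv.
  by elim: (q ^ n)%N => //= k ->.
move: (g1^-1 * g2) => g; elim/G1_ind: g w Hw {E1} => [|g IH|g IH|j g IH|j g IH] w Hw.
- by rewrite (act_one rP).
- rewrite (act_mul rP w); apply: IH; rewrite -(act_mul rP) -expgS expgSr.
  by rewrite (act_mul rP) Hw.
- rewrite (act_mul rP w); apply: IH; rewrite -(act_mul rP).
  have -> : a^-1 * a ^+ i = a ^+ i * a^-1.
    by apply: (@mulgI _ a); rewrite mulVKg mulgA -expgS expgSr mulgK.
  by rewrite (act_mul rP) Hw.
- by rewrite (act_mul rP w); apply: IH; apply: step.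
- rewrite (act_mul rP w); apply: IH; have [[|n] // n0 E] := ract_period (gt q j).
  have -> : r w (gt q j)^-1 = r w (gt q j ^+ n).
    by rewrite -{1}(E w) expgSr -(act_mul rP) mulgK.
  elim: n {n0 E} => [|n IHn]; first by rewrite (act_one rP).
  by rewrite expgSr (act_mul rP); apply: step.
Qed.

Definition alpha (w : O) : O := r w a.

Lemma alpha_inj : injective alpha. Proof. exact: ract_inj. Qed.

Lemma ract_a w i : r w (a ^+ i) = iter i alpha w. Proof. exact: ractX. Qed.

(** By [order_alpha] the length of every cycle of [a], not only of that of [o]. *)
Definition clen : nat := order alpha o.

Lemma clen_gt0 : 0 < clen. Proof. exact: order_gt0. Qed.

Lemma order_alpha w : order alpha w = clen.
Proof.
have D v v' : order alpha v %| order alpha v'.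
  rewrite -iter_order_dvd; last exact: alpha_inj.
  rewrite -ract_a; apply/eqP; apply: (@fixed_everywhere _ v').
  by rewrite ract_a; exact: iter_order alpha_inj _.
by apply/eqP; rewrite eqn_dvd !D.
Qed.

Lemma ract_a_fix w i : (r w (a ^+ i) == w) = (clen %| i).
Proof. by rewrite ract_a iter_order_dvd ?order_alpha //; exact: alpha_inj. Qed.

Lemma ract_a_mod w i : r w (a ^+ (i %% clen)) = r w (a ^+ i).
Proof.
rewrite {2}(divn_eq i clen) addnC expgnDr (act_mul rP).
by apply/esym/eqP; rewrite ract_a_fix dvdn_mull.
Qed.

Lemma clen_in_H : H (a ^+ clen).
Proof. by apply/(act_stab rP)/eqP; rewrite ract_a_fix. Qed.

(** On the cosets [a] acts as [a^(q^n)] for some [n > 0], so its order divides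
    [q^n - 1]. *)
Lemma coprime_clen : 'I_d -> coprime q clen.
Proof.
move=> j; have [n n0 E] := ract_a_pow j.
have : clen %| (q ^ n).-1.
  rewrite -(ract_a_fix o); apply/eqP; apply: (@ract_inj a).
  by rewrite -(act_mul rP) -expgSr prednK ?expn_gt0 ?q_gt0 // -[(q ^ n)%N]mul1n E.
move=> D; have : coprime (q ^ n).-1 (q ^ n) by rewrite coprime_sym coprimenP // expn_gt0 q_gt0.
by move/(coprime_dvdl D); rewrite coprime_pexpr // coprime_sym.
Qed.

End Orbits.

(** * Graphs of cyclic groups with labels [(1, q)] *)

Section SubgroupType.
Local Open Scope group_scope.
Variables (G : groupType) (H : set G) (hH : subgrp H).

(** The closure proof is an argument, so that the group structure can be attached to
    the type. *)
Definition sgT (_ : subgrp H) := {x : G | `[< H x >]}.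

HB.instance Definition _ := Choice.on (sgT hH).
HB.instance Definition _ := SubChoice.on (sgT hH).

Lemma sgP (x : sgT hH) : H (val x). Proof. exact/asboolP/(valP x). Qed.

Definition sgIn (x : G) (Hx : H x) : sgT hH := Sub x (asboolT Hx).

Definition sgmul (x y : sgT hH) := sgIn (subgrpM hH (sgP x) (sgP y)).
Definition sgone := sgIn (subgrp1 hH).
Definition sginv (x : sgT hH) := sgIn (subgrpV hH (sgP x)).

Lemma sgmulA : associative sgmul.
Proof. by move=> x y z; apply: val_inj; rewrite /= mulgA. Qed.
Lemma sgmul1 : left_id sgone sgmul.
Proof. by move=> x; apply: val_inj; rewrite /= mul1g. Qed.
Lemma sgmulr1 : right_id sgone sgmul.
Proof. by move=> x; apply: val_inj; rewrite /= mulg1. Qed.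
Lemma sgmulV : left_inverse sgone sginv sgmul.
Proof. by move=> x; apply: val_inj; rewrite /= mulVg. Qed.
Lemma sgmulrV : right_inverse sgone sginv sgmul.
Proof. by move=> x; apply: val_inj; rewrite /= mulgV. Qed.

HB.instance Definition _ :=
  isGroup.Build (sgT hH) sgmulA sgmul1 sgmulr1 sgmulV sgmulrV.

Lemma val_sgM (x y : sgT hH) : val (x * y) = val x * val y. Proof. by []. Qed.
Lemma val_sgV (x : sgT hH) : val x^-1 = (val x)^-1. Proof. by []. Qed.
Lemma val_sgX (x : sgT hH) n : val (x ^+ n) = val x ^+ n.
Proof. by elim: n => // n IH; rewrite !expgS val_sgM IH. Qed.

(** Total on [G], so that products can be formed before membership is proved. *)
Definition toA (g : G) : sgT hH := insubd (1 : sgT hH) g.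

Lemma val_toA g : H g -> val (toA g) = g.
Proof. by move=> Hg; rewrite /toA insubdK //; apply/asboolP. Qed.

Lemma toA_val x : toA (val x) = x.
Proof. by apply: val_inj; rewrite val_toA //; exact: sgP. Qed.

Lemma toA1 : toA 1 = 1.
Proof. exact: (toA_val 1). Qed.

Lemma toAM g h : H g -> H h -> toA (g * h) = toA g * toA h.
Proof.
by move=> Hg Hh; apply: val_inj; rewrite val_sgM !val_toA //; exact: subgrpM.
Qed.

End SubgroupType.

Lemma powVC (G : groupType) (x : G) i j : (x ^+ i * x ^- j = x ^- j * x ^+ i)%g.
Proof.
by apply: (@mulgI _ (x ^+ j)%g); rewrite mulVKg mulgA -expgnDr addnC expgnDr mulgK.
Qed.

(** Values of a cocycle on the generators extend to the whole group as soon as they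
    respect the relations at every point of the set acted upon.  This is the
    extension of a homomorphism from a point stabilizer to the ambient group. *)
Section Cocycle.
Local Open Scope group_scope.
Variables (X : choiceType) (R : word X -> word X -> Prop) (O : Type).
Variables (r : O -> presented R -> O) (K : groupType) (c : O -> X -> K).
Hypothesis rM : forall w g h, r w (g * h) = r (r w g) h.
Hypothesis r1 : forall w, r w 1 = w.

Definition cletter (w : O) (l : X * bool) : K :=
  if l.2 then (c (r w (pword R [:: l])) l.1)^-1 else c w l.1.

Fixpoint cword (w : O) (u : word X) : K :=
  if u is l :: u' then cletter w l * cword (r w (pword R [:: l])) u' else 1.

Hypothesis cR : forall w u v, R u v -> cword w u = cword w v.

Lemma r_cat w u v : r w (pword R (u ++ v)) = r (r w (pword R u)) (pword R v).
Proof.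
by rewrite -rM; congr r; rewrite -(pwordM R).
Qed.

Lemma cword_cat w u v : cword w (u ++ v) = cword w u * cword (r w (pword R u)) v.
Proof.
elim: u w => [|l u IH] w /=; first by rewrite mul1g (r1 w).
by rewrite IH mulgA -r_cat.
Qed.

Lemma cword_cong u v : word_cong R u v -> forall w, cword w u = cword w v.
Proof.
elim=> {u v} [u v Ruv|x b| |u v _ IH|u v w _ IH1 _ IH2|u u' v v' H1 IH1 _ IH2] w' //.
- exact: cR.
- have E : r (r w' (pword R [:: (x, b)])) (pword R [:: (x, ~~ b)]) = w'.
    rewrite -r_cat /=; have /pwordP -> := cong_inv R x b; exact: r1.
  by case: b E => /= E; rewrite /cletter /= ?E mulg1 ?mulVg ?mulgV.
- by rewrite IH1.
- by rewrite !cword_cat IH1 IH2; congr (_ * cword (r _ _) _); apply/pwordP.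
Qed.

Definition cocycle (w : O) (g : presented R) : K := cword w (repr g).

Lemma cocycle_pword w u : cocycle w (pword R u) = cword w u.
Proof. exact/cword_cong/repr_pword. Qed.

Lemma cocycleM w g h : cocycle w (g * h) = cocycle w g * cocycle (r w g) h.
Proof.
rewrite -{1}[g]pword_repr -{1}[h]pword_repr.
rewrite (_ : _ * _ = pword R (repr g ++ repr h)); last exact: pwordM.
by rewrite cocycle_pword cword_cat pword_repr.
Qed.

Lemma cocycle_gen w x : cocycle w (pword R [:: (x, false)]) = c w x.
Proof. by rewrite cocycle_pword /= mulg1. Qed.

Lemma cocycle1 w : cocycle w 1 = 1.
Proof. by apply: (@mulIg _ (cocycle w 1)); rewrite -{2}[w]r1 -cocycleM mul1g mul1g. Qed.

Lemma cocycleV w g : cocycle w g^-1 = (cocycle (r w g^-1) g)^-1.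
Proof.
by apply: (@mulIg _ (cocycle (r w g^-1) g)); rewrite -cocycleM !mulVg cocycle1.
Qed.

End Cocycle.

Record mgraph := MGraph {
  gV : finType; gE : finType; gsrc : gE -> gV; gtgt : gE -> gV }.

Section Pi1.
Local Open Scope group_scope.
Variable q : nat.

(** The homomorphisms to [X] from the fundamental groupoid of the graph of cyclic
    groups with labels [(1, q)]; the next definition is a natural isomorphism
    between the composite of [f] with [(b, t)] and [(b', t')]. *)
Definition assignment (Y : mgraph) (X : groupType) (b : gV Y -> X) (t : gE Y -> X) :=
  forall e, b (gsrc e) * t e = t e * b (gtgt e) ^+ q.

Definition compat (Y : mgraph) (A X : groupType) (f : A -> X) (g : gV Y -> X)
    (b : gV Y -> A) (t : gE Y -> A) (b' : gV Y -> X) (t' : gE Y -> X) :=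
  (forall v, f (b v) * g v = g v * b' v) /\
  (forall e, f (t e) * g (gtgt e) = g (gsrc e) * t' e).

Definition universal (Y : mgraph) (A : groupType) (b : gV Y -> A) (t : gE Y -> A) :=
  assignment b t /\
  forall (X : groupType) (b' : gV Y -> X) (t' : gE Y -> X), assignment b' t' ->
  exists (f : A -> X) (g : gV Y -> X), [/\ hom f, compat f g b t b' t' &
    forall f1 g1, hom f1 -> compat f1 g1 b t b' t' ->
    exists x, (forall v, g1 v = x * g v) /\ (forall y, f1 y = x * f y * x^-1)].

(** [A] is the fundamental group of the graph of groups [Y], all of whose vertex
    groups are infinite cyclic and whose edges have labels [(1, q)].  Stated by
    its universal property, up to simultaneous conjugation, so that neither a
    base point nor a spanning tree has to be chosen. *)
Definition pi1_of (Y : mgraph) (A : groupType) : Prop :=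
  exists (b : gV Y -> A) (t : gE Y -> A), universal b t.

End Pi1.

Section SubgroupPi1.
Local Open Scope group_scope.
Variables (q d : nat).
Hypothesis q_gt0 : 0 < q.
Local Notation G := (G1 q d).
Local Notation a := (ga q d).
Variables (H : set G) (O : finType) (o : O) (r : O -> G -> O).
Hypothesis hH : subgrp H.
Hypothesis rP : coset_action H o r.

Local Notation al := (alpha r).
Local Notation m := (clen o r).
Let al_inj : injective al := alpha_inj rP.
Let m_gt0 : 0 < m := clen_gt0 o r.

(** An orbit of [a] is represented by its canonical root. *)
Definition orbV : finType := {w : O | froot al w == w}.

Lemma orbV_root w : froot al (froot al w) == froot al w.
Proof. by apply/eqP; apply: root_root; apply: fconnect_sym. Qed.

Definition rt (w : O) : orbV := exist _ (froot al w) (orbV_root w).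
Definition ix (w : O) : nat := findex al (froot al w) w.

Definition orb_graph : mgraph :=
  @MGraph orbV (orbV * 'I_d)%type fst (fun e => rt (r (val e.1) (gt q e.2))).

Lemma rt_ix w : r (val (rt w)) (a ^+ ix w) = w.
Proof.
rewrite (ract_a rP) /= iter_findex // fconnect_sym //; exact: connect_root.
Qed.

Lemma ix_lt w : ix w < m.
Proof.
rewrite -(order_alpha rP (froot al w)) findex_max // fconnect_sym //.
exact: connect_root.
Qed.

Lemma rt_val v : rt (val v) = v.
Proof. by apply: val_inj => /=; apply/eqP/(valP v). Qed.

Lemma ix_val (v : orbV) : ix (val v) = 0.
Proof. by rewrite /ix (eqP (valP v)) findex0. Qed.

Lemma rt_ract w n : rt (r w (a ^+ n)) = rt w.
Proof.
apply: val_inj; rewrite /= (ract_a rP); apply/esym/eqP.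
by rewrite root_connect ?fconnect_iter //; exact: fconnect_sym.
Qed.

Lemma ix_ract w n : ix (r w (a ^+ n)) = (ix w + n) %% m.
Proof.
have Er : froot al (r w (a ^+ n)) = froot al w.
  by have := congr1 val (rt_ract w n).
have E : r w (a ^+ n) = iter ((ix w + n) %% m) al (froot al w).
  rewrite -[froot al w]/(val (rt w)) -(ract_a rP) (ract_a_mod rP) expgnDr.
  by rewrite (act_mul rP) rt_ix.
by rewrite {1}/ix Er E findex_iter // (order_alpha rP) ltn_mod.
Qed.

Lemma ract_gt_ix w j :
  r w (gt q j) = r (r (val (rt w)) (gt q j)) (a ^+ (ix w * q)%N).
Proof. by rewrite -(act_mul rP) -ga_gt_pow (act_mul rP) rt_ix. Qed.

Lemma ract_gt_rt w j : rt (r w (gt q j)) = rt (r (val (rt w)) (gt q j)).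
Proof. by rewrite ract_gt_ix rt_ract. Qed.

Section Target.
Variables (X : groupType) (b' : orbV -> X) (t' : orbV * 'I_d -> X).
Hypothesis as' : @assignment q orb_graph X b' t'.

(** The cocycle that is trivial along each cycle of [a] except on the edge that closes
    it.  On [t_j] the exponent counts how often [a^(i q)] goes round the target cycle
    before it reaches the image of the point with index [i]. *)
Definition ocyc (w : O) (x : gen d) : X :=
  if x is Some j then
    t' (rt w, j) * b' (rt (r w (gt q j))) ^+ ((ix (r (val (rt w)) (gt q j)) + ix w * q) %/ m)
  else if (ix w).+1 == m then b' (rt w) else 1.

Local Arguments ocyc : simpl never.
Local Notation cw := (cword r ocyc).

Lemma cword_a w n : cw w (nseq n (None, false)) = b' (rt w) ^+ ((ix w + n) %/ m).
Proof.
elim: n => [|n IH]; first by rewrite addn0 divn_small ?ix_lt.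
rewrite -addn1 nseqD (cword_cat _ (act_mul rP) (act_one rP)) IH.
rewrite ga_pow /= mulg1 /cletter /= /ocyc rt_ract ix_ract addnA addn1 divnS //.
have -> : (((ix w + n) %% m).+1 == m) = (m %| (ix w + n).+1).
  rewrite /dvdn -(addn1 (ix w + n)) -(modnDml (ix w + n)) addn1.
  have := ltn_pmod (ix w + n) m_gt0; move: (_ %% m) => y.
  rewrite leq_eqVlt => /predU1P[->|lt_m]; first by rewrite modnn !eqxx.
  by rewrite (modn_small lt_m) (ltn_eqF lt_m).
 by case: (_ %| _); rewrite ?mulg1 // -expgSr.
Qed.

Lemma cword_rel w u v : G1_rel q u v -> cw w u = cw w v.
Proof.
case=> j; rewrite cword_a /= mulg1.
set w1 := r w _; rewrite /cletter /= -/w1.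
have Ew : w = r w1 (gt q j).
  by rewrite /w1 pword_letterV -{1}(ractK rP (gt q j)^-1 w) invgK.
rewrite -[pword _ [:: (None, false)]]/a -[a in r w1 a]expg1 [in RHS]Ew.
apply: (@mulgI _ (ocyc w1 (Some j))); rewrite mulVKg /ocyc.
rewrite (ract_gt_rt (r w1 _)) -[a in r w1 a]expg1 !rt_ract ix_ract.
have Eix : ix (r w1 (gt q j)) =
    (ix (r (val (rt w1)) (gt q j)) + ix w1 * q) %% m by rewrite ract_gt_ix ix_ract.
rewrite -(ract_gt_rt w1) Eix.
set v1 := rt w1; set l := ix (r (val v1) _); set i := ix w1.
have l_lt : l < m by apply: ix_lt.
have i_lt : i < m by apply: ix_lt.
rewrite -mulgA -expgnDr.
have -> : (l + i * q) %/ m + ((l + i * q) %% m + q) %/ m = (l + i.+1 * q) %/ m.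
  by rewrite -divnMDl // addnA -divn_eq mulSn addnCA addnC.
case: eqP => [Ei|/eqP ne].
  rewrite addn1 Ei modnn mul0n addn0 (divn_small l_lt) expg0 mulg1.
  have -> : (l + m * q) %/ m = q by rewrite mulnC addnC divnMDl // divn_small // addn0.
  by have := as' (v1, j); rewrite /= -(ract_gt_rt w1).
by rewrite mul1g addn1 modn_small // ltn_neqAle ne.
Qed.

Definition ococ (w : O) (g : G) : X := cocycle r ocyc w g.

Lemma ococM w g h : ococ w (g * h) = ococ w g * ococ (r w g) h.
Proof. exact: (cocycleM (act_mul rP) (act_one rP) cword_rel). Qed.

Lemma ococ1 w : ococ w 1 = 1.
Proof. exact: (cocycle1 (act_mul rP) (act_one rP) cword_rel). Qed.

Lemma ococV w g : ococ w g^-1 = (ococ (r w g^-1) g)^-1.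
Proof. exact: (cocycleV (act_mul rP) (act_one rP) cword_rel). Qed.

Lemma ococ_a w n : ococ w (a ^+ n) = b' (rt w) ^+ ((ix w + n) %/ m).
Proof.
by rewrite -cword_a -ga_pow; exact: (cocycle_pword (act_mul rP) (act_one rP) cword_rel).
Qed.

Lemma ococ_ga w : ococ w a = ocyc w None.
Proof. exact: (cocycle_gen (act_mul rP) (act_one rP) cword_rel). Qed.

Lemma ococ_gt w j : ococ w (gt q j) = ocyc w (Some j).
Proof. exact: (cocycle_gen (act_mul rP) (act_one rP) cword_rel). Qed.

Lemma cocycle_unique (F : O -> G -> X) :
  (forall w g h, F w (g * h) = F w g * F (r w g) h) ->
  (forall w, F w a = ocyc w None) -> (forall w j, F w (gt q j) = ocyc w (Some j)) ->
  forall w g, F w g = ococ w g.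
Proof.
move=> FM Fa Ft w g; have F1 v : F v 1 = 1.
  by apply: (@mulIg _ (F v 1)); rewrite -{2}[v](act_one rP) -FM mul1g mul1g.
have FV v h : F v h^-1 = (F (r v h^-1) h)^-1.
  by apply: (@mulIg _ (F (r v h^-1) h)); rewrite -FM !mulVg F1.
elim/G1_ind: g w => [|g IH|g IH|j g IH|j g IH] w; rewrite ?F1 ?ococ1 // FM ococM IH.
- by rewrite Fa ococ_ga.
- by rewrite FV ococV Fa ococ_ga.
- by rewrite Ft ococ_gt.
- by rewrite FV ococV Ft ococ_gt.
Qed.

End Target.

(** Reidemeister-Schreier: a homomorphism out of [H] extends to a cocycle on the
    cosets, and the freedom in extending it allows the cocycle to be trivial on all
    but one edge of each cycle of [a].  What is left is an element for each cycle and
    one for each edge of the orbit graph, subject to the relations of the graph. *)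
Lemma subgroup_pi1 : pi1_of q orb_graph (sgT hH).
Proof.
have /choice[tr trE] := act_trans rP.
have memH g1 g2 : r o g1 = r o g2 -> H (g1 * g2^-1).
  by move=> E; apply/(act_stab rP); rewrite (act_mul rP) E (ractK rP).
have roH g : H g -> r o g = o by move/(act_stab rP).
(* The Schreier generators for the transversal [tr v a^i]. *)
pose tA := @toA _ _ hH.
pose b (v : orbV) := tA (tr (val v) * a ^+ m * (tr (val v))^-1).
pose tt (e : orbV * 'I_d) :=
  let w := r (val e.1) (gt q e.2) in
  tA (tr (val e.1) * gt q e.2 * (a ^+ ix w)^-1 * (tr (val (rt w)))^-1).
have rm w : r w (a ^+ m) = w by apply/eqP; rewrite (ract_a_fix rP).
have Hb v : H (tr (val v) * a ^+ m * (tr (val v))^-1).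
  by apply: memH; rewrite (act_mul rP) trE rm.
have rVix w : r w (a ^+ ix w)^-1 = val (rt w) by rewrite -{1}(rt_ix w) (ractK rP).
have Ht (e : orbV * 'I_d) : let w := r (val e.1) (gt q e.2) in
  H (tr (val e.1) * gt q e.2 * (a ^+ ix w)^-1 * (tr (val (rt w)))^-1).
  by apply: memH; rewrite !(act_mul rP) !trE rVix.
have vb v : val (b v) = tr (val v) * a ^+ m * (tr (val v))^-1 by rewrite val_toA.
have vt e : val (tt e) = tr (val e.1) * gt q e.2 *
   (a ^+ ix (r (val e.1) (gt q e.2)))^-1 * (tr (val (rt (r (val e.1) (gt q e.2)))))^-1.
  by rewrite val_toA //; apply: Ht.
have vbX v k : val (b v ^+ k) = tr (val v) * a ^+ (m * k)%N * (tr (val v))^-1.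
  rewrite val_sgX vb; elim: k => [|k IH]; first by rewrite muln0 !expg0 mulg1 mulgV.
  by rewrite expgS IH mulnS expgnDr !mulgA mulgVK.
exists b, tt; split.
  move=> e; apply: val_inj; rewrite !val_sgM vbX vb vt /=.
  set w := r _ _; rewrite !mulgA !mulgVK; congr (_ * _).
  rewrite -!(mulgA (tr _)); congr (_ * _).
  rewrite ga_gt_pow -!mulgA; congr (_ * _); exact: powVC.
move=> X b' t' as'.
pose f (x : sgT hH) : X := ococ b' t' o (val x).
pose g (v : orbV) : X := ococ b' t' o (tr (val v)).
have roV (x : sgT hH) : r o (val x) = o by apply/(act_stab rP); exact: sgP.
have fM : hom f by move=> x y; rewrite /f val_sgM ococM // roV.
exists f, g; split=> //.
  split=> [v|e].
    rewrite /f /g -[in X in _ * X](roV (b v)) -ococM // vb mulgVK ococM // trE ococ_a //.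
    by rewrite rt_val ix_val add0n divnn m_gt0.
  rewrite /f /g -[in X in _ * X](roV (tt e)) -ococM // vt /= mulgVK -mulgA ococM // trE.
  congr (_ * _); rewrite ococM // ococ_gt // /ocyc rt_val ix_val mul0n addn0.
  rewrite divn_small ?ix_lt // expg0 mulg1 ococV // rVix ococ_a // ix_val add0n.
  by rewrite divn_small ?ix_lt // invg1 mulg1; case: e.
move=> f1 g1 f1M [cb ct].
have [T TE] : {T : O -> G | forall w, T w = tr (val (rt w)) * a ^+ ix w}.
  by exists (fun w => tr (val (rt w)) * a ^+ ix w).
have roT w : r o (T w) = w by rewrite TE (act_mul rP) trE rt_ix.
have HT w h : H (T w * h * (T (r w h))^-1).
  by apply: memH; rewrite (act_mul rP) !roT.
(* The cocycle of [f1], framed by [g1], is normalized, hence equal to [ococ]. *)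
pose F w h := (g1 (rt w))^-1 * f1 (tA (T w * h * (T (r w h))^-1)) * g1 (rt (r w h)).
have FE w h : F w h = ococ b' t' w h.
  apply: cocycle_unique => {w h} // [w h1 h2|w|w j].
  - rewrite /F (act_mul rP).
    have -> : tA (T w * (h1 * h2) * (T (r (r w h1) h2))^-1) =
      tA (T w * h1 * (T (r w h1))^-1) * tA (T (r w h1) * h2 * (T (r (r w h1) h2))^-1).
      by rewrite /tA -(toAM hH (HT _ _) (HT _ _)) !mulgA mulgVK.
    by rewrite f1M !mulgA mulgK.
  - rewrite /F -[a in r w a]expg1 rt_ract !TE rt_ract ix_ract addn1 /=.
    case: eqP => [E|/eqP ne].
      rewrite E modnn expg0 mulg1 -(mulgA (tr _)) -expgSr E.
      by rewrite -/(b (rt w)) -mulgA cb mulKg.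
    rewrite modn_small; last by rewrite ltn_neqAle ne ix_lt.
    by rewrite [a ^+ _.+1]expgSr mulgA mulgV /tA toA1 (hom1 f1M) mulg1 mulVg.
  - pose v := rt w; pose l := ix (r (val v) (gt q j)); pose k := (l + ix w * q) %/ m.
    pose u := rt (r (val v) (gt q j)).
    have E : T w * gt q j * (T (r w (gt q j)))^-1 = val (tt (v, j) * b u ^+ k).
      rewrite val_sgM vt vbX /= -/l -/u !TE ract_gt_rt -/v -/u.
      rewrite [ix (r w _)](_ : _ = (l + ix w * q) %% m); last by rewrite ract_gt_ix ix_ract.
      rewrite !mulgA mulgVK invgM !mulgA; congr (_ * _).
      rewrite -!(mulgA (tr _)); congr (_ * _); rewrite ga_gt_pow -!mulgA; congr (_ * _).
      set z := (l + _) %% m; apply: (@mulIg _ (a ^+ z)); rewrite mulgVK.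
      apply: (@mulgI _ (a ^+ l)); rewrite -!mulgA mulVKg -!expgnDr.
      by rewrite (mulnC m) /k /z -divn_eq.
    rewrite /F E /tA toA_val f1M (homX f1M) ract_gt_rt -/v -/u.
    have cbX : f1 (b u) ^+ k * g1 u = g1 u * b' u ^+ k.
      elim: (k) => [|i IH]; first by rewrite !expg0 mul1g mulg1.
      by rewrite expgSr -mulgA cb mulgA IH -mulgA -expgSr.
    have ctv := ct (v, j); rewrite /= -/u in ctv.
    by rewrite -!mulgA cbX (mulgA (f1 _)) ctv -mulgA mulKg /ocyc ract_gt_rt.
have HTo : H (T o) by apply/(act_stab rP).
pose x := (f1 (tA (T o)))^-1 * g1 (rt o).
exists x; split=> [v|y].
  have := FE o (tr (val v)); rewrite /F trE.
  have -> : T (val v) = tr (val v) by rewrite TE rt_val ix_val mulg1.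
  by rewrite mulgK rt_val /g /x => <-; rewrite !mulgA mulgK mulVg mul1g.
rewrite /f -FE /F roV.
rewrite (_ : T o * val y * (T o)^-1 = val (tA (T o) * y * (tA (T o))^-1)); last first.
  by rewrite !val_sgM val_sgV val_toA.
rewrite /tA !toA_val !f1M (homV f1M) /x !invgM invgK !mulgA.
by rewrite !mulgK mulVg mul1g mulgVK.
Qed.

End SubgroupPi1.

(** * Folding the graph of groups onto a cycle *)

Section Folding.
Local Open Scope group_scope.
Variables (q : nat) (A : groupType).

(** A change of framing at the vertices is absorbed in the natural isomorphism. *)
Lemma universal_gauge (Y : mgraph) (b : gV Y -> A) (t : gE Y -> A) (h : gV Y -> A) :
  universal q b t ->
  universal q (fun v => b v ^ h v) (fun e => (h (gsrc e))^-1 * t e * h (gtgt e)).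
Proof.
move=> [bt U]; split.
  move=> e; rewrite -conjXg /conjg !mulgA !mulgK.
  by rewrite -(mulgA _ (b _)) bt !mulgA.
move=> X b' t' as'; have [f [g [fM [fb ft] funi]]] := U X b' t' as'.
exists f, (fun v => (f (h v))^-1 * g v); split=> //.
  split=> [v|e].
    rewrite /conjg !fM (homV fM) !mulgA mulgK -!mulgA; congr (_ * _); exact: fb.
  by rewrite !fM (homV fM) -!mulgA mulVKg; congr (_ * _); exact: ft.
move=> f1 g1 f1M [fb1 ft1]; have [|x [xg xf]] := funi f1 (fun v => f1 (h v) * g1 v) f1M.
  split=> [v|e].
    have := fb1 v; rewrite /conjg !f1M (homV f1M) => E.
    by rewrite -[RHS]mulgA -E !mulgA mulgV mul1g.
  have := ft1 e; rewrite !f1M (homV f1M) => E.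
  by rewrite -[RHS]mulgA -E !mulgA mulgV mul1g.
exists x; split=> // v; have E := xg v; rewrite xf in E.
have {}E : f (h v) * (x^-1 * g1 v) = g v by apply: (@mulgI _ x); rewrite -E !mulgA.
by rewrite -E mulKg mulVKg.
Qed.

Lemma pi1_iso (Y Z : mgraph) (fV : gV Y -> gV Z) (fV' : gV Z -> gV Y)
    (fE : gE Y -> gE Z) (fE' : gE Z -> gE Y) :
  cancel fV' fV -> cancel fV fV' -> cancel fE' fE -> cancel fE fE' ->
  (forall e, gsrc (fE e) = fV (gsrc e)) -> (forall e, gtgt (fE e) = fV (gtgt e)) ->
  pi1_of q Y A -> pi1_of q Z A.
Proof.
move=> VK VK' EK EK' sE tE [b [t [bt U]]].
have sE' e : gsrc (fE' e) = fV' (gsrc e) by rewrite -{2}(EK e) sE VK'.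
have tE' e : gtgt (fE' e) = fV' (gtgt e) by rewrite -{2}(EK e) tE VK'.
exists (b \o fV'), (t \o fE'); split=> [e|X b' t' as'] /=.
  by have := bt (fE' e); rewrite sE' tE'.
have [|f [g [fM [fb ft] funi]]] := U X (b' \o fV) (t' \o fE).
  by move=> e /=; have := as' (fE e); rewrite sE tE.
exists f, (g \o fV'); split=> //.
  split=> [v|e] /=; first by rewrite fb /= VK.
  by have := ft (fE' e); rewrite /= EK sE' tE'.
move=> f1 g1 f1M [fb1 ft1]; have [|x [xg xf]] := funi f1 (g1 \o fV) f1M.
  split=> [v|e] /=; first by have := fb1 (fV v); rewrite /= VK'.
  by have := ft1 (fE e); rewrite /= EK' sE tE.
by exists x; split=> // v; have := xg (fV' v); rewrite /= VK.
Qed.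

Section OneFold.
Variables (Y : mgraph) (e1 e2 : gE Y).
Hypothesis tgt12 : gtgt e1 = gtgt e2.
Hypothesis src12 : gsrc e1 != gsrc e2.

Definition foldV : finType := {v : gV Y | v != gsrc e2}.
Definition foldE : finType := {e : gE Y | e != e2}.

Definition fold1 : foldV := exist _ (gsrc e1) src12.
Definition rho (v : gV Y) : foldV := insubd fold1 v.
Definition fold_graph : mgraph :=
  @MGraph foldV foldE (fun e => rho (gsrc (val e))) (fun e => rho (gtgt (val e))).

Lemma val_rho v : val (rho v) = if v == gsrc e2 then gsrc e1 else v.
Proof. by rewrite val_insubd; case: eqP. Qed.

Lemma rho_val v : rho (val v) = v.
Proof. by rewrite /rho valKd. Qed.

Lemma rho_src2 : rho (gsrc e2) = rho (gsrc e1).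
Proof. by apply: val_inj; rewrite !val_rho eqxx; case: eqP. Qed.

Lemma e12 : e1 != e2.
Proof. by apply: contraNneq src12 => ->. Qed.

Lemma fold_edge (e : gE Y) : exists e' : gE fold_graph,
  gsrc e' = rho (gsrc e) /\ gtgt e' = rho (gtgt e).
Proof.
have [->|ne] := eqVneq e e2; last by exists (exist _ e ne).
by exists (exist _ e1 e12); rewrite /= rho_src2 tgt12.
Qed.

(** Both edges conjugate the generator at their origin to the [q]-th power of the
    generator at the common end.  After a change of framing at the second origin the
    two edges carry the same element, and then the origins have the same generator.
    The framing at the common end must not change, whence the hypothesis. *)
Lemma pi1_fold_aux : gtgt e1 != gsrc e2 -> pi1_of q Y A -> pi1_of q fold_graph A.
Proof.
move=> w2 [b0 [t0 U0]].
pose h v := if v == gsrc e2 then t0 e2 * (t0 e1)^-1 else 1.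
have := universal_gauge h U0.
set b := (fun v => _); set t := (fun e => _) => -[bt U].
have t12 : t e2 = t e1.
  rewrite /t /h -tgt12 (negbTE w2) eqxx (negbTE src12) invg1 mul1g !mulg1 invgM invgK.
  by rewrite mulgVK.
have b12 : b (gsrc e2) = b (gsrc e1).
  by apply: (@mulIg _ (t e1)); rewrite -{1}t12 !bt t12 tgt12.
have brho v : b (val (rho v)) = b v by rewrite val_rho; case: eqP => [->|].
have trho (e' : foldE) : t (val e') = t (val e') by [].
exists (b \o val), (t \o val); split=> [e'|X b' t' as'].
  by rewrite /= !brho bt.
pose t1 e := if e == e2 then t' (exist _ e1 e12) else t' (insubd (exist _ e1 e12 : foldE) e).
have t1E (e' : foldE) : t1 (val e') = t' e'.
  by rewrite /t1 (negbTE (valP e')) valKd.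
have [|f [g [fM [fb ft] funi]]] := U X (b' \o rho) t1.
  move=> e /=; have [->|ne] := eqVneq e e2.
    by rewrite rho_src2 -tgt12 /t1 eqxx; exact: (as' (exist _ e1 e12)).
  by rewrite -[e]/(val (exist _ e ne : foldE)) t1E; exact: (as' (exist _ e ne)).
have g12 : g (gsrc e2) = g (gsrc e1).
  have := ft e2; rewrite t12 -tgt12 ft.
  have -> : t1 e2 = t1 e1.
    by rewrite -[e1]/(val (exist _ e1 e12 : foldE)) t1E /t1 eqxx.
  by move/mulIg.
have grho v : g (val (rho v)) = g v by rewrite val_rho; case: eqP => [->|].
exists f, (g \o val); split=> //.
  split=> [v|e'] /=; first by have := fb (val v); rewrite /= rho_val.
  by rewrite !grho ft t1E.
move=> f1 g1 f1M [fb1 ft1]; have [|x [xg xf]] := funi f1 (g1 \o rho) f1M.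
  split=> [v|e] /=; first by have := fb1 (rho v); rewrite /= brho.
  have [->|ne] := eqVneq e e2.
    rewrite t12 rho_src2 -tgt12 /t1 eqxx; exact: (ft1 (exist _ e1 e12)).
  by rewrite -[e]/(val (exist _ e ne : foldE)) t1E; exact: (ft1 (exist _ e ne)).
by exists x; split=> // v; have := xg (val v); rewrite /= rho_val.
Qed.

End OneFold.

Definition grading n (Y : mgraph) (gr : gV Y -> nat) :=
  forall e, gr (gtgt e) = (gr (gsrc e)).+1 %[mod n].

(** The properties of the orbit graph that folding preserves and that pin down the
    cycle in the end: [good_max] gives its length, and [good_card] the number of
    parallel edges, since a fold removes one edge and one vertex of the same degree,
    the degree of a vertex [v] being [gr v] modulo [p]. *)
Record good p c (Y : mgraph) (gr : gV Y -> nat) : Prop := Good {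
  good_gr : grading p gr;
  good_max : forall n gr', 0 < n -> @grading n Y gr' -> n %| p;
  good_conn : forall f : gV Y -> nat, (forall e, f (gsrc e) = f (gtgt e)) ->
    forall v w, f v = f w;
  good_out : forall v : gV Y, exists e, gsrc e = v;
  good_in : forall v : gV Y, exists e, gtgt e = v;
  good_card : forall i, #|[pred e : gE Y | gr (gsrc e) %% p == i]| =
                        (#|[pred v : gV Y | gr v %% p == i]| + (i < p) * c)%N }.

Lemma card_subtype (T : finType) (P Q : pred T) :
  #|[pred x : {x : T | P x} | Q (val x)]| = #|[pred x | Q x & P x]|.
Proof.
rewrite -(fintype.card_image val_inj); apply: eq_card => x; apply/fintype.imageP/idP.
  by case=> y; rewrite !inE => Qy ->; rewrite Qy (valP y).
by rewrite inE => /andP[Qx Px]; exists (exist _ x Px).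
Qed.

Lemma good_fold p c Y gr (e1 e2 : gE Y) (src12 : gsrc e1 != gsrc e2) :
  gtgt e1 = gtgt e2 -> @good p c Y gr ->
  @good p c (fold_graph src12) (fun v => gr (val v)).
Proof.
move=> tgt12 gd; have gr12 : gr (gsrc e1) = gr (gsrc e2) %[mod p].
  have E1 := good_gr gd e1; have E2 := good_gr gd e2.
  move: E2; rewrite -tgt12 E1 => /eqP.
  by rewrite -[(gr (gsrc e1)).+1]addn1 -[(gr (gsrc e2)).+1]addn1 eqn_modDr => /eqP.
have grrho v : gr (val (rho src12 v)) = gr v %[mod p].
  by rewrite val_rho; case: eqP => [->|].
split.
- move=> e' /=; rewrite grrho (good_gr gd) -addn1 -modnDml -grrho modnDml addn1 //.
- move=> n gr' n0 G'; apply: (good_max gd (gr' := gr' \o rho src12)) => // e /=.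
  by have [e' [<- <-]] := fold_edge tgt12 src12 e; apply: G'.
- move=> f fE v w; have := good_conn gd (f := f \o rho src12) _ (val v) (val w).
  rewrite /= !rho_val; apply=> e; have [e' [<- <-]] := fold_edge tgt12 src12 e; exact: fE.
- move=> v; have [e Ee] := good_out gd (val v).
  have [e' [E _]] := fold_edge tgt12 src12 e; exists e'; by rewrite E Ee rho_val.
- move=> v; have [e Ee] := good_in gd (val v).
  have [e' [_ E]] := fold_edge tgt12 src12 e; exists e'; by rewrite E Ee rho_val.
- move=> i; have := good_card gd i.
  rewrite (cardD1 e2) (cardD1 (gsrc e2) [pred v | _]) !inE -addnA => /addnI.
  have -> : #|[pred e : gE (fold_graph src12) | gr (val (gsrc e)) %% p == i]| =
            #|[pred e | gr (gsrc e) %% p == i & e != e2]|.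
    by rewrite -card_subtype; apply: eq_card => e; rewrite !inE /= grrho.
  have -> : #|[pred v : gV (fold_graph src12) | gr (val v) %% p == i]| =
            #|[pred v | gr v %% p == i & v != gsrc e2]|.
    exact: (card_subtype (fun v => v != gsrc e2) (fun v => gr v %% p == i)).
  move=> E; transitivity #|[predD1 [pred e | gr (gsrc e) %% p == i] & e2]|.
    by apply: eq_card => x; rewrite !inE andbC.
  by rewrite E; congr (_ + _)%N; apply: eq_card => x; rewrite !inE andbC.
Qed.

Definition unfoldable (Y : mgraph) :=
  forall e1 e2 : gE Y, gtgt e1 = gtgt e2 -> gsrc e1 = gsrc e2.

(** Each fold removes a vertex.  A loop is folded onto the other edge by exchanging
    the roles of the two edges. *)
Lemma fold_all p c Y gr : @good p c Y gr -> pi1_of q Y A ->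
  exists Z gr', [/\ @good p c Z gr', pi1_of q Z A & unfoldable Z].
Proof.
have [n] := ubnP #|gV Y|; elim: n Y gr => // n IH Y gr leYn gd piY.
case: (pselect (unfoldable Y)) => [ufY|]; first by exists Y, gr.
case/existsNP=> e1 /existsNP[e2 /not_implyP[tgt12 /eqP src12]].
have smaller (e1' e2' : gE Y) (src12' : gsrc e1' != gsrc e2') :
    #|gV (fold_graph src12')| < n.
  have -> : #|gV (fold_graph src12')| = #|predC1 (gsrc e2')|.
    transitivity #|[pred v | true & v != gsrc e2']|.
      by rewrite -card_subtype; exact: eq_card.
    exact: eq_card.
  have : 0 < #|gV Y| by apply/fintype.card_gt0P; exists (gsrc e2').
  by rewrite cardC1; case: #|gV Y| leYn.
have [w1|w2] := eqVneq (gtgt e1) (gsrc e2).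
  rewrite eq_sym in src12.
  apply: (IH _ _ (smaller _ _ src12) (good_fold src12 (esym tgt12) gd)).
  by apply: pi1_fold_aux => //; rewrite -tgt12 w1.
apply: (IH _ _ (smaller _ _ src12) (good_fold src12 tgt12 gd)).
exact: pi1_fold_aux.
Qed.

End Folding.

(** A vertex is named by its distance to the vertex [0] along the edges, so that an
    edge leads from [i.+1] to [i] and from [0] to [p]. *)
Definition cycle_graph (p c : nat) : mgraph :=
  @MGraph 'I_p.+1 ('I_p.+1 * 'I_c.+1)%type fst
    (fun e => inord (if val e.1 is i.+1 then i else p)).

Lemma surj_inj (T : finType) (f : T -> T) : (forall y, exists x, f x = y) -> injective f.
Proof.
move=> /choice[g fg]; have g_bij : bijective g by apply: injF_bij; apply: can_inj fg.
have gf : cancel f g by apply/(bij_can_sym g_bij).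
exact: can_inj gf.
Qed.

Lemma findex_iter_mod (T : finType) (f : T -> T) x i : injective f ->
  findex f x (iter i f x) = i %% order f x.
Proof.
move=> f_inj; have lt_r : i %% order f x < order f x by rewrite ltn_mod order_gt0.
rewrite -[RHS](findex_iter lt_r); congr findex.
have /eqP E : iter (i %/ order f x * order f x) f x == x.
  by rewrite iter_order_dvd // dvdn_mull.
by rewrite {1}(divn_eq i (order f x)) addnC iterD E.
Qed.

Section Cycle.
Variables (q : nat) (A : groupType) (p c : nat) (Y : mgraph) (gr : gV Y -> nat).
Hypothesis p_gt0 : 0 < p.
Hypothesis gd : good p c gr.
Hypothesis uf : unfoldable Y.
Variable v0 : gV Y.

(** With no fold left, a vertex has a single predecessor; as every vertex has a
    successor, predecessor is a permutation, transitive by connectedness.  Its order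
    is [p] by maximality, and then each degree consists of one vertex. *)
Lemma unfoldable_cycle : pi1_of q Y A -> pi1_of q (cycle_graph p.-1 c) A.
Proof.
have /choice[ein einE] := good_in gd.
pose pr v := gsrc (ein v).
have prE e : gsrc e = pr (gtgt e) by apply: uf; rewrite einE.
have pr_inj : injective pr.
  by apply: surj_inj => v; have [e Ee] := good_out gd v; exists (gtgt e); rewrite -prE.
have conn v : fconnect pr v0 v.
  have := good_conn gd (f := fun v => nat_of_bool (fconnect pr v0 v)) _ v v0.
  rewrite connect0 => H; suff: nat_of_bool (fconnect pr v0 v) = true by case: (fconnect pr v0 v).
  by apply: H => e; rewrite prE -same_fconnect1_r.
pose n := order pr v0; pose de v := findex pr v0 v.
have n0 : 0 < n by apply: order_gt0.
have deK v : iter (de v) pr v0 = v by apply: iter_findex.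
have de_lt v : de v < n by apply: findex_max.
have de_pr v : de (pr v) = (de v).+1 %% n.
  by rewrite -{1}(deK v) -iterS /de findex_iter_mod.
have grit i : gr (iter i pr v0) + i = gr v0 %[mod p].
  elim: i => [|i IH]; first by rewrite addn0.
  rewrite -IH -[in RHS](einE (iter i pr v0)) addnS -addSn.
  by rewrite -[in RHS]modnDml (good_gr gd) modnDml.
have pn : p = n.
  apply/eqP; rewrite eqn_dvd; apply/andP; split.
    have := grit n; rewrite iter_order // -{2}[gr v0]addn0 => /eqP.
    by rewrite eqn_modDl mod0n.
  apply: (good_max gd (gr' := fun v => n - de v)) => // e.
  rewrite prE de_pr; have := de_lt (gtgt e); set x := de _; move=> lt_x.
  have := lt_x; rewrite leq_eqVlt => /predU1P[E|lt_x1].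
    by rewrite E modnn subn0 -addn1 modnDl; congr (_ %% _); lia.
  by rewrite [x.+1 %% n]modn_small //; congr (_ %% _); lia.
have gr_inj v w : gr v = gr w %[mod p] -> v = w.
  move=> E; rewrite -(deK v) -(deK w); congr iter.
  have := grit (de v); rewrite -(grit (de w)) !deK -modnDml E modnDml => /eqP.
  by rewrite eqn_modDl pn !modn_small // => /eqP.
have card_out (v : gV Y) : #|[pred e | gsrc e == v]| = c.+1.
  have := good_card gd (gr v %% p); rewrite ltn_mod p_gt0 mul1n.
  have -> : #|[pred v1 : gV Y | gr v1 %% p == gr v %% p]| = 1.
    rewrite -(card1 v); apply: eq_card => w; rewrite !inE.
    by apply/eqP/eqP => [/gr_inj|->].
  rewrite add1n => <-; apply: eq_card => e; rewrite !inE.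
  by apply/eqP/eqP => [->|/gr_inj].
have p1 : p.-1.+1 = p by apply: prednK.
pose fV (v : gV Y) : 'I_p.-1.+1 := inord (de v).
pose fV' (i : 'I_p.-1.+1) : gV Y := iter i pr v0.
have fVE v : fV v = de v :> nat by rewrite inordK // p1 pn.
have VK' : cancel fV fV' by move=> v; rewrite /fV' fVE deK.
have VK : cancel fV' fV.
  move=> i; apply: val_inj; rewrite /= fVE /fV' /de findex_iter_mod // -/n -pn.
  by rewrite modn_small // -[p in _ < p]p1.
pose es v := enum [pred e : gE Y | gsrc e == v].
have size_es v : size (es v) = c.+1 by rewrite -(card_out v) cardE.
have mem_es v e : (e \in es v) = (gsrc e == v) by rewrite mem_enum inE.
have e0 : gE Y by exact: (ein v0).
pose fE (e : gE Y) : 'I_p.-1.+1 * 'I_c.+1 := (fV (gsrc e), inord (index e (es (gsrc e)))).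
pose fE' (ij : 'I_p.-1.+1 * 'I_c.+1) : gE Y := nth e0 (es (fV' ij.1)) ij.2.
have EK' : cancel fE fE'.
  move=> e; have me : e \in es (gsrc e) by rewrite mem_es.
  by rewrite /fE' /fE /= VK' inordK ?nth_index // -(size_es (gsrc e)) index_mem.
have EK : cancel fE' fE.
  move=> [i j]; have lj : j < size (es (fV' i)) by rewrite size_es.
  have : fE' (i, j) \in es (fV' i) by rewrite mem_nth.
  rewrite mem_es => /eqP E; rewrite /fE E VK /fE' /= index_uniq ?enum_uniq //.
  by rewrite inord_val.
apply: (@pi1_iso q A Y (cycle_graph p.-1 c) fV fV' fE fE') => // e.
apply: val_inj; rewrite /= !fVE prE de_pr.
have lt_w := de_lt (gtgt e); have := lt_w; rewrite leq_eqVlt => /predU1P[E|lt1].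
  by rewrite E modnn inordK //; lia.
by rewrite modn_small //= inordK //; lia.
Qed.
End Cycle.

(** * Groups with one distorted cyclic subgroup *)

Section Presentation.
Local Open Scope group_scope.

Definition pres_assign (Q : nat) (J : finType) (ex : J -> nat) (X : groupType)
    (b s : X) (u : J -> X) : Prop :=
  b * s = s * b ^+ Q /\ forall j, b ^+ ex j * u j = u j * b ^+ ex j.

(** The universal property of
    [<b, s, u_j | s^-1 b s = b^Q, [b^(ex j), u_j] = 1>]. *)
Definition presented_by (Q : nat) (J : finType) (ex : J -> nat) (A : groupType) :=
  exists (b s : A) (u : J -> A), pres_assign Q ex b s u /\
  forall (X : groupType) (b' s' : X) (u' : J -> X), pres_assign Q ex b' s' u' ->
  exists f : A -> X, [/\ hom f, f b = b', f s = s', forall j, f (u j) = u' j &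
    forall f1, hom f1 -> f1 b = b' -> f1 s = s' -> (forall j, f1 (u j) = u' j) ->
    forall y, f1 y = f y].

(** Framing the vertices along a path of edges to the vertex [0] makes these edges
    trivial and every vertex generator a power of [b], the one at [0].  The edge that
    closes the cycle is [s]; each other edge, completed to a loop at [0] by the path
    and, if need be, by [s^-1], centralizes the generator at its origin. *)
Lemma cycle_presentation q p c (A : groupType) : pi1_of q (cycle_graph p c) A ->
  @presented_by (q ^ p.+1)%N ('I_p.+1 * 'I_c)%type (fun ij => (q ^ ij.1)%N) A.
Proof.
move=> [b0 [t0 U0]].
(* The product of the edges of the path from [k] to [0]. *)
pose th := fix th k : A := if k is k'.+1 then t0 (inord k, ord0) * th k' else 1.
have := @universal_gauge q A (cycle_graph p c) b0 t0 (fun v : 'I_p.+1 => th v) U0.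
set b := (fun v => _); set t := (fun e => _) => -[bt U].
pose Y := cycle_graph p c.
have tgtS (k : nat) j : k < p ->
    @gtgt Y (inord k.+1, j) = inord k.
  by move=> kp; rewrite /= inordK.
have tgt0 j : @gtgt Y (ord0, j) = ord_max by apply: val_inj; rewrite /= inordK.
have ttree k : k < p -> t (inord k.+1, ord0) = 1.
  move=> kp; rewrite /t tgtS //= !inordK //; last exact: ltnW.
  by rewrite -mulgA mulVg.
clearbody b t.
have bq k : k <= p -> b (inord k) = b ord0 ^+ (q ^ k)%N.
  elim: k => [|k IH] kp; first by rewrite expn0 expg1; congr b; apply: val_inj; rewrite /= inordK.
  have := bt (inord k.+1, ord0); rewrite ttree // tgtS //= mulg1 mul1g => ->.
  by rewrite IH ?(ltnW kp) // -expgnA -expnSr.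
have bmax : b ord_max = b ord0 ^+ (q ^ p)%N.
  by rewrite -bq //; congr b; apply: val_inj; rewrite /= inordK.
pose s := t (ord0, ord0).
have bs : b ord0 * s = s * b ord0 ^+ (q ^ p.+1)%N.
  by rewrite /s (bt (ord0, ord0)) tgt0 bmax -expgnA -expnSr.
(* The value of the edge [(i, ord0)]: trivial on the path, [s1] where it closes up. *)
pose corr (X : groupType) (i : 'I_p.+1) (s1 : X) := if val i is _.+1 then 1 else s1.
pose u (ij : 'I_p.+1 * 'I_c) := t (ij.1, lift ord0 ij.2) * (corr A ij.1 s)^-1.
exists (b ord0), s, u; split.
  split=> // -[i j]; pose e : gE Y := (i, lift ord0 j).
  have : b i * t e = t e * b (gtgt e) ^+ q := bt e; rewrite {}/e /u /corr /fst /snd.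
  case: i => [[|i] lti] Hb.
    move: Hb; rewrite (_ : Ordinal lti = ord0); last exact: val_inj.
    rewrite tgt0 bmax -expgnA -expnSr expn0 expg1 mulgA => ->.
    by rewrite -!mulgA; congr (_ * _); apply: (@mulIg _ s); rewrite mulgVK -mulgA bs mulKg.
  have Ei : Ordinal lti = inord i.+1 by apply: val_inj; rewrite /= inordK.
  have ip : i <= p by exact: ltnW.
  rewrite Ei tgtS // !bq // -!expgnA -!expnSr in Hb.
  by rewrite /= invg1 mulg1 Ei.
move=> X b' s' u' [bs' bu'].
pose b1 (i : 'I_p.+1) := b' ^+ (q ^ i)%N.
pose t1 (e : 'I_p.+1 * 'I_c.+1) : X :=
  if unlift ord0 e.2 is Some j then u' (e.1, j) * corr X e.1 s' else corr X e.1 s'.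
have bcorr (i : 'I_p.+1) : b' ^+ (q ^ i)%N * corr X i s' =
    corr X i s' * b1 (@gtgt Y (i, ord0)) ^+ q.
  rewrite /corr /b1; case: i => [[|i] lti] /=.
    by rewrite inordK // -expgnA -expnSr expn0 expg1.
  by rewrite inordK ?(ltnW lti) // mulg1 mul1g -expgnA -expnSr.
have as1 : @assignment q Y X b1 t1.
  move=> [i j]; rewrite /t1 /b1 /=; case: unliftP => [j' _|_]; last exact: bcorr.
  by rewrite mulgA (bu' (i, j')) -!mulgA (bcorr i).
have [f [g [fM [fb ft] funi]]] := U X b1 t1 as1.
have t10 i : t1 (i, ord0) = corr X i s' by rewrite /t1 unlift_none.
have t1S i j : t1 (i, lift ord0 j) = u' (i, j) * corr X i s' by rewrite /t1 liftK.
have gk k : k <= p -> g (inord k) = g ord0.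
  elim: k => [|k IH] kp; first by congr g; apply: val_inj; rewrite /= inordK.
  have := ft (inord k.+1, ord0); rewrite ttree // (hom1 fM) t10 tgtS //= mul1g.
  by rewrite /corr -[val _]/(nat_of_ord _) inordK // mulg1 => <-; apply: IH; apply: ltnW.
have gE i : g i = g ord0 by rewrite -(gk i) ?inord_val // -ltnS.
pose x := g ord0.
have fs : f s * x = x * s' by have := ft (ord0, ord0); rewrite t10 !gE.
have fcorr i : f (corr A i s) * x = x * corr X i s'.
  by rewrite /corr; case: (val i) => //=; rewrite (hom1 fM) mulg1 mul1g.
pose f2 y := x^-1 * f y * x.
have f2M : hom f2 by move=> y z; rewrite /f2 fM !mulgA mulgK.
exists f2; split=> //.
- by rewrite /f2 -mulgA (fb ord0) mulKg /b1 expn0 expg1.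
- by rewrite /f2 -mulgA fs mulKg.
- move=> [i j]; apply: (@mulIg _ (corr X i s')).
  have := ft (i, lift ord0 j); rewrite t1S !gE -/x => E.
  have -> : corr X i s' = f2 (corr A i s) by rewrite /f2 -mulgA fcorr mulKg.
  rewrite -f2M /u /= mulgVK /f2 -[LHS]mulgA E mulKg.
  by rewrite -[x^-1 * _ * _]mulgA fcorr mulKg.
move=> f1 f1M f1b f1s f1u y.
have [|z [zg zf]] := funi f1 (fun=> 1) f1M.
  split=> [v|[i j]]; rewrite mulg1 mul1g.
    have := bq v; rewrite -ltnS ltn_ord inord_val => -> //.
    by rewrite (homX f1M) f1b.
  have f1c : f1 (corr A i s) = corr X i s'.
    by rewrite /corr; case: (val i) => //=; rewrite (hom1 f1M).
  case: (unliftP ord0 j) => [j' ->|->]; last first.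
    rewrite t10 /corr; case: i {f1c} => [[|i] lti] /=.
      by rewrite -f1s; congr (f1 (t (_, _))); exact: val_inj.
    have -> : Ordinal lti = inord i.+1 by apply: val_inj; rewrite /= inordK.
    by rewrite ttree // (hom1 f1M).
  by rewrite t1S -(f1u (i, j')) -f1c -f1M /u /= mulgVK.
have zx : z = x^-1 by apply: (@mulIg _ x); rewrite -zg mulVg.
by rewrite zf zx /f2 invgK.
Qed.

End Presentation.

(** * The presentation of a subgroup of finite index *)

Section SubgroupPresentation.
Local Open Scope group_scope.
Variables (q d : nat).
Hypothesis q_gt0 : 0 < q.
Hypothesis d_gt0 : 0 < d.
Local Notation G := (G1 q d).
Local Notation a := (ga q d).
Variables (H : set G) (O : finType) (o : O) (r : O -> G -> O).
Hypothesis hH : subgrp H.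
Hypothesis rP : coset_action H o r.

(** The positive generator of the image of [H] under the exponent sum. *)
Definition is_period (H : set G) (p : nat) : Prop :=
  0 < p /\ forall n : nat, (forall h, H h -> (Posz n %| eps h)%Z) <-> n %| p.

Variable p : nat.
Hypothesis pP : is_period H p.

Local Notation V := (orbV r).
Local Notation Y := (orb_graph r).
Local Notation rt := (rt rP).
Let p_gt0 : 0 < p := pP.1.

(** A grading of the orbit graph forces its modulus to divide the exponent sums of the
    elements of [H]: they fix [o]. *)
Lemma graded_ract (n : nat) (F : O -> int) :
  (forall w, (F (r w a) = F w %[mod n])%Z) ->
  (forall w j, (F (r w (gt q j)) = F w + 1 %[mod n])%Z) ->
  forall g w, (F (r w g) = F w + eps g %[mod n])%Z.
Proof.
move=> Fa Ft; elim/G1_ind=> [|g IH|g IH|j g IH|j g IH] w.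
- by rewrite (act_one rP) eps1 GRing.addr0.
- by rewrite (act_mul rP) IH epsM eps_ga GRing.add0r -modzDml Fa modzDml.
- rewrite (act_mul rP) IH epsM epsV eps_ga GRing.oppr0 GRing.add0r -modzDml.
  by rewrite -(Fa (r w a^-1)) -(act_mul rP) mulVg (act_one rP) modzDml.
- by rewrite (act_mul rP) IH epsM eps_gt GRing.addrA -modzDml Ft modzDml.
- rewrite (act_mul rP) IH epsM epsV eps_gt GRing.addrA.
  have := Ft (r w (gt q j)^-1) j; rewrite -(act_mul rP) mulVg (act_one rP) => E.
  apply/eqP; rewrite eqz_mod_dvd; move/eqP: E; rewrite eqz_mod_dvd -GRing.rpredN => E.
  by rewrite (_ : (_ - _)%R = (- (F w - (F (r w (gt q j)^-1) + 1)))%R) //; lia.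
Qed.

(** The generator [t_j] permutes the orbits of [a], although it does not normalize
    [<a>]: on the cosets [a] acts as a power of [a^q]. *)
Lemma rt_gt_inj j : injective (fun v : V => rt (r (val v) (gt q j))).
Proof.
have same_orbit w w' : rt w = rt w' -> exists n, w' = r w (a ^+ n).
  move=> E; have m0 : 0 < clen o r by apply: clen_gt0.
  have [n1 E1] : exists n1, val (rt w) = r w (a ^+ n1).
    exists ((clen o r).-1 * ix r w)%N; rewrite -{2}(rt_ix rP w) -(act_mul rP) -expgnDr.
    apply/esym/eqP; rewrite (ract_a_fix rP) -mulSn prednK //; exact: dvdn_mulr.
  by exists (n1 + ix r w')%N; rewrite expgnDr (act_mul rP) -E1 E rt_ix.
move=> v v' /same_orbit[n E]; have [[|k] // _ Ek] := ract_a_pow rP j.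
have : r (val v') (gt q j) = r (r (val v) (a ^+ (n * q ^ k)%N)) (gt q j).
  rewrite E -(Ek _ n) -!(act_mul rP); congr (r _ _).
  by rewrite ga_gt_pow expnSr mulnA.
move=> /(ract_inj rP) E'; rewrite -(rt_val rP v) -(rt_val rP v') E'.
by rewrite rt_ract.
Qed.

(** The degree of an orbit is the exponent sum of any element leading to it.  Each
    [t_j] permutes the orbits and raises the degree by one, so all degrees contain
    equally many orbits and [d] times as many edges. *)
Lemma orb_graph_good : exists c gr,
  [/\ @good p c (orb_graph rP) gr & (c * p = #|V| * d.-1)%N].
Proof.
have /choice[tr trE] := act_trans rP.
pose ab (x : int) : nat := `|modz x p|%N.
have abE x : Posz (ab x) = modz x p.
  by rewrite /ab gez0_abs // modz_ge0 //; move: p_gt0; lia.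
have ab_mod x y : ab x = ab y %[mod p] <-> (x = y %[mod p])%Z.
  have E z : Posz (ab z %% p) = modz z p by rewrite -modz_nat abE modz_mod.
  by split=> [/(congr1 Posz)|Exy]; rewrite ?E // -[LHS]/`|Posz (ab x %% p)|%N E Exy -E.
pose gr (v : V) := ab (eps (tr (val v))).
have trM w g : (eps (tr (r w g)) = eps (tr w) + eps g %[mod p])%Z.
  apply/eqP; rewrite eqz_mod_dvd -GRing.rpredN GRing.opprB -epsM -epsV -epsM.
  have [_ /(_ p)[_ /(_ (dvdnn p)) per]] := pP; apply: per.
  by apply/(act_stab rP); rewrite !(act_mul rP) trE -{1}(trE (r w g)) (ractK rP).
have gr_rt w : gr (rt w) = ab (eps (tr w)) %[mod p].
  by apply/ab_mod; rewrite -{2}(rt_ix rP w) trM epsX eps_ga GRing.mul0rn GRing.addr0.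
have gr_edge (v : V) j : gr (rt (r (val v) (gt q j))) = (gr v).+1 %[mod p].
  rewrite gr_rt; apply/eqP; rewrite -eqz_nat -!modz_nat abE modz_mod.
  rewrite trM eps_gt -[Posz (gr v).+1]/(Posz (1 + ab _)%N) PoszD abE GRing.addrC.
  by rewrite modzDmr.
have d1 : 'I_d by case: (d) d_gt0 => // d' _; exact: ord0.
have tgt_surj j v : exists v' : V, rt (r (val v') (gt q j)) = v.
  have [g _ gK] := injF_bij (@rt_gt_inj j); exists (g v); exact: gK.
pose N (i : nat) := #|[pred v : V | gr v %% p == i]|.
have card_src (i : nat) : #|[pred e : V * 'I_d | gr e.1 %% p == i]| = (N i * d)%N.
  rewrite -[d in RHS]card_ord -cardX; apply: eq_card => -[v j].
  by rewrite !inE andbT.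
have card_tgt (i : nat) :
    #|[pred e : V * 'I_d | gr (rt (r (val e.1) (gt q e.2))) %% p == i]| = (N i * d)%N.
  pose phi (e : V * 'I_d) := (rt (r (val e.1) (gt q e.2)), e.2).
  have phi_inj : injective phi.
    move=> [v j] [v' j'] E; have Ej : j = j' := congr1 snd E.
    by have := congr1 fst E; rewrite -Ej => Ev; rewrite (@rt_gt_inj j v v' Ev).
  have [phi' phiK phiK'] := injF_bij phi_inj.
  rewrite -card_src; pose P := [pred e : V * 'I_d | gr e.1 %% p == i].
  transitivity #|preim phi P|; first exact: eq_card.
  rewrite card_preim //; apply: eq_card => e; rewrite !inE; apply/andb_idl => _.
  by apply/codomP; exists (phi' e).
have NS i : i < p -> N i = N (i.+1 %% p).
  move=> ip; apply/eqP; rewrite -(eqn_pmul2r d_gt0) -card_src -card_tgt; apply/eqP.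
  apply: eq_card => -[v j]; rewrite !inE /= gr_edge -addn1 -modnDml addn1.
  have : gr v %% p < p by rewrite ltn_mod.
  move: (gr v %% p) => x xp; apply/eqP/eqP => [->//|/eqP].
  by rewrite -(addn1 x) -(addn1 i) eqn_modDr !modn_small // => /eqP.
have N0 i : i < p -> N i = N 0.
  by elim: i => // i IH ip; rewrite -(IH (ltnW ip)) (NS i) ?(ltnW ip) // modn_small.
have cardV : #|V| = (N 0 * p)%N.
  rewrite -sum1_card (partition_big (fun v : V => Ordinal (ltn_pmod (gr v) p_gt0)) xpredT) //=.
  rewrite (eq_bigr (fun=> N 0)) => [|i _]; first by rewrite sum_nat_const card_ord mulnC.
  by rewrite -(N0 i) // sum1_card; apply: eq_card => v; rewrite !inE.
exists (N 0 * d.-1)%N, gr; split; last by rewrite cardV mulnAC.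
split.
- move=> [v j] /=; exact: gr_edge.
- move=> n gr' n0 G'; have [_ per] := pP; apply/per => h Hh.
  have := @graded_ract n (fun w => Posz (gr' (rt w))) _ _ h o.
  have -> : r o h = o by apply/(act_stab rP).
  move=> E; suff : (0 + Posz (gr' (rt o)) == eps h + Posz (gr' (rt o)) %[mod n])%Z.
    by rewrite eqz_modDr eq_sym eqz_mod_dvd GRing.subr0.
  rewrite GRing.add0r GRing.addrC; apply/eqP; apply: E => [w|w j].
    by rewrite -[a]expg1 rt_ract.
  rewrite (ract_gt_rt rP); have := G' (rt w, j); rewrite /= !modz_nat => /(congr1 Posz).
  by rewrite -addn1.
- move=> f fE v w; have F g u : f (rt (r u g)) = f (rt u).
    elim/G1_ind: g u => [|g IH|g IH|j g IH|j g IH] u; first by rewrite (act_one rP).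
    + by rewrite (act_mul rP) IH -[a]expg1 rt_ract.
    + by rewrite (act_mul rP) IH -{2}(ractK rP a^-1 u) invgK -[a in RHS]expg1 rt_ract.
    + by rewrite (act_mul rP) IH (ract_gt_rt rP) -(fE (rt u, j)).
    + rewrite (act_mul rP) IH -{2}(ractK rP (gt q j)^-1 u) invgK.
      by rewrite [in RHS](ract_gt_rt rP) -(fE (rt _, j)).
  rewrite -(rt_val rP v) -(rt_val rP w).
  by rewrite -(trE (val v)) -(trE (val w)) !F.
- by move=> v; exists (v, d1).
- by move=> v; have [v' E] := tgt_surj d1 v; exists (v', d1).
- move=> i; rewrite card_src; case: (ltnP i p) => ip; last first.
    rewrite mul0n addn0 (_ : N i = 0) ?mul0n; last first.
      by apply: eq_card0 => v; rewrite !inE ltn_eqF // (leq_trans _ ip) // ltn_mod.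
    apply/esym/eq_card0 => v; rewrite !inE ltn_eqF // (leq_trans _ ip) // ltn_mod //.
  rewrite mul1n -[#|_|]/(N i) (N0 i ip) -{1}(prednK d_gt0) mulnS //.
Qed.

Lemma subgroup_presentation : exists c, [/\ (c * p = #|V| * d.-1)%N &
  @presented_by (q ^ p)%N ('I_p.-1.+1 * 'I_c)%type (fun ij => (q ^ ij.1)%N) (sgT hH)].
Proof.
have [c [gr [gd E]]] := orb_graph_good; exists c; split=> //.
have [Z [gr' [gd' piZ ufZ]]] := fold_all gd (subgroup_pi1 hH rP).
have [v0 _|V0] := pickP (gV Z).
  have := cycle_presentation (unfoldable_cycle p_gt0 gd' ufZ v0 piZ).
  by rewrite {1}(prednK p_gt0).
have : p.+1 %| p.
  apply: (good_max gd' (gr' := fun=> 0)) => // e.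
  by have := V0 (gsrc e); rewrite inE.
by move/(dvdn_leq p_gt0); rewrite ltnn.
Qed.
End SubgroupPresentation.

(** * Invariants of the isomorphism type *)

Section Isomorphisms.
Local Open Scope group_scope.

Definition isog (A B : groupType) : Prop :=
  exists (f : A -> B) (g : B -> A), [/\ hom f, hom g, cancel f g & cancel g f].

Lemma presented_isog (Q : nat) (J J' : finType) (ex : J -> nat) (ex' : J' -> nat)
    (A B : groupType) (si : J -> J') (si' : J' -> J) :
  cancel si si' -> cancel si' si -> (forall j, ex' (si j) = ex j) ->
  presented_by Q ex A -> presented_by Q ex' B -> isog A B.
Proof.
move=> siK siK' exE [b [s [u [[bs bu] U]]]] [b' [s' [u' [[bs' bu'] U']]]].
have [|f [fM fb fs fu _]] := U B b' s' (u' \o si).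
  by split=> // j /=; rewrite -exE.
have [|g [gM gb gs gu _]] := U' A b s (u \o si').
  by split=> // j /=; have := bu (si' j); rewrite -exE siK'.
have [|f0 [_ _ _ _ f0u]] := U A b s u; first by split.
have [|g0 [_ _ _ _ g0u]] := U' B b' s' u'; first by split.
exists f, g; split=> // x.
  transitivity (f0 x); last by apply/esym; apply: (f0u id).
  apply: (f0u (g \o f)); rewrite /= ?fb ?gb ?fs ?gs //; first exact: hom_comp.
  by move=> j; rewrite /= fu /= gu /= siK.
transitivity (g0 x); last by apply/esym; apply: (g0u id).
apply: (g0u (f \o g)); rewrite /= ?gb ?fb ?gs ?fs //; first exact: hom_comp.
by move=> j; rewrite /= gu /= fu /= siK'.
Qed.

Lemma mulZ2C (x y : 'I_2) : x * y = y * x.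
Proof. by apply: val_inj; rewrite /= addnC. Qed.

Section CountHoms.
Variable (Q : nat).

Definition Z2sols (J : finType) (ex : J -> nat) : {set 'I_2 * 'I_2 * {ffun J -> 'I_2}} :=
  [set x : 'I_2 * 'I_2 * {ffun J -> 'I_2} |
    `[< @pres_assign Q J ex 'I_2 x.1.1 x.1.2 x.2 >]]%SET.

(** Solutions of the relations in the group of order two are homomorphisms to it, and
    an isomorphism transports these. *)
Lemma isog_Z2sols (J J' : finType) (ex : J -> nat) (ex' : J' -> nat) (A B : groupType) :
  presented_by Q ex A -> presented_by Q ex' B -> isog A B ->
  #|Z2sols ex| <= #|Z2sols ex'|.
Proof.
move=> [b [s [u [_ U]]]] [b' [s' [u' [[bs' bu'] U']]]] [f [g [fM gM fK gK]]].
pose T : finType := {x | x \in Z2sols ex}.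
have /choice[h hE] (x : T) : exists h : A -> 'I_2,
    [/\ hom h, h b = (val x).1.1, h s = (val x).1.2 & forall j, h (u j) = (val x).2 j].
  have := valP x; rewrite inE => /asboolP Hx.
  by have [h [hM hb hs hu _]] := U _ _ _ _ Hx; exists h.
pose F (x : T) : 'I_2 * 'I_2 * {ffun J' -> 'I_2} :=
  (h x (g b'), h x (g s'), [ffun j => h x (g (u' j))]).
have F_inj : injective F.
  move=> x y [Eb Es /ffunP Eu].
  have ghE z : hom (h z \o g) by have [hM _ _ _] := hE z; apply: hom_comp.
  have E : forall a, h x a = h y a.
    have [|f1 [_ _ _ _ f1u]] := U' _ (h x (g b')) (h x (g s')) (fun j => h x (g (u' j))).
      have xM := ghE x; split=> [|j]; rewrite -[h x (g b')]/((h x \o g) b').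
        by rewrite -[h x (g s')]/((h x \o g) s') -(homX xM) -!xM bs'.
      by rewrite -[h x (g (u' j))]/((h x \o g) (u' j)) -(homX xM) -!xM bu'.
    move=> y'; rewrite -[y']fK.
    rewrite -[LHS]/((h x \o g) (f y')) -[RHS]/((h y \o g) (f y')).
    rewrite (f1u _ (ghE x)) // (f1u _ (ghE y)) //= => j.
    by have := Eu j; rewrite !ffunE.
  have [_ hb hs hu] := hE x; have [_ hb' hs' hu'] := hE y.
  apply: val_inj; rewrite [LHS]surjective_pairing [RHS]surjective_pairing.
  rewrite [(val x).1]surjective_pairing [(val y).1]surjective_pairing.
  rewrite -hb -hb' -hs -hs' !E; congr pair; apply/ffunP => j.
  by rewrite -hu -hu' E.
have <- : #|T| = #|Z2sols ex| by rewrite card_sig; apply: eq_card.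
rewrite -(card_codom F_inj); apply/subset_leq_card/fintype.subsetP => _ /codomP[x ->].
rewrite inE; apply/asboolP; have [hM _ _ _] := hE x.
have xM : hom (h x \o g) by apply: hom_comp.
split=> [|j] /=; rewrite ?ffunE -[h x (g b')]/((h x \o g) b').
  by rewrite -[h x (g s')]/((h x \o g) s') -(homX xM) -!xM bs'.
by rewrite -[h x (g (u' j))]/((h x \o g) (u' j)) -(homX xM) -!xM bu'.
Qed.

(** In the group of order two the relations reduce to [b = b^Q]. *)
Lemma card_Z2sols (J : finType) (ex : J -> nat) : exists2 c, 0 < c &
  forall (J' : finType) (ex' : J' -> nat), #|Z2sols ex'| = (c * 2 ^ #|J'|)%N.
Proof.
pose B := [set b : 'I_2 | b == b ^+ Q]%SET.
exists (#|B| * 2)%N => [|J' ex'].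
  rewrite muln_gt0 andbT; apply/fintype.card_gt0P; exists 1.
  by rewrite inE expg1n.
transitivity #|finset.setX (finset.setX B [set: 'I_2]%SET) [set: {ffun J' -> 'I_2}]%SET|.
  apply: eq_card => -[[b s] u]; rewrite !inE !andbT /=.
  apply/asboolP/eqP => [[E _]|E]; first by apply: (@mulgI _ s); rewrite -E mulZ2C.
  by split=> [|j]; rewrite mulZ2C // -E.
by rewrite !cardsX !cardsT card_ffun card_ord.
Qed.

Lemma isog_card (J J' : finType) (ex : J -> nat) (ex' : J' -> nat) (A B : groupType) :
  presented_by Q ex A -> presented_by Q ex' B -> isog A B -> #|J| = #|J'|.
Proof.
move=> pA pB AB; have BA : isog B A.
  by have [f [g [fM gM fK gK]]] := AB; exists g, f.
have [c c0 E] := card_Z2sols ex.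
have := isog_Z2sols pA pB AB; have := isog_Z2sols pB pA BA.
rewrite !E !leq_pmul2l // !leq_exp2l // => l1 l2.
by apply/eqP; rewrite eqn_leq l1 l2.
Qed.

End CountHoms.

Lemma isog_subgroups (G1 G2 : groupType) (H1 : set G1) (H2 : set G2)
    (h1 : subgrp H1) (h2 : subgrp H2) :
  isog (sgT h1) (sgT h2) <-> subgroups_isomorphic H1 H2.
Proof.
split=> [[f [g [fM gM fK gK]]]|[f [fM [fH finj fsurj]]]].
  exists (fun x => val (f (toA h1 x))); split.
    by move=> x y /set_mem Hx /set_mem Hy; rewrite toAM // fM.
  split; first by move=> x _; exact: sgP.
    move=> x y /set_mem Hx /set_mem Hy /val_inj /(can_inj fK) /(congr1 val).
    by rewrite !val_toA.
  move=> y Hy; exists (val (g (toA h2 y))); first exact: sgP.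
  by rewrite toA_val gK val_toA.
have fHs (x : sgT h1) : H2 (f (val x)) by apply: fH; exact: sgP.
have fM' x y : H1 x -> H1 y -> f (x * y) = f x * f y.
  by move=> Hx Hy; apply: fM; apply/mem_set.
have finj' x y : H1 x -> H1 y -> f x = f y -> x = y.
  by move=> Hx Hy; apply: finj; apply/mem_set.
have /choice[g gE] (y : sgT h2) : exists x : sgT h1, f (val x) = val y.
  by have [x Hx E] := fsurj _ (sgP y); exists (toA h1 x); rewrite val_toA.
pose F (x : sgT h1) : sgT h2 := sgIn h2 (fHs x).
have FM : hom F by move=> x y; apply: val_inj; rewrite /= fM' //; exact: sgP.
have gK : cancel g F by move=> y; apply: val_inj; rewrite /= gE.
have FK : cancel F g.
  by move=> x; apply: val_inj; apply: finj'; rewrite ?gE //; exact: sgP.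
exists F, g; split=> // x y; apply: (can_inj FK).
by rewrite FM !gK.
Qed.

End Isomorphisms.

Section Invariants.
Local Open Scope group_scope.
Variables (q d : nat).
Hypothesis q_gt0 : 0 < q.
Local Notation G := (G1 q d).
Local Notation a := (ga q d).
Variables (H : set G) (O : finType) (o : O) (r : O -> G -> O).
Hypothesis hH : subgrp H.
Hypothesis rP : coset_action H o r.

Lemma zga_commX (n : int) (h : G) (n' : int) k : zpow a n * h = h * zpow a n' ->
  zpow a (n * Posz k)%R * h = h * zpow a (n' * Posz k)%R.
Proof.
move=> E; rewrite !zpowM; elim: k => [|k IH]; first by rewrite !expg0 mul1g mulg1.
by rewrite [in LHS]expgSr -mulgA E mulgA IH -mulgA -expgSr.
Qed.

(** The subgroups [<a>] and [g <a> g^-1] are commensurable. *)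
Lemma commensurable (g : G) : exists M M' : nat,
  [/\ 0 < M, 0 < M' & zpow a (Posz M) * g = g * zpow a (Posz M')].
Proof.
elim/G1_ind: g => [|g [M [M' [M0 M'0 E]]]|g [M [M' [M0 M'0 E]]]|j g IH|j g IH];
  try have [M [M' [M0 M'0 E]]] := IH.
- by exists 1%N, 1%N; rewrite mulg1 mul1g.
- exists M, M'; split=> //; rewrite -mulgA -E !mulgA; congr (_ * _).
  by rewrite -[a]/(zpow a 1) -!zpowD GRing.addrC.
- exists M, M'; split=> //; rewrite -mulgA -E !mulgA; congr (_ * _).
  by rewrite -[a^-1]/(zpow a (-1)) -!zpowD GRing.addrC.
- exists M, (M' * q)%N; split; rewrite ?muln_gt0 ?M'0 //.
  by rewrite mulgA zga_gt -mulgA (zga_commX q E) PoszM mulgA.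
- exists (M * q)%N, M'; split; rewrite ?muln_gt0 ?M0 //.
  by rewrite PoszM mulgA zga_gtV -mulgA E mulgA.
Qed.

Variable p : nat.
Hypothesis pP : is_period H p.

(** The least positive exponent sum of an element of [H] divides all the others. *)
Lemma period_witness : exists2 h, H h & eps h = Posz p.
Proof.
have [p0 per] := pP.
have epsD h : H h -> (Posz p %| eps h)%Z by move=> Hh; apply: (proj2 (per p) (dvdnn p)).
have [h0 Hh0 e0] : exists2 h, H h & eps h != 0%R.
  apply: contrapT => E; suff : p.+1 %| p by move/(dvdn_leq p0); rewrite ltnn.
  apply/per => h Hh; have [->|ne] := eqVneq (eps h) 0%R; first exact: dvdz0.
  by case: E; exists h.
pose P n := `[< 0 < n /\ exists2 h, H h & eps h = Posz n >].
have exP : exists n, P n.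
  exists `|eps h0|%N; apply/asboolP; split; first by rewrite absz_gt0.
  case Es: (eps h0) => [k|k]; first by exists h0.
  by exists h0^-1; [exact: subgrpV | rewrite epsV Es].
case: (ex_minnP exP) => n /asboolP[n0 [h Hh En]] nmin.
have nD g : H g -> (Posz n %| eps g)%Z.
  move=> Hg; rewrite dvdzE; apply/negPn/negP => ndvd.
  pose k := divz (eps g) n; pose g' := g * zpow h (- k)%R.
  have Hg' : H g'.
    apply: subgrpM => //; rewrite zpowN; apply: subgrpV => //.
    by case: (k) => i; [exact: subgrpX | apply: subgrpV => //; exact: subgrpX].
  have epsZ i : eps (zpow h i) = (i * Posz n)%R.
    by case: i => i /=; rewrite ?epsV epsX En; lia.
  have Eg' : eps g' = modz (eps g) n.
    by rewrite epsM epsZ {1}(divz_eq (eps g) n) -/k; lia.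
  have lt_n : (modz (eps g) n < Posz n)%R by rewrite ltz_pmod //; lia.
  have ge_0 : (0 <= modz (eps g) n)%R by rewrite modz_ge0 //; lia.
  have ne_0 : modz (eps g) n != 0%R.
    by apply: contra ndvd => /eqP/dvdz_mod0P; rewrite dvdzE.
  have := nmin `|modz (eps g) n|%N; rewrite (_ : P _); first by move=> /(_ isT); lia.
  by apply/asboolP; split; [lia | exists g' => //; rewrite Eg' gez0_abs].
have np : n %| p by apply/per.
have pn : p %| n by have := epsD _ Hh; rewrite En dvdzE.
by exists h => //; rewrite En; congr Posz; apply/eqP; rewrite eqn_dvd np pn.
Qed.

(** An element of [H] of exponent sum [p] conjugates some power of [a] to its
    [q^p]-th power, and the power of [a] can be chosen in [H]. *)
Lemma conj_power_exists : exists x h, [/\ H x, H h, x <> 1 & x ^ h = x ^+ (q ^ p)%N].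
Proof.
have [h Hh Eh] := period_witness; have [M [M' [M0 M'0 E]]] := commensurable h.
have [u [v [Euv Eratio]]] := conj_zga_ratio q_gt0 E.
have EM : (M' = M * q ^ p)%N.
  apply/eqP; rewrite -(eqn_pmul2r (_ : 0 < q ^ v)%N) ?expn_gt0 ?q_gt0 //.
  rewrite -mulnA -expnD (_ : (p + v = u)%N); last by move: Euv; rewrite Eh; lia.
  by have := Eratio; rewrite -!PoszM => -[->].
have m0 : 0 < clen o r := clen_gt0 o r.
exists (a ^+ (M * clen o r)%N), h; split=> //.
- by rewrite mulnC expgnA; apply: subgrpX => //; exact: (clen_in_H rP).
- move=> E1; have := @zga_inj q d q_gt0 (Posz (M * clen o r)%N) 0 E1 => -[].
  by move: M0 m0; case: (M) => // M1; case: (clen o r).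
have E2 : (a ^+ M) ^ h = (a ^+ M) ^+ (q ^ p)%N.
  by rewrite /conjg -[a ^+ M]/(zpow a M) E mulKg /= -expgnA EM.
by rewrite !expgnA conjXg E2; exact: expgnAC.
Qed.

(** Up to conjugation [x] is a power of [a] by [elliptic], so that [N = q ^ eps h] by
    the modular homomorphism, and [p] divides [eps h]. *)
Lemma conj_power_form (x h : G) N : H h -> x <> 1 -> 1 < N -> x ^ h = x ^+ N ->
  exists2 i, 0 < i & N = ((q ^ p) ^ i)%N.
Proof.
move=> Hh x1 N1 Exh; have [g [n Ex]] := elliptic q_gt0 N1 Exh.
have n0 : n != 0%R by apply/eqP => En; case: x1; rewrite Ex En conj1g.
pose k := g * h * g^-1.
have Ek : zpow a n * k = k * zpow a (n * Posz N)%R.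
  have : zpow a n ^ k = zpow a (n * Posz N)%R.
    by rewrite zpowM /k !conjgM -Ex Exh conjXg Ex conjgK.
  by move=> <-; rewrite -conjgC.
have [u [v [Euv Er]]] := conj_zga_ratio q_gt0 Ek.
have {}Er : (N * q ^ v = q ^ u)%N.
  have : (n * Posz (N * q ^ v)%N = n * Posz (q ^ u)%N)%R by rewrite -Er PoszM GRing.mulrA.
  by move/(GRing.mulfI n0) => -[].
have Eh : eps h = (Posz u - Posz v)%R by rewrite -Euv /k !epsM epsV; lia.
have lt_vu : v < u.
  rewrite ltnNge; apply/negP => le_uv; have := leq_pexp2l q_gt0 le_uv.
  rewrite -Er; have : 0 < q ^ v by rewrite expn_gt0 q_gt0.
  by move: (q ^ v)%N N1 => c; nia.
have EN : N = (q ^ (u - v))%N.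
  apply/eqP; rewrite -(eqn_pmul2r (_ : 0 < q ^ v)%N) ?expn_gt0 ?q_gt0 //.
  by rewrite Er -expnD subnK // ltnW.
have [p0 per] := pP; have /dvdnP[i Ei] : p %| u - v.
  have := proj2 (per p) (dvdnn p) _ Hh; rewrite Eh dvdzE.
  by rewrite -(_ : (u - v)%N = `|(Posz u - Posz v)%R|%N) //; lia.
exists i; last by rewrite EN Ei mulnC expnM.
by case: i Ei => //; lia.
Qed.

(** The first power of [a] in [H] has an exponent prime to [q].  Its [y]-th power, for
    [0 < y < q], has an exponent not divisible by [q], and by [centralizer_zga] such a
    power of [a] has the same centralizer as [a]. *)
Lemma small_centralizer (j : 'I_d) : 1 < q -> exists x h N,
  [/\ H x, H h, x <> 1, 1 < N & x ^ h = x ^+ N /\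
   forall y g, 0 < y < q -> commute (x ^+ y) g -> commute x g].
Proof.
move=> q1; have [l l0 Hl] := power_in_H rP (gt q j).
have m0 : 0 < clen o r := clen_gt0 o r.
exists (a ^+ clen o r), (gt q j ^+ l), (q ^ l)%N; split.
- exact: (clen_in_H rP).
- by [].
- move=> E1; have := @zga_inj q d q_gt0 (Posz (clen o r)) 0 E1 => -[].
  by case: (clen o r) m0.
- by rewrite -{1}(expn0 q) ltn_exp2l.
split; first by rewrite /conjg (ga_gtX q j l) mulKg expgnA.
move=> y g /andP[y0 yq]; rewrite -expgnA => C.
apply: (@centralizer_zga q d q_gt0 g (Posz (clen o r * y)%N) _ C (Posz (clen o r))).
rewrite dvdzE /= Gauss_dvdr ?(coprime_clen q_gt0 rP j) //.
by apply/negP => /(dvdn_leq y0); rewrite leqNgt yq.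
Qed.

(** Such an element is conjugate to [a^N0] with [q] not dividing [N0], the factors [q]
    being removed by conjugation with [t_i].  Its power of exponent
    [q / gcd (q, N0)] is a power of [a^q], which commutes with [t_i^-1 t_j], whereas
    [a^N0] commutes with no positive power of [t_i^-1 t_j] by [commutator_moves]. *)
Lemma large_centralizer (i j : 'I_d) (x h : G) N : 1 < q -> i != j ->
  x <> 1 -> 1 < N -> x ^ h = x ^+ N ->
  exists y g, [/\ 0 < y <= q, H g, commute (x ^+ y) g & ~ commute x g].
Proof.
move=> q1 ij x1 N1 Exh; have [g0 [n Ex]] := elliptic q_gt0 N1 Exh.
have n0 : n != 0%R by apply/eqP => En; case: x1; rewrite Ex En conj1g.
have [v [N0 [En qN0]]] : exists v N0, n = (N0 * Posz (q ^ v)%N)%R /\ ~~ (Posz q %| N0)%Z.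
  have [m] := ubnP `|n|%N; elim: m n n0 {Ex} => // m IH n n0 lt_nm.
  case: (boolP (Posz q %| n)%Z) => [/dvdzP[n1 En1]|qn]; last first.
    by exists 0, n; rewrite expn0 GRing.mulr1.
  have n10 : n1 != 0%R by apply: contraNneq n0 => E; rewrite En1 E GRing.mul0r.
  have [|v [N0 [E qN0]]] := IH n1 n10.
    have : `|n|%N = (`|n1| * q)%N by rewrite En1 abszM.
    have : 0 < `|n1|%N by rewrite absz_gt0.
    move: lt_nm; move: `|n|%N `|n1|%N => c1 c2 lt_c c2p Ec; rewrite Ec in lt_c; nia.
  by exists v.+1, N0; rewrite En1 E expnSr PoszM GRing.mulrA.
pose k := gt q i ^+ v * g0.
have Exk : x = zpow a N0 ^ k.
  rewrite Ex En /k conjgM; congr (_ ^ _); rewrite /conjg.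
  have : zpow a N0 * gt q i ^+ v = gt q i ^+ v * zpow a (N0 * Posz (q ^ v)%N)%R.
    elim: (v) => [|w IH]; first by rewrite !expg0 mul1g mulg1 expn0 GRing.mulr1.
    by rewrite expgSr mulgA IH -mulgA zga_gt mulgA expnSr PoszM GRing.mulrA.
  by move=> ->; rewrite mulKg.
pose z := (gt q i)^-1 * gt q j.
have [l l0 Hl] := power_in_H rP (z ^ k).
have y0 : 0 < q %/ gcdn q `|N0|.
  by rewrite divn_gt0 ?gcdn_gt0 ?q_gt0 // dvdn_leq ?dvdn_gcdl.
exists (q %/ gcdn q `|N0|)%N, ((z ^ k) ^+ l); split=> //.
- by rewrite y0 leq_div.
- have [c Ec] : exists c : int, (N0 * Posz (q %/ gcdn q `|N0|)%N = c * Posz q)%R.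
    apply/dvdzP; rewrite dvdzE abszM /=.
    rewrite -{1}(divnK (dvdn_gcdl q `|N0|)) mulnC dvdn_mul //; exact: dvdn_gcdr.
  have Cz : commute (zpow a (c * Posz q)%R) z.
    by rewrite /commute /z mulgA zga_gtV -mulgA zga_gt mulgA.
  rewrite Exk -!conjXg -zpowM Ec /commute -!conjMg; congr (_ ^ _).
  by elim: (l) => [|w IH]; rewrite ?expg0 ?mulg1 ?mul1g // expgSr mulgA IH -mulgA Cz mulgA.
rewrite Exk -conjXg /commute -!conjMg => /conjg_inj.
exact: commutator_moves.
Qed.

End Invariants.

(** * The classification *)

Section Transfer.
Local Open Scope group_scope.
Variables (G1' G2' : groupType) (H1 : set G1') (H2 : set G2').
Variables (h1 : subgrp H1) (h2 : subgrp H2).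

Lemma transfer_conj (f : sgT h1 -> sgT h2) (x h : G1') N :
  hom f -> injective f -> H1 x -> H1 h -> x <> 1 -> x ^ h = x ^+ N ->
  let x' := val (f (toA h1 x)) in let h' := val (f (toA h1 h)) in
  x' <> 1 /\ x' ^ h' = x' ^+ N.
Proof.
move=> fM f_inj Hx Hh x1 E; split.
  move=> Ex; case: x1; rewrite -(val_toA h1 Hx).
  have /f_inj -> // : f (toA h1 x) = f 1 by apply: val_inj; rewrite Ex (hom1 fM).
rewrite -val_sgX -(homX fM) /conjg -val_sgV -(homV fM) -!val_sgM -!fM.
congr (val (f _)); apply: val_inj.
by rewrite val_sgX !val_sgM val_sgV !val_toA.
Qed.

Lemma transfer_commute (f : sgT h1 -> sgT h2) (g : sgT h2 -> sgT h1) (x : G1') (z : G2') y :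
  hom f -> hom g -> cancel f g -> cancel g f -> H1 x -> H2 z ->
  commute (val (f (toA h1 x)) ^+ y) z <-> commute (x ^+ y) (val (g (toA h2 z))).
Proof.
move=> fM gM fK gK Hx Hz.
have Ez : z = val (f (g (toA h2 z))) by rewrite gK val_toA.
rewrite /commute {1 2}Ez -val_sgX -(homX fM) -!val_sgM -!fM.
have Ex : x ^+ y = val (toA h1 x ^+ y) by rewrite val_sgX val_toA.
rewrite Ex -!val_sgM; split=> [/val_inj/(can_inj fK) -> // | /val_inj -> //].
Qed.

End Transfer.

Section Comparison.
Variables (q1 d1 : nat) (H1 : set (G1 q1 d1)) (O1 : finType) (o1 : O1)
  (r1 : O1 -> G1 q1 d1 -> O1) (p1 : nat).
Variables (q2 d2 : nat) (H2 : set (G1 q2 d2)) (O2 : finType) (o2 : O2)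
  (r2 : O2 -> G1 q2 d2 -> O2) (p2 : nat).
Hypotheses (q1_gt0 : 0 < q1) (q2_gt0 : 0 < q2) (d1_gt0 : 0 < d1).
Hypotheses (h1 : subgrp H1) (h2 : subgrp H2).
Hypotheses (rP1 : coset_action H1 o1 r1) (rP2 : coset_action H2 o2 r2).
Hypotheses (pP1 : is_period H1 p1) (pP2 : is_period H2 p2).
Hypothesis iso12 : isog (sgT h1) (sgT h2).

(** As both groups have the role of the first, this makes the two moduli powers of each
    other. *)
Lemma modulus_power : 1 < q1 ^ p1 -> exists2 i, 0 < i & q1 ^ p1 = (q2 ^ p2) ^ i.
Proof.
move=> Q1; have [f [g [fM gM fK gK]]] := iso12.
have [x [h [Hx Hh x1 E]]] := conj_power_exists q1_gt0 h1 rP1 pP1.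
have [x1' E'] := transfer_conj fM (can_inj fK) Hx Hh x1 E.
by apply: (conj_power_form q2_gt0 pP2 _ x1' Q1 E'); exact: sgP.
Qed.

(** An element of [H1] whose centralizer grows only at the [q1]-th power is sent to
    one whose centralizer grows at the latest at the [q2]-th. *)
Lemma base_le : 1 < q1 -> 1 < q2 -> 1 < d2 -> q1 <= q2.
Proof.
move=> q1_gt1 q2_gt1 d2_gt1; have [f [g [fM gM fK gK]]] := iso12.
have [x [h [N [Hx Hh x1 N1 [E C]]]]] := small_centralizer q1_gt0 rP1 (Ordinal d1_gt0) q1_gt1.
have [x1' E'] := transfer_conj fM (can_inj fK) Hx Hh x1 E.
pose i0 : 'I_d2 := Ordinal (ltnW d2_gt1); pose j0 : 'I_d2 := Ordinal d2_gt1.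
have [y [z [/andP[y0 yq] Hz Cy Cn]]] :=
  @large_centralizer q2 d2 q2_gt0 H2 O2 o2 r2 rP2 i0 j0 _ _ _ q2_gt1 isT x1' N1 E'.
apply: leq_trans yq; rewrite leqNgt; apply/negP => lt_y; case: Cn.
have Cy' := proj1 (transfer_commute y fM gM fK gK Hx Hz) Cy.
have := C y _ _ Cy'; rewrite y0 lt_y => /(_ isT) C1.
exact: (proj2 (transfer_commute 1 fM gM fK gK Hx Hz) C1).
Qed.

End Comparison.

Lemma isog_sym (A B : groupType) : isog A B -> isog B A.
Proof. by case=> f [g [fM gM fK gK]]; exists g, f. Qed.

Lemma standard_isog q1 q2 p1 p2 c1 c2 (A B : groupType) :
  q1 = q2 -> p1 = p2 -> c1 = c2 ->
  @presented_by (q1 ^ p1) ('I_p1.-1.+1 * 'I_c1)%type (fun ij => q1 ^ ij.1) A ->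
  @presented_by (q2 ^ p2) ('I_p2.-1.+1 * 'I_c2)%type (fun ij => q2 ^ ij.1) B ->
  isog A B.
Proof. by move=> -> -> ->; apply: (@presented_isog _ _ _ _ _ _ _ id id). Qed.

Section Criterion.
Variables (q1 d1 : nat) (H1 : set (G1 q1 d1)) (O1 : finType) (o1 : O1)
  (r1 : O1 -> G1 q1 d1 -> O1) (p1 : nat).
Variables (q2 d2 : nat) (H2 : set (G1 q2 d2)) (O2 : finType) (o2 : O2)
  (r2 : O2 -> G1 q2 d2 -> O2) (p2 : nat).
Hypotheses (q1_gt0 : 0 < q1) (q2_gt0 : 0 < q2) (d1_gt0 : 0 < d1) (d2_gt0 : 0 < d2).
Hypotheses (h1 : subgrp H1) (h2 : subgrp H2).
Hypotheses (rP1 : coset_action H1 o1 r1) (rP2 : coset_action H2 o2 r2).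
Hypotheses (pP1 : is_period H1 p1) (pP2 : is_period H2 p2).

Lemma equal_card_bij (J J' : finType) : #|J| = #|J'| ->
  exists (si : J -> J') (si' : J' -> J), cancel si si' /\ cancel si' si.
Proof.
move=> E; exists (fun j => enum_val (cast_ord E (enum_rank j))).
exists (fun j => enum_val (cast_ord (esym E) (enum_rank j))).
by split=> j; rewrite enum_valK ?cast_ordK ?cast_ordKV enum_rankK.
Qed.

(** The ranks [R1] and [R2] count the generators [u_ij].  When they vanish the base [q]
    leaves no trace beyond [q^p]; when they do not and [q = 1], the presentations do
    not depend on how [R1] is distributed over the [p1] vertices. *)
Theorem iso_criterion :
  let R1 := #|orbV r1| * d1.-1 in let R2 := #|orbV r2| * d2.-1 in
  subgroups_isomorphic H1 H2 <->
  [/\ R1 = R2, q1 ^ p1 = q2 ^ p2 & R1 = 0 \/ q1 = q2].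
Proof.
move=> R1 R2; rewrite -(isog_subgroups h1 h2).
have [c1 [E1 P1]] := subgroup_presentation q1_gt0 d1_gt0 h1 rP1 pP1.
have [c2 [E2 P2]] := subgroup_presentation q2_gt0 d2_gt0 h2 rP2 pP2.
have [[p1_gt0 _] [p2_gt0 _]] := (pP1, pP2).
have Q1_gt0 : 0 < q1 ^ p1 by rewrite expn_gt0 q1_gt0.
have Q2_gt0 : 0 < q2 ^ p2 by rewrite expn_gt0 q2_gt0.
rewrite -/R1 in E1; rewrite -/R2 in E2; split.
- move=> iso; have iso' := isog_sym iso.
  have EQ : q1 ^ p1 = q2 ^ p2.
    have D1 := modulus_power q1_gt0 q2_gt0 rP1 pP1 pP2 iso.
    have D2 := modulus_power q2_gt0 q1_gt0 rP2 pP2 pP1 iso'.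
    case: (ltnP 1 (q1 ^ p1)) => [Q1|Q1].
      have [[|i] // _ Ei] := D1 Q1.
      have Q2 : 1 < q2 ^ p2.
        by move: Q1; rewrite Ei; case: (q2 ^ p2) Q2_gt0 => [|[|]] //; rewrite exp1n.
      have [[|j] // _ Ej] := D2 Q2.
      apply/eqP; rewrite eqn_leq; apply/andP; split.
        by rewrite [in X in _ <= X]Ej -{1}(expn1 (q1 ^ p1)) leq_pexp2l.
      by rewrite [in X in _ <= X]Ei -{1}(expn1 (q2 ^ p2)) leq_pexp2l.
    case: (ltnP 1 (q2 ^ p2)) => [Q2|Q2]; last by lia.
    have [j j0 Ej] := D2 Q2; move: Q2; rewrite Ej (_ : q1 ^ p1 = 1) ?exp1n //; lia.
  rewrite EQ in P1; have := isog_card P1 P2 iso.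
  rewrite !card_prod !card_ord !prednK // mulnC E1 mulnC E2 => ER.
  split=> //; have [|R0] := posnP R1; [by left | right].
  have d1_gt1 : 1 < d1 by move: R0; rewrite /R1 muln_gt0 => /andP[_]; lia.
  have d2_gt1 : 1 < d2 by move: R0; rewrite ER /R2 muln_gt0 => /andP[_]; lia.
  case: (ltnP 1 q1) => [q1_gt1|q1_le1].
    have q2_gt1 : 1 < q2.
      have Q2 : 1 < q2 ^ p2 by rewrite -EQ -(exp1n p1) ltn_exp2r.
      rewrite ltnNge; apply/negP => q2_le1; move: Q2.
      by rewrite (_ : q2 = 1) ?exp1n //; lia.
    apply/eqP; rewrite eqn_leq; apply/andP; split.
      exact: (base_le q1_gt0 q2_gt0 d1_gt0 rP1 rP2 iso).
    exact: (base_le q2_gt0 q1_gt0 d2_gt0 rP2 rP1 iso').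
  have q11 : q1 = 1 by lia.
  have := ltn_expl p2 (_ : 1 < q2); rewrite -EQ q11 exp1n; lia.
case=> ER EQ Hq; rewrite EQ in P1.
have card_eq : #|{: 'I_p1.-1.+1 * 'I_c1}| = #|{: 'I_p2.-1.+1 * 'I_c2}|.
  by rewrite !card_prod !card_ord !prednK // mulnC E1 mulnC E2.
have [si [si' [siK siK']]] := equal_card_bij card_eq.
have [R0|Rpos] := posnP R1.
  have c10 : c1 = 0 by move: E1; rewrite R0 => /eqP; rewrite muln_eq0; lia.
  subst c1; apply: (presented_isog siK siK' _ P1 P2) => -[i j]; by case: j.
have {Hq} Eq : q1 = q2 by case: Hq => // R0; rewrite R0 in Rpos.
have [q1_gt1|q1_le1] := ltnP 1 q1.
  have Ep : p1 = p2 by apply/eqP; rewrite -(eqn_exp2l _ _ q1_gt1) EQ Eq.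
  have Ec : c1 = c2.
    by apply/eqP; rewrite -(eqn_pmul2r p1_gt0) E1 ER -E2 Ep.
  by apply: (standard_isog Eq Ep Ec _ P2); rewrite EQ.
have q11 : q1 = 1 by lia.
apply: (presented_isog siK siK' _ P1 P2) => j.
by rewrite -Eq q11 !exp1n.
Qed.
End Criterion.

(** * The number of vertices of the quotient graph *)

Section PermutationActions.
Local Open Scope group_scope.
Variables (q d : nat).
Local Notation G := (G1 q d).
Local Notation a := (ga q d).

Section Prho.
Variables (W : finType) (si : 'I_d -> {perm W}).

(** An action of [G] with [a] trivial is an action of the free group on the [t_j]. *)
Definition prho : G -> {perm W} :=
  @pres_lift _ _ {perm W} (fun x => if x is Some j then si j else 1).

Lemma prho_rel (u v : word (gen d)) : G1_rel q u v ->
  word_val (K := {perm W}) (fun x => if x is Some j then si j else 1) u =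
  word_val (K := {perm W}) (fun x => if x is Some j then si j else 1) v.
Proof.
case=> j; rewrite /= /letter_val /= mulg1 mul1g mulVg.
by elim: (q) => //= n <-; rewrite mul1g.
Qed.

Lemma prhoM : hom prho. Proof. exact: pres_lift_hom prho_rel. Qed.

Lemma prho_ga : prho a = 1.
Proof. by rewrite /prho (pres_lift_pword prho_rel) /= mulg1. Qed.

Lemma prho_gt j : prho (gt q j) = si j.
Proof. by rewrite /prho (pres_lift_pword prho_rel) /= mulg1. Qed.

Lemma prho_act g h w : prho (g * h) w = prho h (prho g w).
Proof. by rewrite prhoM permM. Qed.

End Prho.

Variables (L : seq (word (gen d))) (O : finType) (o : O) (r : O -> G -> O).
Local Notation H := (subgroup_of_words q L).
Hypothesis rP : coset_action H o r.
Hypothesis d_gt0 : 0 < d.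

Local Notation V := (orbV r).
Local Notation rt := (rt rP).

Lemma subgroup_of_words_subgrp : subgrp H.
Proof. exact: gen_subgroup_subgrp. Qed.

Lemma word_in_H w : w \in L -> H (pword (@G1_rel q d) w).
Proof. by move=> wL; apply: gen_subgroup_sub; rewrite /=; apply/mapP; exists w. Qed.

Lemma H_min (A : set G) : subgrp A -> (forall w, w \in L -> A (pword (@G1_rel q d) w)) ->
  forall g, H g -> A g.
Proof.
by move=> hA LA; apply: gen_subgroup_min => // _ /mapP[w wL ->]; exact: LA.
Qed.

(** All of [H] fixes the point, so [W] is an equivariant image of the set of cosets, on
    which elements of the same orbit of [a] have the same image. *)
Lemma card_le_orbits (W : finType) (si : 'I_d -> {perm W}) (w0 : W) :
  (forall w, w \in L -> prho si (pword (@G1_rel q d) w) w0 = w0) ->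
  (forall w, exists g, prho si g w0 = w) -> #|W| <= #|V|.
Proof.
move=> Lfix trans.
have Hfix g : H g -> prho si g w0 = w0.
  apply: (H_min (A := fun g => prho si g w0 = w0)) => //; split.
    by rewrite (hom1 (prhoM si)) perm1.
  move=> x y Ex Ey; rewrite prho_act Ex -{1}Ey -prho_act mulgV.
  by rewrite (hom1 (prhoM si)) perm1.
have /choice[tr trE] := act_trans rP.
pose F (w : O) := prho si (tr w) w0.
have FE g : F (r o g) = prho si g w0.
  have Hg : H (tr (r o g) * g^-1) by apply/(act_stab rP); rewrite (act_mul rP) trE (ractK rP).
  by rewrite /F -[tr _](mulgVK g) prho_act (Hfix _ Hg).
have FX w n : F (r w (a ^+ n)) = F w.
  rewrite -(trE w) -(act_mul rP) !FE prho_act (homX (prhoM si)) prho_ga.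
  by rewrite expg1n perm1.
have sub : {subset W <= codom (fun v : V => F (val v))}.
  move=> w _; have [g <-] := trans w; rewrite -FE -(rt_ix rP (r o g)) FX.
  exact: codom_f.
apply: leq_trans (leq_image_card (fun v : V => F (val v)) V).
by apply/subset_leq_card/fintype.subsetP => w _; exact: sub.
Qed.

Definition orb_perm j : {perm V} := perm (@rt_gt_inj q d _ O o r rP j).

Lemma orb_permE g w : prho orb_perm g (rt w) = rt (r w g).
Proof.
have act1 : (forall w, prho orb_perm 1 (rt w) = rt w).
  by move=> u; rewrite (hom1 (prhoM _)) perm1.
have actV h : (forall w, prho orb_perm h (rt w) = rt (r w h)) ->
              forall w, prho orb_perm h^-1 (rt w) = rt (r w h^-1).
  move=> E u; have := E (r u h^-1); rewrite -(act_mul rP) mulVg (act_one rP) => <-.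
  by rewrite -prho_act mulgV act1.
have Ea u : prho orb_perm a (rt u) = rt (r u a).
  by rewrite prho_ga perm1 -[a]expg1 rt_ract.
have Et j u : prho orb_perm (gt q j) (rt u) = rt (r u (gt q j)).
  by rewrite prho_gt permE [RHS](ract_gt_rt rP).
elim/G1_ind: g w => [|g IH|g IH|j g IH|j g IH] w; first by rewrite act1 (act_one rP).
- by rewrite prho_act Ea IH (act_mul rP).
- by rewrite prho_act (actV _ Ea) IH (act_mul rP).
- by rewrite prho_act Et IH (act_mul rP).
- by rewrite prho_act (actV _ (Et j)) IH (act_mul rP).
Qed.

Lemma orb_fix g : H g -> prho orb_perm g (rt o) = rt o.
Proof. by move=> /(act_stab rP) E; rewrite orb_permE E. Qed.

Lemma orb_trans v v' : exists g, prho orb_perm g v = v'.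
Proof.
have [g E] := act_trans rP (val v); have [g' E'] := act_trans rP (val v').
exists (g^-1 * g'); rewrite -(rt_val rP v) -(rt_val rP v') orb_permE.
by rewrite (act_mul rP) -{1}E (ractK rP) E'.
Qed.

(** * A bound on the number of vertices *)

Definition letter_perm (W : finType) (si : 'I_d -> {perm W}) (l : gen d * bool) (w : W) : W :=
  match l with
  | (Some j, false) => si j w
  | (Some j, true) => (si j)^-1 w
  | (None, _) => w
  end.

Lemma prho_word W (si : 'I_d -> {perm W}) u w :
  prho si (pword (@G1_rel q d) u) w = foldl (fun w l => letter_perm si l w) w u.
Proof.
elim: u w => [|l u IH] w; first by rewrite pword_nil (hom1 (prhoM si)) perm1.
rewrite -cat1s pword_cat prho_act IH /=; congr foldl.
case: l => [[j|] [|]] /=; rewrite ?pword_letterV ?(homV (prhoM si)).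
- by rewrite -[pword _ _]/(gt q j) prho_gt.
- by rewrite -[pword _ _]/(gt q j) prho_gt.
- by rewrite -[pword _ _]/a prho_ga invg1 perm1.
- by rewrite -[pword _ _]/a prho_ga perm1.
Qed.

Definition visited (w : word (gen d)) : seq V :=
  scanl (fun v l => letter_perm orb_perm l v) (rt o) w.

Section TwoCopies.
Variables (x : V) (j0 : 'I_d).

(** The double cover of the orbit graph that is trivial except over the edge from [x]
    with label [j0], where the sheets are exchanged. *)
Definition cross (j : 'I_d) (vc : V * bool) : V * bool :=
  (orb_perm j vc.1, vc.2 (+) ((j == j0) && (vc.1 == x))).

Lemma cross_inj j : injective (cross j).
Proof.
move=> [v c] [v' c'] [/perm_inj <-] E.
by congr pair; move: E => /addIb.
Qed.

Definition cross_perm j : {perm V * bool} := perm (@cross_inj j).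

Lemma cross_fst g vc : (prho cross_perm g vc).1 = prho orb_perm g vc.1.
Proof.
have E j u : (cross_perm j u).1 = orb_perm j u.1 by rewrite permE.
have EV j u : ((cross_perm j)^-1 u).1 = (orb_perm j)^-1 u.1.
  by apply: (@perm_inj _ (orb_perm j)); rewrite permKV -E permKV.
rewrite -[g]pword_repr !prho_word; elim: (repr g : word _) vc => //= l u IH vc.
by rewrite IH; congr foldl; case: l => [[j|] [|]] //=; rewrite ?E ?EV.
Qed.

Lemma cross_neg g v c c' : (prho cross_perm g (v, c (+) c')) =
  ((prho cross_perm g (v, c)).1, (prho cross_perm g (v, c)).2 (+) c').
Proof.
have E j u b : cross_perm j (u.1, u.2 (+) b) =
    ((cross_perm j u).1, (cross_perm j u).2 (+) b).
  by rewrite !permE /cross /= addbAC.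
have EV j u b : (cross_perm j)^-1 (u.1, u.2 (+) b) =
    (((cross_perm j)^-1 u).1, ((cross_perm j)^-1 u).2 (+) b).
  by apply: (@perm_inj _ (cross_perm j)); rewrite permKV E permKV.
rewrite -[g]pword_repr !prho_word.
rewrite -[(v, c (+) c')]/((v, c).1, (v, c).2 (+) c').
elim: (repr g : word _) (v, c) => [|l u IH] vc /=; first by [].
by rewrite -IH; congr foldl; case: l => [[j|] [|]] //=; rewrite ?E ?EV.
Qed.

Lemma cross_fix w : x != rt o -> w \in L -> x \notin visited w ->
  prho cross_perm (pword (@G1_rel q d) w) (rt o, false) = (rt o, false).
Proof.
move=> x0 wL; have := orb_fix (word_in_H wL); rewrite !prho_word /visited.
move=> Ew xw; rewrite -[in RHS]Ew {Ew wL}.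
elim: w (rt o) x0 xw => [|l w IH] v x0 //=.
rewrite inE negb_or => /andP[xl xw].
have -> : letter_perm cross_perm l (v, false) = (letter_perm orb_perm l v, false).
  case: l xl {xw} => [[j|] [|]] //= xl.
    apply: (@perm_inj _ (cross_perm j)); rewrite permKV permE /cross /= permKV.
    by rewrite [_ == x]eq_sym (negbTE xl) andbF.
  by rewrite permE /cross /= [_ == x]eq_sym (negbTE x0) andbF.
exact: IH.
Qed.

Lemma cross_trans vc : exists g, prho cross_perm g (rt o, false) = vc.
Proof.
(* The cycle of [t_j0] through [x] crosses the exceptional edge once, so it leads to
   the other sheet. *)
pose l := order (orb_perm j0) x.
have [g1 E1] := orb_trans (rt o) x.
have ltx : exists c g, forall b, prho cross_perm g (x, c (+) b) = (x, ~~ c (+) b).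
  have step k b : k < l -> prho cross_perm (gt q j0 ^+ k.+1) (x, b) =
      (iter k.+1 (orb_perm j0) x, ~~ b).
    elim: k => [|k IH] kl; first by rewrite expg1 prho_gt permE /cross /= !eqxx addbT.
    rewrite expgSr prho_act IH ?(ltnW kl) // prho_gt permE /cross /= eqxx /=.
    rewrite (_ : iter k.+1 (orb_perm j0) x == x = false) ?addbF //.
    rewrite iter_order_dvd; last exact: perm_inj.
    by apply/negP => /dvdn_leq => /(_ isT); rewrite leqNgt kl.
  have l0 : 0 < l by exact: order_gt0.
  exists false, (gt q j0 ^+ l) => b /=.
  rewrite -{1}(prednK l0) step ?prednK // iter_order //; exact: perm_inj.
have [c [g2 E2]] := ltx.
case: vc => v b; have [g3 E3] := orb_trans x v.
pose c1 := (prho cross_perm g1 (rt o, false)).2.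
have E1' : prho cross_perm g1 (rt o, false) = (x, c1).
  by rewrite [LHS]surjective_pairing cross_fst E1.
pose b1 := (prho cross_perm g3 (x, c1)).2.
have E3' : prho cross_perm g3 (x, c1) = (v, b1).
  by rewrite [LHS]surjective_pairing cross_fst E3.
have [Eb|Eb] := eqVneq b b1; first by exists (g1 * g3); rewrite prho_act E1' E3' Eb.
exists (g1 * g2 * g3); rewrite !prho_act E1'.
have -> : c1 = c (+) (c (+) c1) by rewrite addbA addbb.
rewrite E2 addNb addbA addbb /= -[~~ c1]addbT cross_neg E3' /= addbT.
by congr pair; case: (b) (b1) Eb => [] [].
Qed.

End TwoCopies.

(** Words that never visit [x] stay in one sheet of the double cover over [x], so the
    cover contradicts the maximality of the set of orbits. *)
Lemma all_visited x : x = rt o \/ exists2 w, w \in L & x \in visited w.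
Proof.
apply: contrapT => /not_orP[/eqP x0 nv].
have j0 : 'I_d by case: (d) d_gt0 => // d' _; exact: ord0.
have : #|{: V * bool}| <= #|V|.
  apply: (@card_le_orbits _ (cross_perm x j0) (rt o, false)).
    move=> w wL; apply: cross_fix => //; apply/negP => xw; case: nv; by exists w.
  exact: cross_trans.
have : 0 < #|V| by apply/fintype.card_gt0P; exists x.
by rewrite card_prod card_bool; lia.
Qed.

Lemma card_orbits_bound : #|V| <= (sumn [seq size w | w <- L]).+1.
Proof.
pose s := rt o :: flatten [seq visited w | w <- L].
have -> : (sumn [seq size w | w <- L]).+1 = size s.
  rewrite /s /= size_flatten /shape -map_comp; congr _.+1.
  by congr sumn; apply: eq_map => w /=; rewrite size_scanl.
apply: leq_trans (card_size s); apply/subset_leq_card/fintype.subsetP => v _.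
rewrite inE; have [->|[w wL vw]] := all_visited v; first by rewrite eqxx.
by apply/orP; right; apply/flattenP; exists (visited w) => //; apply: map_f.
Qed.

End PermutationActions.

(** * The number of vertices and the period as bounded searches *)

Definition ball (n : nat) (P : nat -> bool) : bool := all P (iota 0 n).
Definition bex (n : nat) (P : nat -> bool) : bool := has P (iota 0 n).

Lemma ballP n (P : nat -> bool) : reflect (forall i, i < n -> P i) (ball n P).
Proof.
apply: (iffP allP) => H i; first by move=> ltin; apply: H; rewrite mem_iota.
by rewrite mem_iota add0n => /andP[_]; apply: H.
Qed.

Lemma bexP n (P : nat -> bool) : reflect (exists2 i, i < n & P i) (bex n P).
Proof.
apply: (iffP hasP) => -[i]; first by rewrite mem_iota add0n => /andP[_ ltin]; exists i.
by move=> ltin Pi; exists i; rewrite // mem_iota.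
Qed.

Definition bmax (P : nat -> bool) (n : nat) : nat :=
  nat_rect (fun=> nat) 0 (fun i m => if P i.+1 then i.+1 else m) n.

Lemma bmaxE (P : nat -> bool) n k : 0 < k <= n -> P k ->
  (forall i, 0 < i <= n -> P i -> i <= k) -> bmax P n = k.
Proof.
move=> /andP[k0]; elim: n => [|n IH] lekn Pk H; first by move: lekn k0; case: (k).
rewrite /= -/(bmax P n); case: ifP => Pn.
  by apply/eqP; rewrite eqn_leq lekn andbT; apply: (H n.+1 _ Pn); rewrite leqnn.
have ne : k != n.+1 by apply/eqP => E; rewrite -E Pk in Pn.
apply: IH => //; first by move: lekn; rewrite leq_eqVlt (negbTE ne).
by move=> i /andP[i0 lein]; apply: H; rewrite i0 leqW.
Qed.

(** The action on the points [{0, .., n - 1}] of a letter given by its code, when [T u j]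
    is the image of [u] under [t_j].  The codes [0] and [1] are those of [a] and its
    inverse.  The sum has at most one nonzero term, the preimage of [u]. *)
Definition step_code (T : nat -> nat -> nat) (n u c : nat) : nat :=
  if c < 2 then u
  else if odd c then \sum_(v < n) v * (T v c./2.-1 == u) else T u c./2.-1.

Definition run_codes T n (cs : seq nat) : nat := foldl (step_code T n) 0 cs.

Definition fixes T n (ws : seq (seq nat)) : bool :=
  all (fun w => run_codes T n w == 0) ws.

(** The last condition is a way to ensure transitivity by local checks; every
    transitive set can be numbered so that it holds ([ordered_vertices]). *)
Definition table_ok (d n : nat) (T : nat -> nat -> nat) : bool :=
  [&& ball n (fun u => ball d (fun j => T u j < n)),
      ball d (fun j => ball n (fun u => ball n (fun v => (T u j == T v j) ==> (u == v))))
    & ball n (fun v => (v == 0) || bex v (fun u => bex d (fun j => T u j == v)))].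

Section Tables.
Variables (q d : nat).
Local Notation G := (G1 q d).
Variable L : seq (word (gen d)).
Local Notation H := (subgroup_of_words q L).

Definition codes : seq (seq nat) := [seq [seq letter_code l | l <- w] | w <- L].

Lemma run_codes_perm n (T : nat -> nat -> nat) (si : 'I_d -> {perm 'I_n}) w (u : 'I_n) :
  (forall (u : 'I_n) (j : 'I_d), T u j = si j u) ->
  foldl (step_code T n) u [seq letter_code l | l <- w] =
  prho si (pword (@G1_rel q d) w) u.
Proof.
move=> TE; rewrite prho_word; elim: w u => [|l w IH] u //=.
rewrite -IH; congr foldl; case: l => [[j|] b]; last by case: b.
have c2 : (letter_code (Some j, b) < 2) = false by rewrite /letter_code /=; lia.
have codd : odd (letter_code (Some j, b)) = b.
  by rewrite /letter_code oddD odd_double oddb.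
have chalf : (letter_code (Some j, b))./2.-1 = j.
  by rewrite /letter_code [_ + b]addnC half_bit_double.
rewrite /step_code c2 codd chalf; case: b {c2 codd chalf}; last by rewrite TE.
rewrite (bigD1 ((si j)^-1 u)%g) //= TE permKV eqxx muln1 big1 ?addn0 // => v ne.
by rewrite TE; case: eqP => [/val_inj E|_]; rewrite ?muln0 //; rewrite -E permK eqxx in ne.
Qed.

Lemma table_perm n T : 0 < n -> ball n (fun u => ball d (fun j => T u j < n)) ->
  ball d (fun j => ball n (fun u => ball n (fun v => (T u j == T v j) ==> (u == v)))) ->
  exists si : 'I_d -> {perm 'I_n}, forall (u : 'I_n) (j : 'I_d), T u j = si j u.
Proof.
move=> n0 /ballP T1 /ballP T2.
have lt_T (u : 'I_n) (j : 'I_d) : T u j < n by move/ballP: (T1 u (ltn_ord u)); apply.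
pose s j (u : 'I_n) : 'I_n := Ordinal (lt_T u j).
have s_inj j : injective (s j).
  move=> u v /(congr1 val) /= E; apply: val_inj.
  have /ballP/(_ u (ltn_ord u))/ballP/(_ v (ltn_ord v)) := T2 j (ltn_ord j).
  by rewrite E eqxx => /eqP.
by exists (fun j => perm (@s_inj j)) => u j; rewrite permE.
Qed.

Section Vertices.
Variables (O : finType) (o : O) (r : O -> G -> O).
Hypothesis rP : coset_action H o r.
Hypothesis d_gt0 : 0 < d.
Local Notation V := (orbV r).

Lemma table_le n T : 0 < n -> table_ok d n T -> fixes T n codes -> n <= #|V|.
Proof.
move=> n0 /and3P[T1 T2 /ballP T3] /allP Tfix.
have [si TE] := table_perm n0 T1 T2.
rewrite -(card_ord n); apply: (@card_le_orbits q d L O o r rP _ si (Ordinal n0)).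
  move=> w wL; apply: val_inj; rewrite /= -(run_codes_perm w _ TE) /=.
  by apply/eqP; apply: Tfix; apply: map_f.
move=> [v lt_vn]; elim/ltn_ind: v lt_vn => v IH lt_vn.
have /orP[/eqP v0|/bexP[u lt_uv /bexP[j lt_jd /eqP E]]] := T3 v lt_vn.
  by exists 1%g; rewrite (hom1 (prhoM si)) perm1; apply: val_inj.
have lt_un : u < n by exact: ltn_trans lt_vn.
have [g Eg] := IH u lt_uv lt_un; exists (g * gt q (Ordinal lt_jd))%g.
rewrite prho_act Eg prho_gt; apply: val_inj; rewrite /= -E.
by rewrite (TE (Ordinal lt_un) (Ordinal lt_jd)).
Qed.

(** A proper subset that no [t_j] leads out of would be stable under the inverses too,
    by finiteness, contradicting transitivity. *)
Lemma ordered_vertices n : 0 < n <= #|V| -> exists s : seq V,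
  [/\ size s = n, uniq s, nth (rt rP o) s 0 = rt rP o &
      forall i, 0 < i < n -> exists2 i', i' < i &
        exists j, orb_perm rP j (nth (rt rP o) s i') = nth (rt rP o) s i].
Proof.
pose x0 := rt rP o.
case: n => // n; elim: n => [|n IH] lt_n.
  by exists [:: x0]; split=> // i; rewrite ltnS; case: i.
have [|s [size_s uniq_s s0 Hs]] := IH; first by rewrite /= ltnW.
have [[v [j [vs jvs]]]|closed] := pselect (exists v j, v \in s /\ orb_perm rP j v \notin s).
  exists (rcons s (orb_perm rP j v)); split.
  - by rewrite size_rcons size_s.
  - by rewrite rcons_uniq jvs.
  - by rewrite nth_rcons size_s.
  move=> i /andP[i0]; rewrite ltnS leq_eqVlt => /predU1P[->|lt_i].
    exists (index v s); first by rewrite -size_s index_mem.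
    by exists j; rewrite !nth_rcons size_s ltnn eqxx -size_s index_mem vs nth_index.
  have [|i' lt_i' [j' E]] := Hs i; first by rewrite i0.
  exists i' => //; exists j'; rewrite !nth_rcons size_s lt_i.
  by rewrite (ltn_trans lt_i' lt_i).
have clos v j : v \in s -> orb_perm rP j v \in s.
  by move=> vs; apply: contrapT => /negP jvs; apply: closed; exists v, j.
have closV v j : v \in s -> (orb_perm rP j)^-1%g v \in s.
  have [m m0 Em] := iter_fixed (@perm_inj _ (orb_perm rP j)).
  move=> vs; have -> : (orb_perm rP j)^-1%g v = iter m.-1 (orb_perm rP j) v.
    apply: (@perm_inj _ (orb_perm rP j)); rewrite permKV -iterS prednK //.
  by elim: (m.-1) => //= i IHi; apply: clos.
have x0s : x0 \in s.
  have : nth (rt rP o) s 0 \in s by rewrite mem_nth // size_s.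
  by rewrite s0.
have all_s v : v \in s.
  have [g <-] := orb_trans rP x0 v; rewrite -[g]pword_repr prho_word.
  elim: (repr g : word _) x0 x0s => //= l u IHu x xs; apply: IHu.
  by case: l => [[j|] [|]] /=; [exact: closV | exact: clos | by [] | by []].
have : #|V| <= size s.
  by apply: leq_trans (card_size s); apply/subset_leq_card/fintype.subsetP.
by move/andP: lt_n => [_ lt_n]; rewrite size_s leqNgt lt_n.
Qed.

Definition table_of (d : nat) (s : seq nat) (u j : nat) : nat := nth 0 s (u * d + j).

Lemma table_exists : exists2 s : seq nat,
  size s = #|V| * d /\ all (fun x => x < #|V|) s &
  table_ok d #|V| (table_of d s) && fixes (table_of d s) #|V| codes.
Proof.
set k := #|V|; pose x0 := rt rP o.
have k0 : 0 < k by apply/fintype.card_gt0P; exists x0.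
have [|s [size_s uniq_s s0 Hs]] := @ordered_vertices k; first by rewrite k0 leqnn.
have all_s v : v \in s.
  apply: contrapT => /negP vs; have := max_card (mem (v :: s)).
  by rewrite (card_uniqP _) /= ?vs ?size_s ?ltnn.
pose img u j := index (orb_perm rP j (nth x0 s u)) s.
pose t := mkseq (fun i => if insub (i %% d) is Some j then img (i %/ d) j else 0) (k * d).
have lt_img u j : img u j < k by rewrite -size_s index_mem.
have tE u (j : 'I_d) : u < k -> table_of d t u j = img u j.
  move=> uk; rewrite /table_of nth_mkseq.
    rewrite modnMDl modn_small // divnMDl // divn_small // addn0.
    by rewrite (_ : insub _ = Some j) //; apply: valK.
  have := ltn_ord j => jd; apply: leq_trans (_ : u * d + d <= _); first by rewrite ltn_add2l.
  by rewrite -mulSnr leq_mul2r uk orbT.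
pose fw (u : 'I_k) : V := nth x0 s u.
have fw_inj : injective fw.
  move=> u v /eqP E; apply/val_inj/eqP.
  by rewrite -(nth_uniq x0 _ _ uniq_s) ?size_s ?ltn_ord.
exists t.
  split; first by rewrite size_mkseq.
  apply/allP => _ /mapP[i _ ->]; case: insubP => //= j _ _; exact: lt_img.
have T1 : ball k (fun u => ball d (fun j => table_of d t u j < k)).
  by apply/ballP => u uk; apply/ballP => j jd; rewrite (tE u (Ordinal jd)).
have T2 : ball d (fun j => ball k (fun u => ball k (fun v =>
    (table_of d t u j == table_of d t v j) ==> (u == v)))).
  apply/ballP => j jd; apply/ballP => u uk; apply/ballP => v vk; apply/implyP.
  rewrite (tE u (Ordinal jd)) // (tE v (Ordinal jd)) // => /eqP.
  move/(congr1 (nth x0 s)); rewrite !nth_index // => /perm_inj /eqP.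
  by rewrite nth_uniq ?size_s.
apply/andP; split.
  rewrite /table_ok T1 T2 /=; apply/ballP => v vk; case: posnP => // v0 /=.
  have [|u uv [j E]] := Hs v; first by rewrite v0.
  apply/bexP; exists u => //; apply/bexP; exists (val j); first exact: ltn_ord.
  by rewrite tE ?(ltn_trans uv) // /img E index_uniq ?size_s.
have [si TE] := table_perm k0 T1 T2.
apply/allP => _ /mapP[w wL ->]; apply/eqP.
pose z := Ordinal k0; rewrite /run_codes -[0]/(val z) (run_codes_perm w z TE).
have siE j u : fw (si j u) = orb_perm rP j (fw u).
  by rewrite /fw -(TE u j) tE // nth_index.
have siVE j u : fw ((si j)^-1%g u) = (orb_perm rP j)^-1%g (fw u).
  by apply: (@perm_inj _ (orb_perm rP j)); rewrite permKV -siE permKV.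
have E : fw (prho si (pword (@G1_rel q d) w) z) = fw z.
  have -> : fw z = x0 by [].
  rewrite -[RHS](orb_fix rP (word_in_H wL)) !prho_word -/x0.
  rewrite (_ : x0 = fw z) //; elim: (w) (z) => //= l u IH y.
  by rewrite IH; congr foldl; case: l => [[j|] [|]] //=.
by rewrite (fw_inj _ _ E).
Qed.

End Vertices.

Lemma code_bound n (s : seq nat) : all (fun x => x < n) s ->
  CodeSeq.code s < 2 ^ (n.+1 * size s).
Proof.
elim: s => [|x s IH] /=; first by rewrite muln0.
move=> /andP[xn /IH Hs]; rewrite [n.+1 * _]mulnS expnD.
apply: leq_trans (_ : 2 ^ n * (2 * (CodeSeq.code s).+1) <= _); last first.
  by rewrite mulnA -expnSr leq_mul2l Hs orbT.
apply: leq_ltn_trans (_ : 2 ^ n * (CodeSeq.code s).*2.+1 < _).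
  by rewrite leq_mul2r leq_exp2l // (ltnW xn) orbT.
by rewrite ltn_mul2l expn_gt0 /=; lia.
Qed.

Lemma sum_code (s : seq nat) : sumn s + size s <= CodeSeq.code s.
Proof.
elim: s => //= x s IH; have : x < 2 ^ x by exact: ltn_expl.
by move: (2 ^ x) => e; nia.
Qed.

Lemma sum_size_code : sumn [seq size w | w <- L] <= words_code L.
Proof.
apply: leq_trans (_ : sumn [seq word_code w | w <- L] <= _); last first.
  exact: leq_trans (leq_addr _ _) (sum_code _).
elim: (L) => //= w ws IH; apply: leq_add => //.
apply: leq_trans (sum_code _); rewrite size_map; exact: leq_addl.
Qed.

(** The bound for [n] comes from [card_orbits_bound] and [sum_size_code], the bound for
    the code of a table from [code_bound]. *)
Definition vertex_count : nat :=
  bmax (fun n => bex (2 ^ (n.+1 * (n * d))) (fun c =>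
          table_ok d n (table_of d (CodeSeq.decode c)) &&
          fixes (table_of d (CodeSeq.decode c)) n codes)) (words_code L).+1.

Lemma vertex_countE (O : finType) (o : O) (r : O -> G -> O) :
  coset_action H o r -> 0 < d -> vertex_count = #|orbV r|.
Proof.
move=> rP d0; apply: bmaxE.
- apply/andP; split; first by apply/fintype.card_gt0P; exists (rt rP o).
  by apply: leq_trans (card_orbits_bound rP d0) _; rewrite ltnS sum_size_code.
- have [s [size_s all_s] Hs] := table_exists rP d0.
  apply/bexP; exists (CodeSeq.code s); last by rewrite CodeSeq.codeK.
  by rewrite -size_s; exact: code_bound.
move=> n /andP[n0 _] /bexP[c _ /andP[Tok Tfix]].
exact: (table_le rP n0 Tok Tfix).
Qed.

(** In the cyclic table every [t_j] is the successor modulo [n], so that words act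
    through their exponent sums. *)
Definition period : nat :=
  bmax (fun n => fixes (fun u _ => u.+1 %% n) n codes) (words_code L).+1.

Lemma eps_word_le (w : word (gen d)) : `|eps_word w|%N <= size w.
Proof.
elim: w => //= l w IH; rewrite /eps_letter.
by case: l => [[j|] [|]] /=; lia.
Qed.

Lemma fixes_cyclic n : 0 < n ->
  fixes (fun u _ => u.+1 %% n) n codes = all (fun w => (Posz n %| eps_word w)%Z) L.
Proof.
move=> n0; have [||si TE] := @table_perm n (fun u _ => u.+1 %% n) n0.
- by apply/ballP => u un; apply/ballP => j _; rewrite ltn_mod.
- apply/ballP => j _; apply/ballP => u un; apply/ballP => v vn.
  apply/implyP; rewrite -(addn1 u) -(addn1 v) => /eqP/eqP.
  by rewrite eqn_modDr !modn_small.
rewrite /fixes all_map; apply: eq_all => w /=; pose z := Ordinal n0.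
rewrite /run_codes -[in foldl _ 0]/(val z) (run_codes_perm w z TE) prho_word.
have siE j u : (Posz (si j u) = Posz u + 1 %[mod n])%Z.
  by rewrite -(TE u j) -modz_nat modz_mod -addn1.
have siVE j u : (Posz ((si j)^-1%g u) = Posz u - 1 %[mod n])%Z.
  have := siE j ((si j)^-1%g u); rewrite permKV => E.
  by rewrite -[in RHS]modzDml E modzDml GRing.addrK.
have E : (Posz (foldl (fun w l => letter_perm si l w) z w) = Posz z + eps_word w %[mod n])%Z.
  elim: (w) (z) => [|l u IH] y /=; first by rewrite GRing.addr0.
  rewrite IH -modzDml GRing.addrA -[in RHS]modzDml; congr (modz (_ + _)%R _).
  by case: l => [[j|] [|]] /=; rewrite /eps_letter /= ?siE ?siVE ?GRing.addr0.
move: E; rewrite GRing.add0r; set y := foldl _ _ _ => E.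
apply/eqP/dvdz_mod0P => [y0|]; first by rewrite -E y0 mod0z.
by rewrite -E modz_nat modn_small // => -[].
Qed.

Lemma periodP (O : finType) (o : O) (r : O -> G -> O) :
  coset_action H o r -> 0 < d -> is_period H period.
Proof.
move=> rP d0.
have HL n : (forall h, H h -> (Posz n %| eps h)%Z) <-> all (fun w => (Posz n %| eps_word w)%Z) L.
  split=> [Hn|/allP Hn].
    by apply/allP => w wL; rewrite -(eps_pword q); apply: Hn; exact: word_in_H.
  apply: (H_min (A := fun h => (Posz n %| eps h)%Z)).
    split; first by rewrite eps1 dvdz0.
    by move=> x y Hx Hy; rewrite epsM epsV; apply: GRing.rpredB.
  by move=> w wL; rewrite eps_pword; apply: Hn.
(* The image of [H] is generated by the exponent sums of the words. *)
pose p := foldr (fun w p => gcdn `|eps_word w|%N p) 0 L.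
have pE n : all (fun w => (Posz n %| eps_word w)%Z) L = (n %| p).
  rewrite /p; elim: (L) => [|w ws IH] /=; first by rewrite dvdn0.
  by rewrite dvdn_gcd IH dvdzE.
have [l l0 Hl] := power_in_H rP (gt q (Ordinal d0)).
have epsl : eps (gt q (Ordinal d0) ^+ l)%g = Posz l.
  by rewrite epsX eps_gt; lia.
have p0 : 0 < p.
  rewrite lt0n; apply/eqP => p0.
  have /HL/(_ _ Hl) : all (fun w => (Posz 0 %| eps_word w)%Z) L by rewrite pE p0.
  by rewrite epsl dvdzE dvd0n /=; lia.
have pB : p <= (words_code L).+1.
  have [w wL nz] : exists2 w, w \in L & eps_word w != 0%R.
    apply: contrapT => nz.
    have /HL/(_ _ Hl) : all (fun w => (Posz 0 %| eps_word w)%Z) L.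
      apply/allP => w wL; rewrite dvd0z; apply: contrapT => /negP nz'.
      by apply: nz; exists w.
    by rewrite epsl dvdzE dvd0n /=; lia.
  have : p %| p by []; rewrite -{1}pE => /allP/(_ w wL); rewrite dvdzE => /dvdn_leq.
  move=> /(_ (_ : 0 < `|eps_word w|)%N) => H1.
  apply: leq_trans (H1 _) _; first by rewrite absz_gt0.
  apply: leq_trans (eps_word_le w) _; apply: leqW; apply: leq_trans sum_size_code.
  by rewrite (perm_sumn (perm_map size (perm_to_rem wL))) /= leq_addr.
suff -> : period = p by split=> // n; rewrite HL pE.
apply: bmaxE; first by rewrite p0.
  by rewrite fixes_cyclic // pE.
by move=> n /andP[n0 _]; rewrite fixes_cyclic // pE => /dvdn_leq; apply.
Qed.

End Tables.

(** * Functions computed by recursive programs *)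

(** Arguments are read off a list, so that the variables bound by sums, quantifiers and
    recursions are consed to the environment. *)
Definition comput (k : nat) (F : seq nat -> nat) : Prop :=
  exists f : recfun k, forall v : k.-tuple nat, rec_eval f v (F v).

Definition compb (k : nat) (P : seq nat -> bool) : Prop := comput k (fun s => P s).

Lemma comput_ext k (F F' : seq nat -> nat) :
  (forall s, size s = k -> F s = F' s) -> comput k F -> comput k F'.
Proof.
by move=> E [f fP]; exists f => v; rewrite -E; [exact: fP | exact: size_tuple].
Qed.

Lemma comput_var k i : comput k (fun s => nth 0 s i).
Proof.
case: (ltnP i k) => [ltik|leki].
  by exists (RProj (Ordinal ltik)) => v /=; rewrite (tnth_nth 0).
by exists (RZero k) => v /=; rewrite nth_default ?size_tuple.
Qed.

Lemma comput_subst k (F : seq nat -> nat) (Gs : seq (seq nat -> nat)) :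
  comput (size Gs) F -> (forall i, i < size Gs -> comput k (nth (fun=> 0) Gs i)) ->
  comput k (fun s => F [seq G s | G <- Gs]).
Proof.
move=> [f fP] GsP; have /choice[g gP] (i : 'I_(size Gs)) := GsP i (ltn_ord i).
exists (RComp f g) => v /=.
have size_w : size [seq G v | G : seq nat -> nat <- Gs] == size Gs by rewrite size_map.
exists (Tuple size_w); last exact: fP.
move=> i; rewrite (tnth_nth 0) /= (nth_map (fun=> 0)) //; exact: gP.
Qed.

Lemma comput_succ k F : comput k F -> comput k (fun s => (F s).+1).
Proof.
move=> cF; apply: (@comput_subst k (fun s => (nth 0 s 0).+1) [:: F]); last by case.
by exists RSucc => v; rewrite /= /thead (tnth_nth 0).
Qed.

Lemma comput_const k n : comput k (fun=> n).
Proof. by elim: n => [|n IH]; [exists (RZero k) | exact: comput_succ]. Qed.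

Lemma map_vars (s : seq nat) j k : size s = (j + k)%N ->
  [seq G s | G <- [seq (fun s : seq nat => nth 0 s i) | i <- iota j k]] = drop j s.
Proof.
move=> E; rewrite -map_comp; apply: (@eq_from_nth _ 0).
  by rewrite size_map size_iota size_drop E addnC addnK.
move=> i; rewrite size_map size_iota => ltik.
by rewrite (nth_map 0) ?size_iota //= nth_iota // nth_drop.
Qed.

(** Used inside the body of a recursion, whose environment begins with the counter and
    the accumulator ([j = 2]), and with [j = 0] as a substitution. *)
Lemma comput_skip k j (F X : seq nat -> nat) : comput k.+1 F -> comput (j + k) X ->
  comput (j + k) (fun s => F (X s :: drop j s)).
Proof.
move=> cF cX; pose Gs := X :: [seq (fun s : seq nat => nth 0 s i) | i <- iota j k].
apply: (@comput_ext _ (fun s => F [seq G s | G <- Gs])).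
  by move=> s size_s; rewrite /= map_vars.
apply: comput_subst; first by rewrite /= size_map size_iota.
case=> [|i] //=; rewrite size_map size_iota ltnS => ltik.
by rewrite (nth_map 0) ?size_iota //; exact: comput_var.
Qed.

Lemma comput_weaken j k (F : seq nat -> nat) : comput k F ->
  comput (j + k) (fun s => F (drop j s)).
Proof.
move=> cF; pose Gs := [seq (fun s : seq nat => nth 0 s i) | i <- iota j k].
apply: (@comput_ext _ (fun s => F [seq G s | G <- Gs])).
  by move=> s size_s; rewrite map_vars.
apply: comput_subst; first by rewrite size_map size_iota.
move=> i; rewrite size_map size_iota => ltik.
by rewrite (nth_map 0) ?size_iota //; exact: comput_var.
Qed.

Lemma comput_rec k (N A B : seq nat -> nat) :
  comput k N -> comput k A -> comput k.+2 B ->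
  comput k (fun s => nat_rect (fun=> nat) (A s) (fun i y => B [:: i, y & s]) (N s)).
Proof.
move=> cN cA cB.
have cR : comput k.+1 (fun s =>
    nat_rect (fun=> nat) (A (behead s)) (fun i y => B [:: i, y & behead s]) (head 0 s)).
  have [f fP] := cA; have [g gP] := cB; exists (RPrim f g) => v.
  pose R n := nat_rect (fun=> nat) (A (behead v)) (fun i y => B [:: i, y & behead v]) n.
  exists R; split.
  - exact: (fP [tuple of behead v]).
  - by move=> i _; exact: (gP [tuple of i :: R i :: [tuple of behead v]]).
  by rewrite /thead (tnth_nth 0) nth0.
apply: (comput_ext _ (@comput_skip k 0 _ N cR cN)) => s size_s /=.
by rewrite drop0.
Qed.

Lemma comput_add k F N : comput k F -> comput k N -> comput k (fun s => F s + N s).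
Proof.
move=> cF cN; apply: (comput_ext _ (comput_rec cN cF (comput_succ (@comput_var k.+2 1)))).
by move=> s _; elim: (N s) => [|n IH] /=; rewrite ?addn0 // addnS -IH.
Qed.

Lemma comput_pred k F : comput k F -> comput k (fun s => (F s).-1).
Proof.
move=> cF; apply: (comput_ext _ (comput_rec cF (comput_const k 0) (@comput_var k.+2 0))).
by move=> s _; case: (F s).
Qed.

Lemma comput_sub k F N : comput k F -> comput k N -> comput k (fun s => F s - N s).
Proof.
move=> cF cN; apply: (comput_ext _ (comput_rec cN cF (comput_pred (@comput_var k.+2 1)))).
by move=> s _; elim: (N s) => [|n IH] /=; rewrite ?subn0 // subnS -IH.
Qed.

Lemma comput_mul k F N : comput k F -> comput k N -> comput k (fun s => F s * N s).
Proof.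
move=> cF cN; apply: (comput_ext _ (comput_rec cN (comput_const k 0)
   (comput_add (@comput_var k.+2 1) (@comput_weaken 2 k _ cF)))).
by move=> s _; rewrite /= drop0; elim: (N s) => [|n IH] /=; rewrite ?muln0 // mulnSr -IH.
Qed.

Lemma comput_exp k F N : comput k F -> comput k N -> comput k (fun s => F s ^ N s).
Proof.
move=> cF cN; apply: (comput_ext _ (comput_rec cN (comput_const k 1)
   (comput_mul (@comput_var k.+2 1) (@comput_weaken 2 k _ cF)))).
by move=> s _; rewrite /= drop0; elim: (N s) => [|n IH] /=; rewrite ?expn0 // expnSr -IH.
Qed.

Lemma compb_leq k F N : comput k F -> comput k N -> compb k (fun s => F s <= N s).
Proof.
move=> cF cN; apply: (comput_ext _ (comput_sub (comput_const k 1) (comput_sub cF cN))).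
by move=> s _; rewrite /leq; case: (F s - N s).
Qed.

Lemma compb_and k P Q : compb k P -> compb k Q -> compb k (fun s => P s && Q s).
Proof.
move=> cP cQ; apply: (comput_ext _ (comput_mul cP cQ)) => s _.
by rewrite mulnb.
Qed.

Lemma compb_neg k P : compb k P -> compb k (fun s => ~~ P s).
Proof.
move=> cP; apply: (comput_ext _ (comput_sub (comput_const k 1) cP)) => s _.
by case: (P s).
Qed.

Lemma compb_or k P Q : compb k P -> compb k Q -> compb k (fun s => P s || Q s).
Proof.
move=> cP cQ; apply: (comput_ext _ (compb_neg (compb_and (compb_neg cP) (compb_neg cQ)))).
by move=> s _; rewrite -negb_or negbK.
Qed.

Lemma compb_eq k F N : comput k F -> comput k N -> compb k (fun s => F s == N s).
Proof.
move=> cF cN; apply: (comput_ext _ (compb_and (compb_leq cF cN) (compb_leq cN cF))).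
by move=> s _; rewrite eqn_leq.
Qed.

Lemma comput_if k P F N : compb k P -> comput k F -> comput k N ->
  comput k (fun s => if P s then F s else N s).
Proof.
move=> cP cF cN; apply: (comput_ext _ (comput_add (comput_mul cP cF)
  (comput_mul (compb_neg cP) cN))) => s _.
by case: (P s); rewrite ?mul1n ?mul0n ?addn0.
Qed.

Lemma comput_odd k F : comput k F -> compb k (fun s => odd (F s)).
Proof.
move=> cF; apply: (comput_ext _ (comput_rec cF (comput_const k 0)
  (comput_sub (comput_const _ 1) (@comput_var k.+2 1)))).
by move=> s _; elim: (F s) => //= n ->; case: odd.
Qed.

Lemma comput_half k F : comput k F -> comput k (fun s => (F s)./2).
Proof.
move=> cF; apply: (comput_ext _ (comput_rec cF (comput_const k 0)
  (comput_add (comput_odd (@comput_var k.+2 0)) (@comput_var k.+2 1)))).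
by move=> s _; elim: (F s) => //= n ->; rewrite uphalf_half.
Qed.

Lemma comput_bind2 k F : comput k.+1 F -> comput k.+2 (fun s => F (nth 0 s 0 :: drop 2 s)).
Proof. by move=> cF; apply: (@comput_skip k 2) => //; exact: comput_var. Qed.

Lemma comput_sum k N F : comput k N -> comput k.+1 F ->
  comput k (fun s => \sum_(i < N s) F (val i :: s)).
Proof.
move=> cN cF; apply: (comput_ext _ (comput_rec cN (comput_const k 0)
  (comput_add (@comput_var k.+2 1) (comput_bind2 cF)))).
move=> s _; elim: (N s) => [|n IH]; first by rewrite big_ord0.
by rewrite big_ord_recr -IH /= drop0.
Qed.

Lemma compb_ball k N P : comput k N -> compb k.+1 P ->
  compb k (fun s => ball (N s) (fun i => P (i :: s))).
Proof.
move=> cN cP; apply: (comput_ext _ (comput_rec cN (comput_const k 1)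
  (comput_mul (@comput_var k.+2 1) (comput_bind2 cP)))).
move=> s _; elim: (N s) => //= n ->; rewrite drop0 mulnb; congr nat_of_bool.
by rewrite /ball -(addn1 n) iotaD all_cat /= andbT.
Qed.

Lemma compb_bex k N P : comput k N -> compb k.+1 P ->
  compb k (fun s => bex (N s) (fun i => P (i :: s))).
Proof.
move=> cN cP; apply: (comput_ext _ (compb_neg (compb_ball cN (compb_neg cP)))).
move=> s _; rewrite /ball /bex -has_predC; congr nat_of_bool.
by apply: eq_has => i /=; rewrite negbK.
Qed.

Lemma comput_bmax k N P : comput k N -> compb k.+1 P ->
  comput k (fun s => bmax (fun i => P (i :: s)) (N s)).
Proof.
move=> cN cP.
have cS := comput_succ (@comput_var k.+2 0).
apply: (comput_ext _ (comput_rec cN (comput_const k 0)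
  (comput_if (@comput_skip k 2 _ _ cP cS) cS (@comput_var k.+2 1)))).
by move=> s _; rewrite /bmax; elim: (N s) => //= n ->; rewrite drop0.
Qed.

Lemma sum_ltn m n : \sum_(i < m) (i < n) = minn m n.
Proof.
elim: m => [|m IH]; first by rewrite big_ord0 min0n.
by rewrite big_ord_recr /= IH; lia.
Qed.

(** The quotient is the number of [i < F] with [(i + 1) N <= F]; the factor [1 <= N]
    is for division by [0]. *)
Lemma comput_div k F N : comput k F -> comput k N -> comput k (fun s => F s %/ N s).
Proof.
move=> cF cN.
have cB : compb k.+1 (fun s => (nth 0 s 0).+1 * N (drop 1 s) <= F (drop 1 s)).
  apply: compb_leq; last exact: (@comput_weaken 1 k).
  by apply: comput_mul; [exact/comput_succ/comput_var | exact: (@comput_weaken 1 k)].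
apply: (comput_ext _ (comput_mul (compb_leq (comput_const k 1) cN) (comput_sum cF cB))).
move=> s _ /=; case: (posnP (N s)) => [->|N0]; first by rewrite divn0.
rewrite mul1n drop0; set m := F s; rewrite (eq_bigr (fun i : 'I_m => nat_of_bool (i < m %/ N s))).
  by rewrite sum_ltn; apply/minn_idPr/leq_div.
by move=> i _; rewrite leq_divRL.
Qed.

Lemma comput_app1 k (f : nat -> nat) A :
  comput 1 (fun s => f (nth 0 s 0)) -> comput k A -> comput k (fun s => f (A s)).
Proof. by move=> cf cA; apply: (@comput_subst k _ [:: A] cf); case. Qed.

Lemma comput_app2 k (f : nat -> nat -> nat) A B :
  comput 2 (fun s => f (nth 0 s 0) (nth 0 s 1)) -> comput k A -> comput k B ->
  comput k (fun s => f (A s) (B s)).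
Proof. by move=> cf cA cB; apply: (@comput_subst k _ [:: A; B] cf); case=> [|[|]]. Qed.

Lemma comput_app4 k (f : nat -> nat -> nat -> nat -> nat) A B C D :
  comput 4 (fun s => f (nth 0 s 0) (nth 0 s 1) (nth 0 s 2) (nth 0 s 3)) ->
  comput k A -> comput k B -> comput k C -> comput k D ->
  comput k (fun s => f (A s) (B s) (C s) (D s)).
Proof.
move=> cf cA cB cC cD; apply: (@comput_subst k _ [:: A; B; C; D] cf).
by case=> [|[|[|[|]]]].
Qed.

Lemma comput_app5 k (f : nat -> nat -> nat -> nat -> nat -> nat) A B C D E :
  comput 5 (fun s => f (nth 0 s 0) (nth 0 s 1) (nth 0 s 2) (nth 0 s 3) (nth 0 s 4)) ->
  comput k A -> comput k B -> comput k C -> comput k D -> comput k E ->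
  comput k (fun s => f (A s) (B s) (C s) (D s) (E s)).
Proof.
move=> cf cA cB cC cD cE; apply: (@comput_subst k _ [:: A; B; C; D; E] cf).
by case=> [|[|[|[|[|]]]]].
Qed.

Lemma compb_dvd k F N : comput k F -> comput k N -> compb k (fun s => N s %| F s).
Proof.
move=> cF cN; apply: (comput_ext _ (compb_eq (comput_mul (comput_div cF cN) cN) cF)).
by move=> s _; rewrite dvdn_eq.
Qed.

Lemma comput_mulb k F P : comput k F -> compb k P -> comput k (fun s => F s * P s).
Proof. exact: comput_mul. Qed.

Lemma compb_implies k P Q : compb k P -> compb k Q -> compb k (fun s => P s ==> Q s).
Proof.
move=> cP cQ; apply: (comput_ext _ (compb_or (compb_neg cP) cQ)) => s _.
by rewrite implybE.
Qed.

(** * Decoding lists *)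

(** The head of a coded list is the 2-adic valuation of its code. *)
Definition hdc (c : nat) : nat := logn 2 c.
Definition tlc (c : nat) : nat := c %/ 2 ^ (hdc c).+1.
Definition dropc (i c : nat) : nat := iter i tlc c.

Lemma hdc_code x s : hdc (CodeSeq.code (x :: s)) = x.
Proof.
rewrite /hdc /= lognM ?expn_gt0 // lognX logn_prime // eqxx muln1.
by rewrite lognE /= dvdn2 /= odd_double /= addn0.
Qed.

Lemma tlc_code x s : tlc (CodeSeq.code (x :: s)) = CodeSeq.code s.
Proof.
rewrite /tlc hdc_code /= expnSr divnMl ?expn_gt0 //.
by rewrite divn2 /= uphalf_double.
Qed.

Lemma dropc_code i s : dropc i (CodeSeq.code s) = CodeSeq.code (drop i s).
Proof.
elim: i s => [|i IH] s; first by rewrite drop0.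
rewrite /dropc iterSr; case: s => [|x s]; last by rewrite tlc_code -/(dropc i _) IH.
by rewrite (_ : tlc _ = CodeSeq.code [::]) // -/(dropc i _) IH; case: (i).
Qed.

Lemma code_eq0 s : (CodeSeq.code s == 0) = (size s == 0).
Proof. by case: s => //= x s; rewrite muln_eq0 expn_eq0. Qed.

Lemma dropc_eq0 i s : (dropc i (CodeSeq.code s) == 0) = (size s <= i).
Proof. by rewrite dropc_code code_eq0 size_drop. Qed.

Lemma hdc_dropc i s : hdc (dropc i (CodeSeq.code s)) = nth 0 s i.
Proof.
rewrite dropc_code; case: (ltnP i (size s)) => [lti|lei].
  by rewrite (drop_nth 0) // hdc_code.
by rewrite drop_oversize // nth_default.
Qed.

(** The 2-adic valuation of [n] is the number of positive exponents [i] with [2^i]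
    dividing [n], all of them less than [n]. *)
Lemma comput_hdc k F : comput k F -> comput k (fun s => hdc (F s)).
Proof.
apply: comput_app1; have cv := @comput_var.
have cS : compb 2 (fun s => 2 ^ (nth 0 s 0).+1 %| nth 0 s 1).
  apply: compb_dvd; first exact: cv.
  by apply: comput_exp; [exact: comput_const | exact/comput_succ/cv].
apply: (comput_ext _ (@comput_sum 1 (fun s => nth 0 s 0) _ (cv 1 0) cS)).
move=> s _ /=; case: (nth 0 s 0) => [|n]; first by rewrite big_ord0 /hdc.
rewrite /hdc logn_count_dvd // big_add1 big_mkord big_ord_recr /=.
by rewrite gtnNdvd ?addn0 //; exact: ltn_expl.
Qed.

Lemma comput_tlc k F : comput k F -> comput k (fun s => tlc (F s)).
Proof.
move=> cF; apply: comput_div => //; apply: comput_exp; first exact: comput_const.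
exact/comput_succ/comput_hdc.
Qed.

Lemma comput_dropc k F N : comput k N -> comput k F -> comput k (fun s => dropc (N s) (F s)).
Proof.
move=> cN cF; apply: (comput_ext _ (comput_rec cN cF (comput_tlc (@comput_var k.+2 1)))).
by move=> s _; elim: (N s) => //= n ->.
Qed.

(** * The two searches are computable *)

Section Family.
(** A program reads a table off its environment, hence the two numerical parameters. *)
Variable tau : nat -> nat -> nat -> nat -> nat.
Hypothesis ctau : comput 4 (fun s => tau (nth 0 s 0) (nth 0 s 1) (nth 0 s 2) (nth 0 s 3)).

(** A code is at least the length of the list, so it bounds the recursions over its
    items; past the end of the list nothing happens. *)
Definition run_num (c d n w : nat) : nat :=
  nat_rect (fun=> nat) 0 (fun i y =>
    if dropc i w == 0 then y else step_code (tau c d) n y (hdc (dropc i w))) w.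

Definition fixes_num (c d n l : nat) : bool :=
  ball l (fun i => (dropc i l == 0) || (run_num c d n (hdc (dropc i l)) == 0)).

Lemma run_numE c d n (w : seq nat) :
  run_num c d n (CodeSeq.code w) = run_codes (tau c d) n w.
Proof.
rewrite /run_num; set c0 := CodeSeq.code w.
have H k : nat_rect (fun=> nat) 0 (fun i y =>
    if dropc i c0 == 0 then y else step_code (tau c d) n y (hdc (dropc i c0))) k =
  run_codes (tau c d) n (take k w).
  elim: k => [|k IH] /=; first by rewrite take0.
  rewrite IH dropc_eq0 hdc_dropc; case: leqP => [le|lt].
    by rewrite !take_oversize ?(leqW le).
  by rewrite (take_nth 0) // /run_codes foldl_rcons.
rewrite H take_oversize //; exact: leq_trans (leq_addl _ _) (sum_code w).
Qed.

Lemma fixes_numE c d n (ws : seq (seq nat)) :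
  fixes_num c d n (CodeSeq.code [seq CodeSeq.code w | w <- ws]) = fixes (tau c d) n ws.
Proof.
set l := [seq _ | w <- ws].
have size_l : size l <= CodeSeq.code l by apply: leq_trans (leq_addl _ _) (sum_code l).
have nthE i : i < size ws -> nth 0 l i = CodeSeq.code (nth [::] ws i).
  by move=> lt_i; rewrite (nth_map [::]).
apply/ballP/allP => [H w /(nthP [::])[i lt_i <-]|H i _].
  have size_i : i < size l by rewrite size_map.
  have := H i (leq_trans size_i size_l).
  by rewrite dropc_eq0 leqNgt size_i /= hdc_dropc nthE // run_numE.
rewrite dropc_eq0; case: leqP => //= lt_i; rewrite size_map in lt_i.
by rewrite hdc_dropc nthE // run_numE; apply: H; apply: mem_nth.
Qed.

Lemma comput_step k C D N U A : comput k C -> comput k D -> comput k N ->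
  comput k U -> comput k A ->
  comput k (fun s => step_code (tau (C s) (D s)) (N s) (U s) (A s)).
Proof.
have cv := @comput_var; move=> cC cD cN cU cA.
pose f c d n u a := step_code (tau c d) n u a.
apply: (@comput_app5 k f) => //; rewrite /f /step_code.
have chalf j i : comput j (fun s => (nth 0 s i)./2.-1) by exact/comput_pred/comput_half/cv.
apply: comput_if; last apply: comput_if.
- by apply: compb_leq; [exact/comput_succ/cv | exact: comput_const].
- exact: cv.
- exact/comput_odd/cv.
- apply: (@comput_sum 5 (fun s => nth 0 s 2) (fun s =>
     nth 0 s 0 * (tau (nth 0 s 1) (nth 0 s 2) (nth 0 s 0) (nth 0 s 5)./2.-1 == nth 0 s 4))).
    exact: cv.
  apply: comput_mulb; first exact: cv.
  by apply: compb_eq; [apply: comput_app4 | ]; rewrite //; exact: cv.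
- by apply: comput_app4; rewrite //; exact: cv.
Qed.

Lemma compb_fixes k C D N A : comput k C -> comput k D -> comput k N -> comput k A ->
  compb k (fun s => fixes_num (C s) (D s) (N s) (A s)).
Proof.
have cv := @comput_var; move=> cC cD cN cA.
pose f c d n a := nat_of_bool (fixes_num c d n a).
apply: (@comput_app4 k f) => //.
have crun j C' D' N' A' : comput j C' -> comput j D' -> comput j N' -> comput j A' ->
    comput j (fun s => run_num (C' s) (D' s) (N' s) (A' s)).
  move=> cC' cD' cN' cA'; apply: comput_app4 => //.
  apply: (@comput_rec 4 (fun s => nth 0 s 3) (fun=> 0) (fun s =>
    if dropc (nth 0 s 0) (nth 0 s 5) == 0 then nth 0 s 1 else
    step_code (tau (nth 0 s 2) (nth 0 s 3)) (nth 0 s 4) (nth 0 s 1)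
      (hdc (dropc (nth 0 s 0) (nth 0 s 5))))); [exact: cv | exact: comput_const |].
  have cdr : comput 6 (fun s => dropc (nth 0 s 0) (nth 0 s 5)).
    by apply: comput_dropc; exact: cv.
  apply: comput_if; [|exact: cv|].
    by apply: compb_eq => //; exact: comput_const.
  by apply: comput_step; [exact: cv..|exact: comput_hdc].
apply: (@compb_ball 4 (fun s => nth 0 s 3) (fun s =>
  (dropc (nth 0 s 0) (nth 0 s 4) == 0) ||
  (run_num (nth 0 s 1) (nth 0 s 2) (nth 0 s 3) (hdc (dropc (nth 0 s 0) (nth 0 s 4))) == 0))).
  exact: cv.
have cdr : comput 5 (fun s => dropc (nth 0 s 0) (nth 0 s 4)).
  by apply: comput_dropc; exact: cv.
apply: compb_or; apply: compb_eq => //; try exact: comput_const.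
by apply: crun; [exact: cv..|exact: comput_hdc].
Qed.

Lemma compb_table_ok k C D N : comput k C -> comput k D -> comput k N ->
  compb k (fun s => table_ok (D s) (N s) (tau (C s) (D s))).
Proof.
have cv := @comput_var; move=> cC cD cN.
pose f c d n (_ : nat) := nat_of_bool (table_ok d n (tau c d)).
apply: (@comput_app4 k f _ _ _ (fun=> 0)) => //; last exact: comput_const.
rewrite -[comput _ _]/(compb 4 (fun s =>
  table_ok (nth 0 s 1) (nth 0 s 2) (tau (nth 0 s 0) (nth 0 s 1)))) /table_ok.
apply: compb_and; last apply: compb_and.
- apply: (@compb_ball 4 (fun s => nth 0 s 2) (fun s => ball (nth 0 s 2) (fun j =>
    tau (nth 0 s 1) (nth 0 s 2) (nth 0 s 0) j < nth 0 s 3))); first exact: cv.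
  apply: (@compb_ball 5 (fun s => nth 0 s 2) (fun s =>
    tau (nth 0 s 2) (nth 0 s 3) (nth 0 s 1) (nth 0 s 0) < nth 0 s 4)); first exact: cv.
  by apply: compb_leq; [apply/comput_succ/comput_app4; rewrite //; exact: cv | exact: cv].
- apply: (@compb_ball 4 (fun s => nth 0 s 1) (fun s =>
    ball (nth 0 s 3) (fun u => ball (nth 0 s 3) (fun v =>
      (tau (nth 0 s 1) (nth 0 s 2) u (nth 0 s 0) == tau (nth 0 s 1) (nth 0 s 2) v (nth 0 s 0))
      ==> (u == v))))); first exact: cv.
  apply: (@compb_ball 5 (fun s => nth 0 s 3) (fun s => ball (nth 0 s 4) (fun v =>
      (tau (nth 0 s 2) (nth 0 s 3) (nth 0 s 0) (nth 0 s 1) ==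
       tau (nth 0 s 2) (nth 0 s 3) v (nth 0 s 1)) ==> (nth 0 s 0 == v)))); first exact: cv.
  apply: (@compb_ball 6 (fun s => nth 0 s 4) (fun s =>
      (tau (nth 0 s 3) (nth 0 s 4) (nth 0 s 1) (nth 0 s 2) ==
       tau (nth 0 s 3) (nth 0 s 4) (nth 0 s 0) (nth 0 s 2)) ==> (nth 0 s 1 == nth 0 s 0)));
    first exact: cv.
  apply: compb_implies; last by apply: compb_eq; exact: cv.
  by apply: compb_eq; apply: comput_app4; rewrite //; exact: cv.
apply: (@compb_ball 4 (fun s => nth 0 s 2) (fun s => (nth 0 s 0 == 0) ||
  bex (nth 0 s 0) (fun u => bex (nth 0 s 2) (fun j =>
    tau (nth 0 s 1) (nth 0 s 2) u j == nth 0 s 0)))); first exact: cv.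
apply: compb_or; first by apply: compb_eq; [exact: cv | exact: comput_const].
apply: (@compb_bex 5 (fun s => nth 0 s 0) (fun s => bex (nth 0 s 3) (fun j =>
    tau (nth 0 s 2) (nth 0 s 3) (nth 0 s 0) j == nth 0 s 1))); first exact: cv.
apply: (@compb_bex 6 (fun s => nth 0 s 3) (fun s =>
    tau (nth 0 s 3) (nth 0 s 4) (nth 0 s 1) (nth 0 s 0) == nth 0 s 2)); first exact: cv.
by apply: compb_eq; [apply: comput_app4; rewrite //; exact: cv | exact: cv].
Qed.

End Family.

Definition tau_table (c d u j : nat) : nat := hdc (dropc (u * d + j) c).
Definition tau_cycle (n d u j : nat) : nat := u.+1 - u.+1 %/ n * n.

Lemma comput_tau_table :
  comput 4 (fun s => tau_table (nth 0 s 0) (nth 0 s 1) (nth 0 s 2) (nth 0 s 3)).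
Proof.
have cv := @comput_var; apply/comput_hdc/comput_dropc; last exact: cv.
by apply: comput_add; [apply: comput_mul|]; exact: cv.
Qed.

Lemma comput_tau_cycle :
  comput 4 (fun s => tau_cycle (nth 0 s 0) (nth 0 s 1) (nth 0 s 2) (nth 0 s 3)).
Proof.
have cv := @comput_var; have cs := comput_succ (cv 4 2).
by apply: comput_sub => //; apply: comput_mul; [apply: comput_div|]; rewrite //; exact: cv.
Qed.

Definition vertex_num (d l : nat) : nat :=
  bmax (fun n => bex (2 ^ (n.+1 * (n * d))) (fun c =>
          table_ok d n (tau_table c d) && fixes_num tau_table c d n l)) l.+1.

Definition period_num (l : nat) : nat :=
  bmax (fun n => fixes_num tau_cycle n 0 n l) l.+1.

Lemma comput_vertex_num k D A : comput k D -> comput k A ->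
  comput k (fun s => vertex_num (D s) (A s)).
Proof.
have cv := @comput_var; move=> cD cA; apply: comput_app2 => //.
apply: (@comput_bmax 2 (fun s => (nth 0 s 1).+1) (fun s =>
  bex (2 ^ ((nth 0 s 0).+1 * (nth 0 s 0 * nth 0 s 1))) (fun c =>
    table_ok (nth 0 s 1) (nth 0 s 0) (tau_table c (nth 0 s 1)) &&
    fixes_num tau_table c (nth 0 s 1) (nth 0 s 0) (nth 0 s 2)))).
  exact/comput_succ/cv.
apply: (@compb_bex 3 (fun s => 2 ^ ((nth 0 s 0).+1 * (nth 0 s 0 * nth 0 s 1))) (fun s =>
    table_ok (nth 0 s 2) (nth 0 s 1) (tau_table (nth 0 s 0) (nth 0 s 2)) &&
    fixes_num tau_table (nth 0 s 0) (nth 0 s 2) (nth 0 s 1) (nth 0 s 3))).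
  apply: comput_exp; first exact: comput_const.
  by apply: comput_mul; [exact/comput_succ/cv | apply: comput_mul; exact: cv].
apply: compb_and; first by apply: (compb_table_ok comput_tau_table); exact: cv.
by apply: (compb_fixes comput_tau_table); exact: cv.
Qed.

Lemma comput_period_num k A : comput k A -> comput k (fun s => period_num (A s)).
Proof.
have cv := @comput_var; move=> cA; apply: comput_app1 => //.
apply: (@comput_bmax 1 (fun s => (nth 0 s 0).+1) (fun s =>
  fixes_num tau_cycle (nth 0 s 0) 0 (nth 0 s 0) (nth 0 s 1))).
  exact/comput_succ/cv.
by apply: (compb_fixes comput_tau_cycle); [exact: cv|exact: comput_const|exact: cv..].
Qed.

Lemma eq_step_code T T' n u c : (forall u j, T u j = T' u j) ->
  step_code T n u c = step_code T' n u c.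
Proof.
move=> E; rewrite /step_code E; case: ifP => // _; case: ifP => // _.
by apply: eq_bigr => i _; rewrite E.
Qed.

Lemma eq_fixes T T' n ws : (forall u j, T u j = T' u j) -> fixes T n ws = fixes T' n ws.
Proof.
move=> E; apply: eq_all => w; congr (_ == _); rewrite /run_codes.
by elim: w 0 => //= c w IH y; rewrite (eq_step_code _ _ _ E) IH.
Qed.

Lemma eq_table_ok d n T T' : (forall u j, T u j = T' u j) -> table_ok d n T = table_ok d n T'.
Proof.
move=> E; rewrite /table_ok; congr (_ && (_ && _)).
- by apply: eq_all => u; apply: eq_all => j; rewrite E.
- by apply: eq_all => j; apply: eq_all => u; apply: eq_all => v; rewrite !E.
- by apply: eq_all => v; congr orb; apply: eq_has => u; apply: eq_has => j; rewrite E.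
Qed.

Lemma eq_bmax (P P' : nat -> bool) n : P =1 P' -> bmax P n = bmax P' n.
Proof. by move=> E; elim: n => //= n ->; rewrite E. Qed.

Section Numerical.
Variables (d : nat) (L : seq (word (gen d))).

Lemma words_codeE : words_code L = CodeSeq.code [seq CodeSeq.code w | w <- codes L].
Proof. by rewrite /words_code /codes -map_comp. Qed.

Lemma vertex_numE : vertex_num d (words_code L) = vertex_count L.
Proof.
apply: eq_bmax => n; apply: eq_has => c; rewrite words_codeE fixes_numE.
have E u j : tau_table c d u j = table_of d (CodeSeq.decode c) u j.
  by rewrite /tau_table -{1}(CodeSeq.decodeK c) hdc_dropc.
by rewrite (eq_fixes _ _ E) (eq_table_ok _ _ E).
Qed.

Lemma period_numE : period_num (words_code L) = period L.
Proof.
apply: eq_bmax => n; rewrite words_codeE fixes_numE; apply: eq_fixes => u j.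
by rewrite /tau_cycle {1}(divn_eq u.+1 n) addKn.
Qed.
End Numerical.

(** * The decision procedure *)

Theorem theorem1p1 :
  exists f : recfun 6,
    forall (q1 d1 q2 d2 : nat)
           (L1 : seq (word (gen d1))) (L2 : seq (word (gen d2))),
      0 < q1 -> 0 < d1 -> 0 < q2 -> 0 < d2 ->
      finite_index (subgroup_of_words q1 L1) ->
      finite_index (subgroup_of_words q2 L2) ->
      let input := [tuple q1; d1; words_code L1; q2; d2; words_code L2] in
      let H1_iso_H2 := subgroups_isomorphic (subgroup_of_words q1 L1)
                                            (subgroup_of_words q2 L2) in
      (H1_iso_H2 -> rec_eval f input 1) /\
      (~ H1_iso_H2 -> rec_eval f input 0).
Proof.
(* The arguments [i], [i + 1], [i + 2] are [q], [d] and the code of the words. *)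
pose rank i s := vertex_num (nth 0 s i.+1) (nth 0 s i.+2) * (nth 0 s i.+1).-1.
pose modulus i s := nth 0 s i ^ period_num (nth 0 s i.+2).
have cv := @comput_var 6.
have crank i : comput 6 (rank i).
  by apply: comput_mul; [apply: comput_vertex_num; exact: cv | exact/comput_pred/cv].
have cmod i : comput 6 (modulus i).
  by apply: comput_exp; [exact: cv | exact/comput_period_num/cv].
have [f fP] : compb 6 (fun s => [&& rank 0 s == rank 3 s, modulus 0 s == modulus 3 s &
    (rank 0 s == 0) || (nth 0 s 0 == nth 0 s 3)]).
  apply: compb_and; first exact: compb_eq.
  apply: compb_and; first exact: compb_eq.
  by apply: compb_or; apply: compb_eq; rewrite //; exact: comput_const.
exists f => q1 d1 q2 d2 L1 L2 q1_gt0 d1_gt0 q2_gt0 d2_gt0 fin1 fin2 input iso12.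
have h1 := @subgroup_of_words_subgrp q1 d1 L1.
have h2 := @subgroup_of_words_subgrp q2 d2 L2.
have [O1 [o1 [r1 rP1]]] := finite_index_action h1 fin1.
have [O2 [o2 [r2 rP2]]] := finite_index_action h2 fin2.
have pP1 := periodP rP1 d1_gt0; have pP2 := periodP rP2 d2_gt0.
have := iso_criterion q1_gt0 q2_gt0 d1_gt0 d2_gt0 h1 h2 rP1 rP2 pP1 pP2.
rewrite /= -/iso12 -(vertex_countE rP1 d1_gt0) -(vertex_countE rP2 d2_gt0) => crit.
have := fP input; rewrite /rank /modulus /= !vertex_numE !period_numE.
set b := [&& _, _ & _] => fb.
have bP : b <-> iso12.
  rewrite crit; split=> [/and3P[/eqP E1 /eqP E2 /orP E3]|[E1 E2 E3]].
    by split=> //; case: E3 => /eqP E3; [left | right].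
  apply/and3P; split; [exact/eqP | exact/eqP | apply/orP].
  by case: E3 => E3; [left | right]; exact/eqP.
split=> iso; move: fb; first by have /bP -> := iso.
by have /negbTE -> : ~~ b by apply/negP => /bP.
Qed.
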